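(* Let $\varepsilon>0$, let $\nu$ be a probability measure with finite second moment on $\mathcal{Y}\subset\mathbb{R}^d$, and let $\theta^\varepsilon\in\ell_1(\Lambda)$ be the minimizer of $H_\varepsilon$ over $\ell_1(\Lambda)$. Let $w=(w_\lambda)_{\lambda\in\Lambda}$ be a deterministic sequence of positive weights with $w_{-\lambda}=w_\lambda$ and $\sum_{\lambda\in\Lambda}w_\lambda<+\infty$. Let $(Y_n)_{n\ge1}$ be independent random vectors with common distribution $\nu$, and let $(\widehat\theta_n)_{n\ge0}$ be defined by $$\widehat\theta_{n+1}=\widehat\theta_n-\gamma_n W D_\theta h_\varepsilon(\widehat\theta_n,Y_{n+1}),\qquad n\ge0,$$ where $\gamma_0>0$ and $\gamma_n=\gamma n^{-c}$ for $n\ge1$, with $\gamma>0$ and $1/2<c\le1$. Suppose that the initial value $\widehat\theta_0$ is any random element of $\ell_2(\Lambda)$ such that $\|\widehat\theta_0\|_{W^{-1}}<+\infty$. Assume moreover that: (i) $\|\theta^\varepsilon\|_{W^{-1}}<+\infty$; (ii) there exists a constant $c_\varepsilon>0$ such that the second order Fréchet derivative of $H_\varepsilon$ at $\theta^\varepsilon$ satisfies $D^2H_\varepsilon(\theta^\varepsilon)[\tau,\tau]\ge c_\varepsilon\|\tau\|_{\ell_2}^2$ for every $\tau\in\ell_1(\Lambda)$. Then $(\widehat\theta_n)$ converges almost surely in $\ell_2$ to $\theta^\varepsilon$: $$\lim_{n\to\infty}\|\widehat\theta_n-\theta^\varepsilon\|_{\ell_2}=0\quad\text{a.s.}$$ Equivalently,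 with $\widehat u_\varepsilon^{\,n}(x)=\sum_{\lambda\in\Lambda}\widehat\theta_{n,\lambda}\phi_\lambda(x)$ and $u_\varepsilon(x)=\sum_{\lambda\in\Lambda}\theta^\varepsilon_\lambda\phi_\lambda(x)$, $$\lim_{n\to\infty}\int_{\mathcal X}|\widehat u_\varepsilon^{\,n}(x)-u_\varepsilon(x)|^2\,d\mu(x)=0\quad\text{a.s.}$$
   Context: $\mathcal X=[0,1]^d$, $\mu$ is the uniform (Lebesgue) probability measure on $\mathcal X$, $\Lambda=\mathbb Z^d\setminus\{0\}$, $\phi_\lambda(x)=e^{2\pi i\langle\lambda,x\rangle}$, and $c(x,y)=\frac12\|x-y\|^2$ is the quadratic cost. $\ell_1(\Lambda)$, $\ell_2(\Lambda)$, $\ell_\infty(\Lambda)$ denote the real Banach spaces of families $\theta=(\theta_\lambda)_{\lambda\in\Lambda}\in\mathbb C^\Lambda$ with $\theta_{-\lambda}=\overline{\theta_\lambda}$ and, respectively, $\|\theta\|_{\ell_1}=\sum_\lambda|\theta_\lambda|<\infty$, $\|\theta\|_{\ell_2}^2=\sum_\lambda|\theta_\lambda|^2<\infty$, $\|\theta\|_{\ell_\infty}=\sup_\lambda|\theta_\lambda|<\infty$. For $\theta\in\ell_1(\Lambda)$, $y\in\mathcal Y$: $$h_\varepsilon(\theta,y)=\varepsilon\log\Big(\int_{\mathcal X}\exp\Big(\frac{\sum_{\lambda\in\Lambda}\theta_\lambda\phi_\lambda(x)-c(x,y)}{\varepsilon}\Big)d\mu(x)\Big)+\varepsilon,\qquad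 H_\varepsilon(\theta)=\mathbb E[h_\varepsilon(\theta,Y)],\ Y\sim\nu.$$ The Fréchet derivative $D_\theta h_\varepsilon(\theta,y)$ is identified with the element of $\ell_\infty(\Lambda)$ whose components are $$\frac{\partial h_\varepsilon(\theta,y)}{\partial\theta_\lambda}=\int_{\mathcal X}\overline{\phi_\lambda(x)}F_{\theta,y}(x)\,d\mu(x),\qquad F_{\theta,y}(x)=\frac{\exp\big(\frac{\sum_{\lambda}\theta_\lambda\phi_\lambda(x)-c(x,y)}{\varepsilon}\big)}{\int_{\mathcal X}\exp\big(\frac{\sum_{\lambda}\theta_\lambda\phi_\lambda(z)-c(z,y)}{\varepsilon}\big)d\mu(z)}.$$ It is a standing assumption that a minimizer $\theta^\varepsilon$ of $H_\varepsilon$ over $\ell_1(\Lambda)$ exists (it is then unique). $W:\ell_\infty(\Lambda)\to\ell_1(\Lambda)$ is the linear operator $(v_\lambda)_\lambda\mapsto(w_\lambda v_\lambda)_\lambda$. The weighted norm is $\|\theta\|_{W^{-1}}^2=\sum_{\lambda\in\Lambda}w_\lambda^{-1}|\theta_\lambda|^2\in[0,+\infty]$. (If $\|\theta\|_{W^{-1}}<\infty$ then $\theta\in\ell_1(\Lambda)$ by Cauchy–Schwarz.) *)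

(* Defs.v *)
From HB Require Import structures.
From mathcomp Require Import all_boot all_order all_algebra finmap.
From mathcomp Require Import all_classical all_reals all_analysis.
From mathcomp Require Export complex.
From mathcomp Require Import ring lra.

Set Implicit Arguments.
Unset Strict Implicit.
Unset Printing Implicit Defensive.

Import Order.TTheory GRing.Theory Num.Theory.
Import numFieldNormedType.Exports.
Import ComplexField.Normc.

Local Open Scope classical_set_scope.
Local Open Scope ring_scope.
Local Open Scope complex_scope.

Definition freq (d : nat) := {l : 'rV[int]_d | l != 0}.
HB.instance Definition _ d := Countable.on (freq d).

Lemma freq_opp_subproof d (l : freq d) : - val l != 0.
Proof. by rewrite oppr_eq0; case: l. Qed.

Definition freq_opp d (l : freq d) : freq d :=
  exist _ (- val l) (freq_opp_subproof l).

Lemma freq_oppK d : involutive (@freq_opp d).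
Proof. by move=> l; apply/val_inj; rewrite /= opprK. Qed.

Section sequence_spaces.
Context {R : realType} {d : nat}.
Implicit Types (t : freq d -> R[i]).

Definition hermitian t := forall l, t (freq_opp l) = (t l)^*%C.

Definition l1norm t : \bar R := \esum_(l in [set: freq d]) (normc (t l))%:E.
Definition l2norm t : \bar R :=
  sqrte (\esum_(l in [set: freq d]) (normc (t l) ^+ 2)%:E).

Definition in_l1 t := hermitian t /\ (l1norm t < +oo)%E.
Definition in_l2 t := hermitian t /\ (l2norm t < +oo)%E.

Definition weightop (w : freq d -> R) t : freq d -> R[i] :=
  fun l => (w l)%:C * t l.

Definition sqwnorm (w : freq d -> R) t : \bar R :=
  \esum_(l in [set: freq d]) ((w l)^-1 * normc (t l) ^+ 2)%:E.

Lemma l1norm_ge0 t : (0 <= l1norm t)%E.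
Proof.
by apply: esum_ge0 => l _; rewrite lee_fin; case: (t l) => a b; exact: sqrtr_ge0.
Qed.

End sequence_spaces.

Record ell1 (R : realType) (d : nat) := Ell1 {
  ell1_val :> freq d -> R[i];
  ell1P : in_l1 ell1_val }.

Section ell1_normed_module.
Context {R : realType} {d : nat}.
Local Notation E := (ell1 R d).

Lemma ell1_inj (s t : E) : (s : freq d -> R[i]) = t -> s = t.
Proof.
by case: s t => [s hs] [t ht] /= st; subst t; congr Ell1; exact: Prop_irrelevance.
Qed.

HB.instance Definition _ := gen_eqMixin E.
HB.instance Definition _ := gen_choiceMixin E.

Lemma normc_ge0 (z : R[i]) : 0 <= normc z.
Proof. by case: z => a b; exact: sqrtr_ge0. Qed.

Lemma ell1_fin (t : E) : l1norm t \is a fin_num.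
Proof. by rewrite ge0_fin_numE ?l1norm_ge0//; case: (ell1P t). Qed.

Lemma l1normD (s t : freq d -> R[i]) :
  (l1norm (fun l => s l + t l)%R <= l1norm s + l1norm t)%E.
Proof.
rewrite /l1norm -esumD; [|by move=> l _; rewrite lee_fin normc_ge0..].
by apply: le_esum => l _; rewrite -EFinD lee_fin le_normcD.
Qed.

Lemma normcZ (a : R) (z : R[i]) : normc (a%:C * z) = `|a| * normc z.
Proof. by rewrite normcM /normc /= expr0n/= addr0 sqrtr_sqr. Qed.

Lemma l1normZ (a : R) (t : freq d -> R[i]) :
  l1norm (fun l => a%:C * t l)%R = (`|a|%:E * l1norm t)%E.
Proof.
have le (b : R) (u : freq d -> R[i]) :
    (l1norm (fun l => b%:C * u l)%R <= `|b|%:E * l1norm u)%E.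
  apply: ge_ereal_sup => _ [A [finA _] <-].
  rewrite (eq_fsbigr (fun l => (`|b|%:E * (normc (u l))%:E)%E)); last first.
    by move=> l _; rewrite -EFinM -normcZ.
  rewrite -ge0_mule_fsumr; last by move=> l; rewrite lee_fin normc_ge0.
  by apply: lee_wpmul2l => //; apply: ereal_sup_ubound; exists A.
apply/le_anti/andP; split; first exact: le.
have [->|a0] := eqVneq a 0; first by rewrite normr0 mul0e l1norm_ge0.
have aP : (0 < `|a|%:E)%E by rewrite lte_fin normr_gt0.
have := le a^-1 (fun l => a%:C * t l).
have -> : (fun l => (a^-1)%:C * (a%:C * t l)) = t.
  by apply/funext => l; rewrite mulrA -rmorphM/= mulVf// mul1r.
by rewrite -(lee_pmul2l _ aP)// muleA -EFinM normfV divff ?normr_eq0// mul1e.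
Qed.

Lemma in_l1D (s t : E) : in_l1 (fun l => s l + t l).
Proof.
case: (ell1P s) (ell1P t) => [hs ns] [ht nt]; split.
  by move=> l; rewrite hs ht rmorphD.
by apply: le_lt_trans (l1normD _ _) _; exact: lte_add_pinfty.
Qed.

Lemma in_l1Z (a : R) (t : E) : in_l1 (fun l => a%:C * t l).
Proof.
case: (ell1P t) => ht nt; split.
  by move=> l; rewrite ht rmorphM/=; congr (_ * _); rewrite /conjc/= oppr0.
by rewrite l1normZ; apply: lte_mul_pinfty; rewrite ?lee_fin ?fin_numE.
Qed.

Lemma in_l10 : in_l1 (fun _ : freq d => 0 : R[i]).
Proof.
split; first by move=> l; rewrite rmorph0.
by rewrite /l1norm esum1 ?ltry// => l _; rewrite normc0.
Qed.

Lemma in_l1N (t : E) : in_l1 (fun l => - t l).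
Proof.
rewrite (_ : (fun _ => _) = fun l => (-1)%:C * t l); first exact: in_l1Z.
by apply/funext => l; rewrite rmorphN1 mulN1r.
Qed.

Definition ell1_add s t := Ell1 (in_l1D s t).
Definition ell1_opp t := Ell1 (in_l1N t).
Definition ell1_zero := Ell1 in_l10.
Definition ell1_scale a t := Ell1 (in_l1Z a t).

Let addA : associative ell1_add.
Proof. by move=> r s t; apply: ell1_inj; apply/funext => l /=; rewrite addrA. Qed.
Let addC : commutative ell1_add.
Proof. by move=> s t; apply: ell1_inj; apply/funext => l /=; rewrite addrC. Qed.
Let add0 : left_id ell1_zero ell1_add.
Proof. by move=> t; apply: ell1_inj; apply/funext => l /=; rewrite add0r. Qed.
Let addN : left_inverse ell1_zero ell1_opp ell1_add.
Proof. by move=> t; apply: ell1_inj; apply/funext => l /=; rewrite addNr. Qed.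

HB.instance Definition _ := GRing.isZmodule.Build E addA addC add0 addN.

Let scaleA a b t : ell1_scale a (ell1_scale b t) = ell1_scale (a * b) t.
Proof. by apply: ell1_inj; apply/funext => l /=; rewrite mulrA -rmorphM. Qed.
Let scale1 : left_id 1 ell1_scale.
Proof. by move=> t; apply: ell1_inj; apply/funext => l /=; rewrite rmorph1 mul1r. Qed.
Let scaleDr : right_distributive ell1_scale +%R.
Proof. by move=> a s t; apply: ell1_inj; apply/funext => l /=; rewrite mulrDr. Qed.
Let scaleDl t : {morph ell1_scale^~ t : a b / a + b}.
Proof.
by move=> a b; apply: ell1_inj; apply/funext => l /=; rewrite rmorphD mulrDl.
Qed.

HB.instance Definition _ :=
  GRing.Zmodule_isLmodule.Build R E scaleA scale1 scaleDr scaleDl.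

Definition ell1_norm (t : E) : R := fine (l1norm t).

Let normD s t : ell1_norm (s + t) <= ell1_norm s + ell1_norm t.
Proof.
rewrite -lee_fin EFinD !fineK ?ell1_fin//; exact: l1normD.
Qed.
Let normZ a t : ell1_norm (a *: t) = `|a| * ell1_norm t.
Proof. by rewrite /ell1_norm l1normZ fineM ?ell1_fin. Qed.
Let norm0 t : ell1_norm t = 0 -> t = 0.
Proof.
move=> t0; apply: ell1_inj; apply/funext => l /=; apply: eq0_normc.
apply/le_anti/andP; split; last exact: normc_ge0.
rewrite -t0 -lee_fin fineK ?ell1_fin//.
rewrite -[leLHS](@esum_set1 _ _ l (fun l => (normc (t l))%:E)); last first.
  by rewrite lee_fin normc_ge0.
rewrite /l1norm esum_mkcond; apply: le_esum => k _.
by case: ifP => // _; rewrite lee_fin normc_ge0.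
Qed.

HB.instance Definition _ := Lmodule_isNormed.Build R E normD normZ norm0.

End ell1_normed_module.

Section second_derivative.
Context {R : realType} {V : normedModType R}.
Implicit Types (f : V -> R) (x : V) (B : V -> V -> R).

(* [B] is the Frechet derivative at [x] of [z |-> 'd f z], seen as a map into
   the continuous linear forms with the operator norm, [B h] being the image of
   the increment [h]. *)
Definition is_diff2 f x B :=
  [/\ \forall z \near x, differentiable f z,
      forall h, linear (B h : V -> R^o) /\ linear (B^~ h : V -> R^o),
      exists M : R, forall h k, `|B h k| <= M * `|h| * `|k| &
      forall e : R, 0 < e -> \forall h \near (0 : V), forall k,
        `|'d f (x + h) k - 'd f x k - B h k| <= e * `|h| * `|k|].

(* Null when [f] has no second Frechet derivative at [x]; [diff2E] covers the
   other case. *)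
Definition diff2 f x : V -> V -> R := xget (fun _ _ => 0) (is_diff2 f x).

Lemma is_diff2_unique f x B B' : is_diff2 f x B -> is_diff2 f x B' -> B = B'.
Proof.
move=> [_ lB _ dB] [_ lB' _ dB']; apply/funext => h; apply/funext => k.
apply/eqP; rewrite -subr_eq0 -normr_le0; apply/ler_addgt0Pr => e e0.
rewrite add0r.
pose C := `|h| * `|k| + 1.
have C0 : 0 < C by rewrite ltr_wpDl// mulr_ge0.
have e'0 : 0 < e / C / 2 by rewrite !divr_gt0.
have c0 : (t *: h) @[t --> (0 : R)^'+] --> (0 : V).
  rewrite -[X in _ --> X](scale0r h); apply: (@cvgZ _ _ _ _ _ id (cst h)).
    by apply: cvg_at_right_filter; exact: cvg_id.
  exact: cvg_cst.
have [t [/= t0 [/(_ k) b1 /(_ k) b2]]] := filter_ex (filterI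
  (nbhs_right_gt (0 : R)) (filterI (c0 _ (dB _ e'0)) (c0 _ (dB' _ e'0)))).
have BZ G : linear (G^~ k : V -> R^o) -> G (t *: h) k = t * G h k.
  move=> lG; have := lG t h 0; rewrite addr0 => ->.
  have := lG (-1) 0 0; rewrite scaler0 addr0 scaleN1r addNr => ->.
  by rewrite addr0.
move: b1 b2; rewrite (BZ B (lB k).2) (BZ B' (lB' k).2) normrZ (gtr0_norm t0).
set u := 'd f _ _ - _ => b1 b2.
have : `|t * (B h k - B' h k)| <= e / C * (t * `|h|) * `|k|.
  have -> : t * (B h k - B' h k) = (u - t * B' h k) - (u - t * B h k) by ring.
  apply: le_trans (ler_normB _ _) _; lra.
rewrite normrM (gtr0_norm t0) mulrCA -!mulrA ler_pM2l// => /le_trans; apply.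
by rewrite ger_pMr// ler_pdivrMl// mulr1 /C lerDl ler01.
Qed.

Lemma diff2E f x B : is_diff2 f x B -> diff2 f x = B.
Proof.
by move=> fB; exact: is_diff2_unique (xgetPex _ (ex_intro _ B fB)) fB.
Qed.

End second_derivative.

Section unit_cube.
Context {R : realType}.

(* The library puts [uniform_prob] on [measurableTypeR R], which has the carrier
   and the measurable sets of [R] but another display. *)
Definition tuple_cons d (p : measurableTypeR R * d.-tuple R) : d.+1.-tuple R :=
  [tuple of (p.1 : R) :: p.2].

Lemma measurable_tuple_cons d : measurable_fun setT (@tuple_cons d).
Proof.
apply: (@measurable_cons _ _ _ _ (fun p => p.1 : R)) => // _ A mA.
exact: (@measurable_fst _ _ (measurableTypeR R) (d.-tuple R)).
Qed.

HB.instance Definition _ d :=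
  isMeasurableFun.Build _ _ _ _ (@tuple_cons d) (@measurable_tuple_cons d).

(* The d-fold product of the uniform probability on [0, 1], that is, the
   Lebesgue measure restricted to [0, 1]^d, see [unif_cube_box]. *)
Fixpoint unif_cube (d : nat) : probability (d.-tuple R) R :=
  match d with
  | 0 => \d_([tuple] : 0.-tuple R)
  | d'.+1 => distribution (uniform_prob (@ltr01 R) \x unif_cube d')%E
      (@tuple_cons d')
  end.

Definition cube (d : nat) : set (d.-tuple R) :=
  [set x | forall i, 0 <= tnth x i <= 1].

Lemma measurable_box d (A : 'I_d -> set R) : (forall i, measurable (A i)) ->
  measurable [set x : d.-tuple R | forall i, A i (tnth x i)].
Proof.
move=> mA; rewrite (_ : [set x | _] =
    \bigcap_(i in [set: 'I_d]) ((fun x : d.-tuple R => tnth x i) @^-1` A i)).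
  apply: fin_bigcap_measurable => // i _; rewrite -[X in measurable X]setTI.
  exact: measurable_tnth.
by apply/seteqP; split => x /= Ax i; [move=> _|]; exact: Ax.
Qed.

Lemma unif_cube_box d (A : 'I_d -> set R) : (forall i, measurable (A i)) ->
  unif_cube d [set x | forall i, A i (tnth x i)] =
  (\prod_(i < d) uniform_prob (@ltr01 R) (A i))%E.
Proof.
elim: d A => [|d IH] A mA.
  by rewrite big_ord0 /= diracE mem_set//=; case.
rewrite big_ord_recl -(IH (fun i => A (lift ord0 i)))//.
rewrite -product_measure1E; [|exact: mA|by apply: (@measurable_box d (fun i => A (lift ord0 i)))].
rewrite [LHS]/= /distribution /pushforward.
congr ((_ \x _)%E _); apply/seteqP; split => -[a x] /=.
  move=> Ax; split; first exact: (Ax ord0).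
  by move=> i; have := Ax (lift ord0 i); rewrite tnthS.
move=> [Aa Ax] i; case: (unliftP ord0 i) => [j ->|->//].
by rewrite tnthS; exact: Ax.
Qed.

End unit_cube.
Arguments unif_cube {R}.
Arguments cube {R}.

Section complex_sum_integral.
Context {R : realType}.

(* Sum of a summable real family: [esum] is only meaningful on nonnegative
   families, hence the split into positive and negative parts. *)
Definition rsum (I : choiceType) (f : I -> R) : R :=
  fine (\esum_(i in [set: I]) ((EFin \o f)^\+ i)%E) -
  fine (\esum_(i in [set: I]) ((EFin \o f)^\- i)%E).

Definition csum (I : choiceType) (f : I -> R[i]) : R[i] :=
  rsum (fun i => complex.Re (f i)) +i* rsum (fun i => complex.Im (f i)).

Definition cintegral dT (T : measurableType dT) (mu : {measure set T -> \bar R})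
    (D : set T) (f : T -> R[i]) : R[i] :=
  (\int[mu]_(x in D) complex.Re (f x)) +i* (\int[mu]_(x in D) complex.Im (f x)).

End complex_sum_integral.

Section entropic_potentials.
Context {R : realType} {d : nat}.
Implicit Types (eps : R) (t : freq d -> R[i]) (x y : d.-tuple R) (l : freq d).

Definition phase l x : R := 2 * pi * \sum_(i < d) (val l 0 i)%:~R * tnth x i.

Definition phi l x : R[i] := cos (phase l x) +i* sin (phase l x).

Definition fourier t x : R[i] := csum (fun l => t l * phi l x).

Lemma fourier_real t x : hermitian t -> complex.Im (fourier t x) = 0.
Proof.
move=> ht; rewrite /fourier /csum /= /rsum.
set g : freq d -> R := fun l => complex.Im (t l * phi l x).
have gN l : g (freq_opp l) = - g l.
  rewrite /g ht /phi.
  have -> : phase (freq_opp l) x = - phase l x.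
    rewrite /phase -mulrN -sumrN; congr (_ * _); apply: eq_bigr => i _.
    by rewrite /= mxE rmorphN mulNr.
  rewrite cosN sinN; case: (t l) => a b /=; ring.
apply/eqP; rewrite subr_eq0; apply/eqP; congr fine.
rewrite (@reindex_esum R _ _ setT setT (@freq_opp d)).
- apply: eq_esum => l _.
  by rewrite funeposE funenegE /= -/(g _) gN EFinN.
- split=> [//|l k _ _|k _]; first exact: (can_inj (@freq_oppK d)).
  by exists (freq_opp k) => //; rewrite freq_oppK.
Qed.

Definition cost x y : R := 2^-1 * \sum_(i < d) (tnth x i - tnth y i) ^+ 2.

Definition gibbs eps t y x : R := expR ((complex.Re (fourier t x) - cost x y) / eps).

Definition partition_fun eps t y : R :=
  \int[unif_cube d]_(x in cube d) gibbs eps t y x.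

Definition h_eps eps t y : R := eps * ln (partition_fun eps t y) + eps.

Definition H_eps eps (nu : probability (d.-tuple R) R) (Y : set (d.-tuple R)) t : R :=
  \int[nu]_(y in Y) h_eps eps t y.

Definition F_eps eps t y x : R := gibbs eps t y x / partition_fun eps t y.

(* A derivative on the real space l1 is represented by the hermitian bounded
   family [v] that acts as [tau |-> \sum_l tau l * (v l)^*]; this is why the
   component of index [l] carries [(phi l x)^*]. *)
Definition Dh_eps eps t y : freq d -> R[i] :=
  fun l => cintegral (unif_cube d) (cube d)
    (fun x => (phi l x)^*%C * (F_eps eps t y x)%:C).

End entropic_potentials.

Section probability_notions.
Context {R : realType} {dO : measure_display} {Omega : measurableType dO}
  (P : probability Omega R).

Definition mutually_independent dT (T : measurableType dT)
    (X : nat -> {RV P >-> T}) : Prop :=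
  forall (J : {fset nat}) (A : nat -> set T), (forall n, measurable (A n)) ->
    P (\bigcap_(n in [set` J]) (X n @^-1` A n)) =
    (\prod_(n <- J) P (X n @^-1` A n))%E.

Definition has_law dT (T : measurableType dT) (X : {RV P >-> T})
    (nu : probability T R) : Prop :=
  forall A, measurable A -> distribution P X A = nu A.

(* l2 is separable, so that Borel measurability of an l2-valued map amounts to
   the measurability of its coordinates. *)
Definition l2_random_element d (X : Omega -> freq d -> R[i]) : Prop :=
  (forall om, in_l2 (X om)) /\
  (forall l, measurable_fun [set: Omega] (fun om => complex.Re (X om l)) /\
             measurable_fun [set: Omega] (fun om => complex.Im (X om l))).

End probability_notions.

Definition step_size {R : realType} (gamma0 gamma c : R) (n : nat) : R :=
  if n is 0 then gamma0 else gamma * n%:R `^ (- c).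

(* Main.v *)
Require Import Defs.
From HB Require Import structures.
From mathcomp Require Import all_boot all_order all_algebra finmap.
From mathcomp Require Import all_classical all_reals all_analysis.
From mathcomp Require Import complex.
From mathcomp Require Import measurable_realfun ring lra.

Set Implicit Arguments.
Unset Strict Implicit.
Unset Printing Implicit Defensive.

Import Order.TTheory GRing.Theory Num.Theory.
Import numFieldNormedType.Exports.
Import ComplexField.Normc.

Local Open Scope classical_set_scope.
Local Open Scope ring_scope.

(* Idea. Write tau for the minimizer. In real coordinates the recursion is a
   stochastic gradient descent, preconditioned by the weights, on the expectation
   of the convex functions fr(., Y), and the squared distance in L2(mu) between two
   potentials is the variance of their difference.
   1. On l1-balls, fr(., y) is strongly convex at midpoints with respect to this
      variance, up to a factor kap(y) > 0. Hence, for the reference trajectory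
      a_n started at tau, the squared weighted distance to tau, corrected
      by the remaining sum of the gamma_k^2, is a nonnegative supermartingale
      whose drift controls gamma_n Var(a_n - tau). So a_n stays bounded and
      sum_n gamma_n Var(a_n - tau) < oo almost surely.
   2. The initial value may depend on the whole sequence (Y_n), so theta_n itself
      gives no supermartingale. Instead theta_n is compared pathwise with a_n:
      both are driven by the same samples, and the strong monotonicity of the
      gradient gives sum_n gamma_n kap(Y_(n+1)) Var(theta_n - a_n) < oo on
      almost every path, whatever theta_0 is.
   3. The variances vary by O(gamma_n) per step, the gamma_n have infinite sum, and
      sum_n gamma_n (kap(Y_(n+1)) - E kap(Y)) converges almost surely. Hence
      both variances tend to 0. *)

(** * Expectations of bounded measurable functions *)

(** At tau only the mean of the sample gradients vanishes, not each of them, so a pathwise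
    comparison with tau itself leaves a first-order error. Between two runs on the same samples the
    error is multiplicative, a factor 1 + O(gamma_n^2), which the summable squares absorb. Since a_n
    depends only on the first n samples, Y_(n+1) can be averaged out there, and the mean of kap
    appears at once. On an arbitrary path the factor kap(Y_(n+1)) remains. It may have no positive
    lower bound, as the cost grows with y; this is why the centred sums of kap are needed. Convexity
    is used through midpoints, so only values and gradients of the functional enter. The convexity
    factor decays with the l1-radius, so boundedness has to be proved before summability. Distances
    are measured with the inverse weights: the preconditioner then cancels in the cross term, and
    summability of the weights turns the energy into a bound on the l1-norm. Frequency 0 being
    excluded, potentials have mean zero, and the variance is the squared l2 distance. Conditional
    expectations are replaced by Fubini on the law of the list of past samples. *)

Section bounded_measurable.
Context {R : realType} {dX : measure_display} {X : measurableType dX}.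
Implicit Types (u v : X -> R) (M : R).

(** The bound is required at every point, not almost everywhere. The class is stable under all
    operations used below, and under a probability each member is integrable. *)
Definition bmf u := measurable_fun setT u /\ exists M, forall x, `|u x| <= M.

Lemma bmf_bound u M : measurable_fun setT u -> (forall x, `|u x| <= M) -> bmf u.
Proof. by move=> mu uM; split=> //; exists M. Qed.

Lemma bmf_cst (a : R) : bmf (fun _ => a).
Proof. by apply: (@bmf_bound _ `|a|). Qed.

Lemma bmfD u v : bmf u -> bmf v -> bmf (fun x => u x + v x).
Proof.
move=> [mu [M uM]] [mv [N vN]]; apply: (@bmf_bound _ (M + N)).
  exact: measurable_funD.
by move=> x; rewrite (le_trans (ler_normD _ _))// lerD.
Qed.

Lemma bmfM u v : bmf u -> bmf v -> bmf (fun x => u x * v x).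
Proof.
move=> [mu [M uM]] [mv [N vN]]; apply: (@bmf_bound _ (M * N)).
  exact: measurable_funM.
by move=> x; rewrite normrM ler_pM.
Qed.

Lemma bmfZ (a : R) u : bmf u -> bmf (fun x => a * u x).
Proof. by move=> bu; apply: bmfM => //; exact: bmf_cst. Qed.

Lemma bmfB u v : bmf u -> bmf v -> bmf (fun x => u x - v x).
Proof.
move=> bu bv; have -> : (fun x => u x - v x) = (fun x => u x + (-1) * v x).
  by apply/funext => x; rewrite mulN1r.
by apply: bmfD => //; exact: bmfZ.
Qed.

Lemma bmf_sqr u : bmf u -> bmf (fun x => u x ^+ 2).
Proof.
by move=> bu; under [X in bmf X]funext do rewrite expr2; exact: bmfM.
Qed.

Lemma bmf_norm u : bmf u -> bmf (fun x => `|u x|).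
Proof.
move=> [mu [M uM]]; apply: (@bmf_bound _ M); first exact: measurableT_comp.
by move=> x; rewrite normr_id.
Qed.

Lemma bmf_expR u : bmf u -> bmf (fun x => expR (u x)).
Proof.
move=> [mu [M uM]]; apply: (@bmf_bound _ (expR M)).
  exact: measurableT_comp.
move=> x; rewrite ger0_norm ?expR_ge0// ler_expR.
by rewrite (le_trans (ler_norm _)).
Qed.

Context (mu : probability X R).
Local Notation mean u := (\int[mu]_x u x).

Lemma bmf_integrable u : bmf u -> mu.-integrable setT (EFin \o u).
Proof.
move=> [mfu [M uM]]; apply: measurable_bounded_integrable => //.
  by move: (ltry (1 : R)); rewrite -(probability_setT mu).
exists M; split; first exact: num_real.
by move=> N MN x _; apply: le_trans (ltW MN); exact: uM.
Qed.

Lemma bmf_integralE u : bmf u -> (\int[mu]_x (u x)%:E = (mean u)%:E)%E.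
Proof.
move=> bu; rewrite fineK//.
exact: (integrable_fin_num measurableT (bmf_integrable bu)).
Qed.

Lemma meanD u v : bmf u -> bmf v -> \int[mu]_x (u x + v x) = mean u + mean v.
Proof. by move=> bu bv; rewrite RintegralD//; exact: bmf_integrable. Qed.

Lemma meanB u v : bmf u -> bmf v -> \int[mu]_x (u x - v x) = mean u - mean v.
Proof. by move=> bu bv; rewrite RintegralB//; exact: bmf_integrable. Qed.

Lemma meanZ (a : R) u : bmf u -> \int[mu]_x (a * u x) = a * mean u.
Proof. by move=> bu; rewrite RintegralZl//; exact: bmf_integrable. Qed.

Lemma mean_cst (a : R) : \int[mu]_x a = a.
Proof.
rewrite Rintegral_cst//; transitivity (a * fine (1%E : \bar R)).
  by congr (_ * fine _); exact: probability_setT.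
by rewrite /= mulr1.
Qed.

Lemma le_mean u v : bmf u -> bmf v -> (forall x, u x <= v x) -> mean u <= mean v.
Proof. by move=> bu bv uv; apply: le_Rintegral => //; exact: bmf_integrable. Qed.

Lemma norm_mean_le u : bmf u -> `|mean u| <= \int[mu]_x `|u x|.
Proof. by move=> bu; apply: le_normr_Rintegral => //; exact: bmf_integrable. Qed.

Lemma mean_norm_bound u M : bmf u -> (forall x, `|u x| <= M) -> `|mean u| <= M.
Proof.
move=> bu uM; rewrite -[leRHS]mean_cst (le_trans (norm_mean_le bu))// le_mean//.
  exact: bmf_norm.
exact: bmf_cst.
Qed.

Definition var u : R := \int[mu]_x (u x ^+ 2) - (mean u) ^+ 2.

Lemma var_shift u (a : R) : bmf u ->
  \int[mu]_x ((u x - a) ^+ 2) = var u + (mean u - a) ^+ 2.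
Proof.
move=> bu.
under eq_Rintegral.
  move=> x _.
  have -> : (u x - a) ^+ 2 = u x ^+ 2 + (- (2 * a) * u x + a ^+ 2) by ring.
  over.
rewrite meanD; [|exact: bmf_sqr|by apply: bmfD; [exact: bmfZ|exact: bmf_cst]].
rewrite meanD; [|exact: bmfZ|exact: bmf_cst].
rewrite meanZ// mean_cst /var; ring.
Qed.

Lemma var_ge0 u : bmf u -> 0 <= var u.
Proof.
move=> bu; have := var_shift (mean u) bu.
rewrite subrr expr0n/= addr0 => <-.
by apply: Rintegral_ge0 => x _; exact: sqr_ge0.
Qed.

Lemma var_le_shift u (a : R) : bmf u -> var u <= \int[mu]_x ((u x - a) ^+ 2).
Proof. by move=> bu; rewrite var_shift// lerDl sqr_ge0. Qed.

(** Parallelogram inequality, applied pointwise to the centred functions. It serves to combine the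
    distance from iterate to reference with the distance from reference to minimizer. *)
Lemma varD_le u v : bmf u -> bmf v ->
  var (fun x => u x + v x) <= 2 * var u + 2 * var v.
Proof.
move=> bu bv; apply: (le_trans (var_le_shift (mean u + mean v) (bmfD bu bv))).
have bs w : bmf w -> bmf (fun x => (w x - mean w) ^+ 2).
  by move=> bw; apply: bmf_sqr; apply: bmfB => //; exact: bmf_cst.
have vE w : bmf w -> var w = \int[mu]_x ((w x - mean w) ^+ 2).
  by move=> bw; rewrite var_shift// subrr expr0n addr0.
rewrite (vE u)// (vE v)// -!meanZ; [|exact: bs..].
rewrite -[leRHS]meanD; [|by apply: bmfZ; exact: bs|by apply: bmfZ; exact: bs].
apply: le_mean => [||x].
- by apply: bmf_sqr; apply: bmfB; [exact: bmfD|exact: bmf_cst].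
- by apply: bmfD; apply: bmfZ; exact: bs.
- rewrite -subr_ge0.
  set a := u x; set b := v x; set c := mean u; set e := mean v.
  have -> : 2 * (a - c) ^+ 2 + 2 * (b - e) ^+ 2 - (a + b - (c + e)) ^+ 2 =
    ((a - c) - (b - e)) ^+ 2 by ring.
  exact: sqr_ge0.
Qed.

Lemma var_lipschitz u v M e : bmf u -> bmf v ->
  (forall x, `|u x| <= M) -> (forall x, `|v x| <= M) ->
  (forall x, `|u x - v x| <= e) -> `|var u - var v| <= 4 * M * e.
Proof.
move=> bu bv uM vM uve.
have sq x y : `|x| <= M -> `|y| <= M -> `|x - y| <= e ->
    `|x ^+ 2 - y ^+ 2| <= 2 * M * e.
  move=> xM yM xye; rewrite subr_sqr normrM mulrC ler_pM//.
  by rewrite (le_trans (ler_normD _ _))// mulrDl mul1r lerD.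
have -> : var u - var v = (\int[mu]_x (u x ^+ 2) - \int[mu]_x (v x ^+ 2)) -
   ((mean u) ^+ 2 - (mean v) ^+ 2) by rewrite /var; ring.
rewrite (le_trans (ler_normB _ _))//.
have -> : 4 * M * e = 2 * M * e + 2 * M * e by ring.
rewrite lerD//.
  rewrite -meanB; [|exact: bmf_sqr..].
  by apply: mean_norm_bound => [|x]; [apply: bmfB; exact: bmf_sqr|exact: sq].
by apply: sq; rewrite -?meanB//; apply: mean_norm_bound => //; exact: bmfB.
Qed.

End bounded_measurable.

(** * The entropic functional *)

Lemma ln_ratio {R : realType} (a b : R) : 0 < a -> 0 < b ->
  ln (a / b) = ln a - ln b.
Proof. by move=> a0 b0; rewrite ln_div ?posrE. Qed.

(** [A], [B], [C] are the partition functions at two points and at their midpoint. The convexity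
    defect is [eps / 2 * ln (A * B / C ^+ 2)], and [ln x >= 1 - x^-1] bounds it below by
    [eps / 2 * ((A - C ^+ 2 / B) / A)]. *)
Lemma midpoint_gap {R : realType} (eps A B C a k : R) :
  0 < eps -> 0 < A -> 0 < B -> 0 < C -> 0 <= a -> a <= A - C ^+ 2 / B ->
  A <= k ->
  eps / 2 * (a / k) <= 2^-1 * (eps * ln A + eps) + 2^-1 * (eps * ln B + eps) -
    (eps * ln C + eps).
Proof.
move=> e0 A0 B0 C0 a0 aA Ak.
have C2 : 0 < C ^+ 2 by rewrite exprn_gt0.
have AB : 0 < A * B by rewrite mulr_gt0.
have -> : 2^-1 * (eps * ln A + eps) + 2^-1 * (eps * ln B + eps) -
    (eps * ln C + eps) = eps / 2 * ln (A * B / C ^+ 2).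
  by rewrite ln_ratio// lnM ?posrE// lnXn//; field.
rewrite ler_pM2l ?divr_gt0//.
have x0 : 0 < A * B / C ^+ 2 by rewrite divr_gt0.
apply: (@le_trans _ _ (1 - (A * B / C ^+ 2)^-1)); last first.
  have := le_ln1Dx (x := (A * B / C ^+ 2)^-1 - 1).
  rewrite (_ : 1 + ((A * B / C ^+ 2)^-1 - 1) = (A * B / C ^+ 2)^-1); last by ring.
  rewrite lnV ?posrE// => h.
  by rewrite -lerN2 opprB h// ltrBrDr addNr invr_gt0.
have -> : 1 - (A * B / C ^+ 2)^-1 = (A - C ^+ 2 / B) / A.
  by field; rewrite !lt0r_neq0.
apply: ler_pM => //; first by rewrite invr_ge0 (le_trans _ Ak)// ltW.
by rewrite lef_pV2 ?posrE// (lt_le_trans A0).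
Qed.

Section gibbs_functional.
Context {R : realType} {dX : measure_display} {X : measurableType dX}.
Context (mu : probability X R) (eps : R) (c : X -> R).
Hypothesis eps_gt0 : 0 < eps.
Hypothesis bc : bmf c.
Implicit Types (u v : X -> R).

Definition boltz u x : R := expR ((u x - c x) / eps).
Definition pfun u : R := \int[mu]_x boltz u x.
Definition free u : R := eps * ln (pfun u) + eps.
Definition tilt u x : R := boltz u x / pfun u.

Lemma bmf_boltz u : bmf u -> bmf (boltz u).
Proof.
move=> bu; apply: bmf_expR; under [X in bmf X]funext do rewrite mulrC.
by apply: bmfZ; exact: bmfB.
Qed.

Lemma pfun_ge (u : X -> R) (m : R) : bmf u -> (forall x, m <= u x - c x) ->
  expR (m / eps) <= pfun u.
Proof.
move=> bu mu'; rewrite -[leLHS](mean_cst mu); apply: le_mean => [||x].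
- exact: bmf_cst.
- exact: bmf_boltz.
- by rewrite ler_expR ler_pM2r ?invr_gt0.
Qed.

Lemma pfun_le (u : X -> R) (m : R) : bmf u -> (forall x, u x - c x <= m) ->
  pfun u <= expR (m / eps).
Proof.
move=> bu mu'; rewrite -[leRHS](mean_cst mu); apply: le_mean => [||x].
- exact: bmf_boltz.
- exact: bmf_cst.
- by rewrite ler_expR ler_pM2r ?invr_gt0.
Qed.

Lemma pfun_gt0 u : bmf u -> 0 < pfun u.
Proof.
move=> bu; have [_ [M uM]] := bmfB bu bc.
apply: lt_le_trans (pfun_ge bu (m := - M) _); first exact: expR_gt0.
by move=> x; have := uM x; rewrite ler_norml => /andP[].
Qed.

Lemma bmf_tilt u : bmf u -> bmf (tilt u).
Proof.
move=> bu; under [X in bmf X]funext do rewrite /tilt mulrC.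
by apply: bmfZ; exact: bmf_boltz.
Qed.

Lemma tilt_gt0 u x : bmf u -> 0 < tilt u x.
Proof. by move=> bu; rewrite divr_gt0 ?expR_gt0 ?pfun_gt0. Qed.

Lemma int_tilt u : bmf u -> \int[mu]_x tilt u x = 1.
Proof.
move=> bu; under eq_Rintegral do rewrite /tilt mulrC.
by rewrite meanZ ?mulVf// ?gt_eqF ?pfun_gt0//; exact: bmf_boltz.
Qed.

(* Jensen's inequality for exp under the density [tilt u]. *)
Lemma free_convex u v : bmf u -> bmf v ->
  \int[mu]_x (tilt u x * (v x - u x)) <= free v - free u.
Proof.
move=> bu bv.
have bd : bmf (fun x => tilt u x * (v x - u x)).
  by apply: bmfM; [exact: bmf_tilt|exact: bmfB].
set I := \int[mu]_x _.
have bt := bmf_tilt bu.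
have Zu := pfun_gt0 bu; have Zv := pfun_gt0 bv.
have key : expR (I / eps) <= pfun v / pfun u.
  set m := I / eps.
  have -> : pfun v / pfun u = \int[mu]_x (tilt u x * expR ((v x - u x) / eps)).
    rewrite mulrC -meanZ; last exact: bmf_boltz.
    apply: eq_Rintegral => x _; rewrite /tilt /boltz mulrAC -expRD mulrC.
    by congr (expR _ * _); field; rewrite gt_eqF.
  (* The integrand is the tangent line of exp at the mean [m]; its linear part integrates to 0 under
     the density [tilt u]. *)
  have <- : \int[mu]_x (tilt u x * (expR m * (1 + ((v x - u x) / eps - m)))) = expR m.
    under eq_Rintegral.
      move=> x _.
      have -> : tilt u x * (expR m * (1 + ((v x - u x) / eps - m))) =
        (expR m * (1 - m)) * tilt u x + (expR m / eps) * (tilt u x * (v x - u x)).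
        by ring.
      over.
    rewrite meanD; [|exact: bmfZ..].
    rewrite !meanZ// int_tilt// -/I /m; ring.
  have bq : bmf (fun x => (v x - u x) / eps).
    by under [X in bmf X]funext do rewrite mulrC; apply: bmfZ; exact: bmfB.
  apply: le_mean => [||x].
  - apply: bmfM => //; apply: bmfZ; apply: bmfD; first exact: bmf_cst.
    by apply: bmfB => //; exact: bmf_cst.
  - by apply: bmfM => //; exact: bmf_expR.
  - rewrite ler_pM2l ?tilt_gt0// -[in leRHS](subrK m ((v x - u x) / eps)) expRD.
    by rewrite mulrC ler_pM2r ?expR_gt0// expR_ge1Dx.
have -> : free v - free u = eps * (ln (pfun v / pfun u)).
  by rewrite ln_ratio// /free; ring.
rewrite mulrC -ler_pdivrMr//.
rewrite -[leLHS]expRK ler_ln ?posrE ?expR_gt0 ?divr_gt0//.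
Qed.

(** A quantitative Cauchy-Schwarz inequality for partition functions: the defect is a variance of
    [expR ((u - v) / (2 * eps))] under a Gibbs density, and on bounded functions both the
    exponential and the density are controlled from below, which leaves the variance of [u - v]
    under [mu]. The factor [(8 * eps)^-1] is [eps / 2] times [(2 * eps) ^- 2]. *)
Lemma free_strong_midpoint u v (M K : R) : bmf u -> bmf v ->
  (forall x, `|u x| <= M) -> (forall x, `|v x| <= M) ->
  (forall x, `|c x| <= K) ->
  (8 * eps)^-1 * expR (- (4 * M + 2 * K) / eps) * var mu (fun x => u x - v x) <=
  2^-1 * free u + 2^-1 * free v - free (fun x => 2^-1 * (u x + v x)).
Proof.
move=> bu bv uM vM cK.
have e0 : eps != 0 by rewrite gt_eqF.
pose w x := 2^-1 * (u x + v x).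
have bw : bmf w by apply: bmfZ; exact: bmfD.
have A0 := pfun_gt0 bu; have B0 := pfun_gt0 bv; have C0 := pfun_gt0 bw.
set A := pfun u in A0 *; set B := pfun v in B0 *; set C := pfun w in C0 *.
(* [B], [C], [A] are the moments of order 0, 1, 2 of [r] under the density
   [boltz v], so that [A - C ^+ 2 / B] is B times a variance. *)
pose r x := expR ((u x - v x) / (2 * eps)).
have bd : bmf (fun x => (u x - v x) / (2 * eps)).
  by under [X in bmf X]funext do rewrite mulrC; apply: bmfZ; exact: bmfB.
have br : bmf r by exact: bmf_expR.
have r2 x : boltz u x = boltz v x * r x ^+ 2.
  by rewrite /boltz /r -expRM_natl -expRD; congr expR; field.
have r1 x : boltz w x = boltz v x * r x.
  by rewrite /boltz /r -expRD /w; congr expR; field.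
pose l := C / B.
have bbv := bmf_boltz bv.
have bB : bmf (fun x => boltz v x * (r x - l) ^+ 2).
  by apply: bmfM => //; apply: bmf_sqr; apply: bmfB => //; exact: bmf_cst.
have IE : \int[mu]_x (boltz v x * (r x - l) ^+ 2) = A - C ^+ 2 / B.
  under eq_Rintegral.
    move=> x _.
    have -> : boltz v x * (r x - l) ^+ 2 =
      boltz u x + (- (2 * l) * boltz w x + l ^+ 2 * boltz v x).
      by rewrite r1 r2; ring.
    over.
  have bbu := bmf_boltz bu; have bbw := bmf_boltz bw.
  rewrite !meanD//; [|exact: bmfZ|exact: bmfZ|by apply: bmfD; exact: bmfZ].
  rewrite !meanZ// -/(pfun u) -/(pfun v) -/(pfun w) -/A -/B -/C /l; field; exact: lt0r_neq0.
(* A lower bound for [r], since [u - v >= - (2 * M)], and hence for its weighted mean [l]. *)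
pose m := expR (- M / eps).
have m0 : 0 < m by exact: expR_gt0.
have duv x : - (2 * M) <= u x - v x.
  have := uM x; have := vM x; rewrite !ler_norml => /andP[_ ?] /andP[? _]; lra.
have mr x : m <= r x.
  rewrite ler_expR ler_pdivlMr ?mulr_gt0//.
  have -> : - M / eps * (2 * eps) = - (2 * M) by field.
  exact: duv.
have ml : m <= l.
  rewrite /l ler_pdivlMr// -meanZ//; apply: le_mean => [||x].
  - exact: bmfZ.
  - exact: bmf_boltz.
  - by rewrite r1 mulrC ler_pM2l ?expR_gt0.
have l0 : 0 < l by exact: lt_le_trans ml.
(* ln is (1/m)-Lipschitz on [m, +oo[ *)
have lnle x : ((u x - v x) / (2 * eps) - ln l) ^+ 2 * m ^+ 2 <= (r x - l) ^+ 2.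
  have -> : (u x - v x) / (2 * eps) = ln (r x) by rewrite /r expRK.
  have lip (a b : R) : m <= a -> m <= b -> (ln a - ln b) * m <= `|a - b|.
    move=> ma mb; have a0 := lt_le_trans m0 ma; have b0 := lt_le_trans m0 mb.
    rewrite -ln_ratio//.
    have [ab|ba] := leP a b.
      apply: (@le_trans _ _ 0) => //; rewrite mulr_le0_ge0 ?(ltW m0)//.
      by rewrite ln_le0// ler_pdivrMr// mul1r.
    apply: (@le_trans _ _ ((a / b - 1) * m)).
      rewrite ler_pM2r//; have := le_ln1Dx (x := a / b - 1).
      rewrite (_ : 1 + (a / b - 1) = a / b); last by ring.
      by apply; rewrite ltrBrDr addNr divr_gt0.
    rewrite (gtr0_norm (x := a - b)) ?subr_gt0//.
    have -> : a / b - 1 = (a - b) / b by field; exact: lt0r_neq0.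
    rewrite mulrAC ler_pdivrMr//.
    by rewrite ler_pM2l// subr_gt0.
  rewrite -exprMn -[leLHS]real_normK ?num_real// -[leRHS]real_normK ?num_real//.
  rewrite lerXn2r ?nnegrE// ler_norml.
  rewrite lip// andbT -[leRHS]opprK lerN2 -mulNr opprB distrC lip//.
have qm x : expR ((- M - K) / eps) <= boltz v x.
  rewrite ler_expR ler_pM2r ?invr_gt0//.
  have := vM x; have := cK x; rewrite !ler_norml => /andP[_ ?] /andP[? _]; lra.
have Ale : A <= expR ((M + K) / eps).
  apply: pfun_le => // x.
  have := uM x; have := cK x; rewrite !ler_norml => /andP[? _] /andP[_ ?]; lra.
set V := var mu _.
have V0 : 0 <= V by apply: var_ge0; exact: bmfB.
(* The variance is the least mean square distance to a constant, so the centre [ln l] is as good as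
   the mean of [(u - v) / (2 * eps)]. *)
have low : expR ((- M - K) / eps) * m ^+ 2 * ((2 * eps) ^- 2 * V) <= A - C ^+ 2 / B.
  rewrite -IE.
  apply: (@le_trans _ _ (\int[mu]_x (expR ((- M - K) / eps) * m ^+ 2 *
     (((2 * eps)^-1 * (u x - v x) - ln l) ^+ 2)))).
    have b1 : bmf (fun x => (2 * eps)^-1 * (u x - v x)) by apply: bmfZ; exact: bmfB.
    rewrite meanZ; last by apply: bmf_sqr; apply: bmfB => //; exact: bmf_cst.
    rewrite ler_pM2l; last by rewrite mulr_gt0 ?exprn_gt0 ?expR_gt0.
    apply: le_trans (var_le_shift mu (ln l) b1).
    rewrite /var le_eqVlt; apply/orP; left; apply/eqP.
    rewrite meanZ; last exact: bmfB.
    under [in RHS]eq_Rintegral do rewrite exprMn.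
    rewrite meanZ; last by apply: bmf_sqr; exact: bmfB.
    by rewrite /V /var; field.
  apply: le_mean => [||x] //.
    apply: bmfZ; apply: bmf_sqr; apply: bmfB; last exact: bmf_cst.
    by apply: bmfZ; exact: bmfB.
  rewrite -mulrA; apply: ler_pM => //.
  - by rewrite mulr_ge0 ?sqr_ge0.
  - by have := lnle x; rewrite mulrC [(u x - v x) / _]mulrC.
(* The exponent collects [M + K] from the density below, [2 * M] from [m ^+ 2] and [M + K] from the
   upper bound on [A]. *)
have kE : expR (- (4 * M + 2 * K) / eps) =
    expR ((- M - K) / eps) * m ^+ 2 * (expR ((M + K) / eps))^-1.
  rewrite /m -expRM_natl -expRN -!expRD; congr expR; field; exact: e0.
have -> : (8 * eps)^-1 * expR (- (4 * M + 2 * K) / eps) * V =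
  eps / 2 * ((expR ((- M - K) / eps) * m ^+ 2 * ((2 * eps) ^- 2 * V)) /
             expR ((M + K) / eps)).
  rewrite kE; move: (expR _) (expR _)^-1 => k1 k2; field; exact: e0.
apply: (midpoint_gap eps_gt0 A0 B0 C0 _ low Ale).
apply: mulr_ge0; first by rewrite mulr_ge0 ?expR_ge0// exprn_ge0// ltW.
by rewrite mulr_ge0// invr_ge0 exprn_ge0// mulr_ge0// ltW.
Qed.

(** Numerator and partition function each change by a factor at most [expR (D / eps)], so the
    densities are within a factor [expR q] of each other, with [q = 2 * D / eps]. *)
Lemma tilt_lipschitz u v (D : R) : bmf u -> bmf v ->
  (forall x, `|u x - v x| <= D) ->
  \int[mu]_x `|tilt u x - tilt v x| <= 8 / eps * D.
Proof.
move=> bu bv uvD.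
have bt := bmf_tilt bu; have bt' := bmf_tilt bv.
have bn : bmf (fun x => `|tilt u x - tilt v x|) by apply: bmf_norm; exact: bmfB.
have D0 : 0 <= D by exact: le_trans (uvD point).
pose q := 2 * D / eps.
have q0 : 0 <= q by rewrite divr_ge0 ?mulr_ge0// ltW.
have -> : 8 / eps * D = 4 * q by rewrite /q; ring.
(* For [q > 1/2] the total mass 2 of the two densities is already below [4 * q]; otherwise
   [expR q - 1 <= 2 * q] linearizes the ratio. *)
have [q1|q1] := ltP (2^-1) q.
  apply: (@le_trans _ _ (\int[mu]_x (tilt u x + tilt v x))).
    apply: le_mean => // [|x]; first exact: bmfD.
    rewrite (le_trans (ler_normB _ _))// !ger0_norm//; exact/ltW/tilt_gt0.
  by rewrite meanD// !int_tilt//; lra.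
have ratio s t : bmf s -> bmf t -> (forall x, `|s x - t x| <= D) ->
    forall x, tilt s x <= expR q * tilt t x.
  move=> bs bt0 stD x.
  have bs' := bmf_boltz bs; have bt0' := bmf_boltz bt0.
  have st z : boltz s z <= expR (D / eps) * boltz t z.
    rewrite /boltz -expRD ler_expR -mulrDl ler_pM2r ?invr_gt0//.
    by have := stD z; rewrite ler_norml => /andP[_ ?]; lra.
  have ts : pfun t <= expR (D / eps) * pfun s.
    rewrite -meanZ//; apply: le_mean => // [|z]; first exact: bmfZ.
    rewrite /boltz -expRD ler_expR -mulrDl ler_pM2r ?invr_gt0//.
    by have := stD z; rewrite ler_norml => /andP[? _]; lra.
  rewrite /tilt ler_pdivrMr ?pfun_gt0//.
  apply: (le_trans (st x)).
  have -> : expR q = expR (D / eps) * expR (D / eps).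
    by rewrite -expRD /q; congr expR; lra.
  rewrite -!mulrA ler_pM2l ?expR_gt0// mulrCA -[leLHS]mulr1 ler_pM2l ?expR_gt0//.
  by rewrite mulrCA mulrC ler_pdivlMr ?mul1r ?pfun_gt0.
have eq : expR q - 1 <= 2 * q.
  have h := expR_ge1Dx (- q).
  have e0 := expR_gt0 q.
  have : expR q * (1 - q) <= 1.
    by rewrite -[leRHS](expRxMexpNx_1 q) ler_pM2l.
  have : (1 - q) * (expR q - 1 - 2 * q) <= 0 -> expR q - 1 - 2 * q <= 0.
    by rewrite pmulr_rle0//; lra.
  move=> h2 h3; rewrite -subr_le0; apply: h2.
  have -> : (1 - q) * (expR q - 1 - 2 * q) = (expR q * (1 - q) - 1) - q + 2 * q * q by ring.
  have : 2 * q * q <= q by nra.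
  lra.
apply: (@le_trans _ _ (\int[mu]_x (2 * q * (tilt u x + tilt v x)))); last first.
  by rewrite meanZ ?meanD//; [rewrite !int_tilt//; lra|exact: bmfD].
apply: le_mean => // [|x]; first by apply: bmfZ; exact: bmfD.
have Fu := tilt_gt0 x bu; have Fv := tilt_gt0 x bv.
have vuD z : `|v z - u z| <= D by rewrite distrC.
have h1 := ratio v u bv bu vuD x; have h2 := ratio u v bu bv uvD x.
have h3 : (expR q - 1) * tilt v x <= 2 * q * tilt v x by rewrite ler_pM2r.
have h4 : (expR q - 1) * tilt u x <= 2 * q * tilt u x by rewrite ler_pM2r.
have h5 : 0 <= 2 * q * tilt u x by apply: mulr_ge0; [exact: mulr_ge0|exact: ltW].
have h6 : 0 <= 2 * q * tilt v x by apply: mulr_ge0; [exact: mulr_ge0|exact: ltW].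
move: h1 h2 h3 h4 h5 h6; move: (tilt u x) (tilt v x) (expR q) => a b e h1 h2 h3 h4 h5 h6.
rewrite ler_norml; apply/andP; split; lra.
Qed.

End gibbs_functional.

(** * Deterministic sequences *)

Section deterministic_sequences.
Context {R : realType}.
Implicit Types (g x b D G : nat -> R).

(* If [x n >= e], slow variation keeps [x >= e / 2] over a window of g-length of
   order e, and each late window carries b-mass at least of order e. *)
Lemma slow_variation_cvg0 g x b (kap C B : R) : 0 < kap -> 0 < C ->
  (forall n, 0 <= g n) -> (forall A : R, exists n, A <= \sum_(0 <= k < n) g k) ->
  (forall n, 0 <= x n) -> (forall n, `|x n.+1 - x n| <= C * g n) ->
  (forall n, 0 <= b n) -> (forall n, \sum_(0 <= k < n) b k * x k <= B) ->
  (forall e : R, 0 < e -> exists m, forall n n', (m <= n <= n')%N ->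
     `|\sum_(n <= k < n') (b k - kap * g k)| <= e) ->
  x @ \oo --> 0.
Proof.
move=> kap0 C0 g0 gdiv x0 xslow b0 bxB bcauchy.
apply/cvgrPdist_lt => /= e e0.
(* [t] is the g-length over which [x] can lose at most [dl]. A window of that length has b-mass
   close to [kap * t = 2 * eta]; an error of [eta] is tolerated. *)
pose dl := e / 2; have dl0 : 0 < dl by rewrite divr_gt0.
pose t := dl / C; have t0 : 0 < t by rewrite divr_gt0.
pose eta := kap * t / 2; have eta0 : 0 < eta by rewrite divr_gt0// mulr_gt0.
pose s n := \sum_(0 <= k < n) b k * x k.
have snd m n : (m <= n)%N -> s m <= s n.
  move=> mn; rewrite /s [leRHS](big_cat_nat _ (n := m))//= lerDl.
  by apply: sumr_ge0 => k _; rewrite mulr_ge0.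
have hs : has_sup (range s).
  split; first by exists (s 0%N), 0%N.
  by exists B => _ [n _ <-]; exact: bxB.
have he : 0 < dl * eta / 2 by rewrite divr_gt0// mulr_gt0.
(* Past [m1] the bounded sum [s] can grow by less than [dl * eta], which the window below
   contradicts. *)
have [_ [m1 _ <-] hm1] := sup_adherent he hs.
have [m2 hm2] := bcauchy _ eta0.
near=> n.
have m1n : (m1 <= n)%N by near: n; exists m1.
have m2n : (m2 <= n)%N by near: n; exists m2.
rewrite sub0r normrN ger0_norm// ltNge; apply/negP => xe.
have exN : exists p, t <= \sum_(n <= k < n + p) g k.
  have [N hN] := gdiv (t + \sum_(0 <= k < n) g k).
  have nN : (n <= N)%N.
    rewrite leqNgt; apply/negP => Nn; move: hN; rewrite leNgt => /negP; apply.
    rewrite ltr_pwDl// [leRHS](big_cat_nat _ (n := N))//= ?lerDl ?sumr_ge0//.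
    exact: ltnW.
  exists (N - n)%N; rewrite subnKC//.
  have hs2 : \sum_(0 <= k < N) g k = \sum_(0 <= k < n) g k + \sum_(n <= k < N) g k.
    by rewrite (big_cat_nat _ (n := n)).
  by move: hN; rewrite hs2; lra.
(* Minimality of [p] keeps the g-length of every proper initial part of the window below [t], so [x]
   stays above [dl] on the whole window. *)
have [p hp pmin] := ex_minnP exN.
have xbig k : (k < p)%N -> dl <= x (n + k)%N.
  move=> kp.
  have sm : \sum_(n <= j < n + k) g j < t.
    by rewrite ltNge; apply/negP => /pmin; rewrite leqNgt kp.
  have : x n - C * \sum_(n <= j < n + k) g j <= x (n + k)%N.
    clear kp sm; elim: k => [|k IH]; first by rewrite addn0 big_geq// mulr0 subr0.
    rewrite addnS big_nat_recr ?leq_addr//= mulrDr.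
    by have := xslow (n + k)%N; rewrite ler_norml => /andP[+ _]; lra.
  apply: le_trans.
  have : C * \sum_(n <= j < n + k) g j < dl by rewrite mulrC -ltr_pdivlMr.
  by rewrite /dl in xe *; lra.
have : s (n + p)%N - s n < dl * eta.
  have h1 := snd _ _ m1n.
  have h2 : s (n + p)%N <= sup (range s) by apply: ub_le_sup; [case: hs|exists (n + p)%N].
  lra.
apply/negP; rewrite -leNgt.
have -> : s (n + p)%N - s n = \sum_(n <= k < n + p) b k * x k.
  by rewrite /s (big_cat_nat _ (n := n) (p := (n + p)%N)) ?leq_addr//= addrAC subrr add0r.
have bge : kap * t - eta <= \sum_(n <= k < n + p) b k.
  have := hm2 n (n + p)%N; rewrite m2n leq_addr => /(_ isT).
  rewrite sumrB -mulr_sumr ler_norml => /andP[+ _].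
  have : kap * t <= kap * \sum_(n <= k < n + p) g k by rewrite ler_pM2l.
  lra.
have : dl * (\sum_(n <= k < n + p) b k) <= \sum_(n <= k < n + p) b k * x k.
  rewrite mulr_sumr; apply: ler_sum_nat => k /andP[nk kp].
  rewrite mulrC ler_wpM2l// -(subnKC nk) xbig//.
  by rewrite ltn_subLR.
apply: le_trans.
rewrite ler_pM2l//; apply: le_trans bge; rewrite /eta; lra.
Unshelve. all: by end_near.
Qed.

(** Discrete Gronwall: the product of the factors [1 + G k] is at most [expR S]. Inserting the
    resulting bound on [D] into the recursion leaves a telescoping sum that controls [b]. *)
Lemma almost_nonincreasing D b G (S : R) :
  (forall n, 0 <= D n) -> (forall n, 0 <= b n) -> (forall n, 0 <= G n) ->
  (forall n, \sum_(0 <= k < n) G k <= S) ->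
  (forall n, D n.+1 + b n <= (1 + G n) * D n) ->
  (forall n, D n <= expR S * D 0%N) /\
  (forall n, \sum_(0 <= k < n) b k <= D 0%N + S * (expR S * D 0%N)).
Proof.
move=> D0 b0 G0 GS rec.
have bd n : D n <= expR S * D 0%N.
  apply: (@le_trans _ _ (expR (\sum_(0 <= k < n) G k) * D 0%N)); last first.
    by rewrite ler_wpM2r// ler_expR.
  elim: n => [|n IH]; first by rewrite big_geq// expR0 mul1r.
  rewrite big_nat_recr//= expRD mulrAC.
  have h := rec n; have hb := b0 n.
  apply: (@le_trans _ _ ((1 + G n) * D n)); first lra.
  rewrite mulrC ler_pM//; first by rewrite addr_ge0.
  exact: expR_ge1Dx.
split=> // n.
have h k : b k <= (D k - D k.+1) + G k * (expR S * D 0%N).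
  have := rec k; have := ler_wpM2l (G0 k) (bd k); lra.
apply: le_trans (ler_sum_nat (fun k _ => h k)) _.
rewrite big_split/= -mulr_suml lerD//; last first.
  by rewrite ler_wpM2r// mulr_ge0 ?expR_ge0.
have := telescope_sumr (fun k => - D k) (leq0n n).
rewrite (eq_bigr (fun k => D k - D k.+1)) => [->|k _]; last by rewrite opprK addrC.
by rewrite opprK addrC lerBlDr lerDl.
Qed.

Lemma powR_telescope (a s : R) : 1 < a -> 0 < s ->
  s * a `^ (- s - 1) <= (a - 1) `^ (- s) - a `^ (- s).
Proof.
move=> a1 s0.
have a0 : 0 < a by exact: lt_trans a1.
have am1 : 0 < a - 1 by rewrite subr_gt0.
have q0 : 0 < (a - 1) / a by rewrite divr_gt0.
have -> : a `^ (- s - 1) = a `^ (- s) / a.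
  rewrite -(powR_inv1 (ltW a0)) -powRD//.
  by rewrite (gt_eqF a0) implybT.
have -> : (a - 1) `^ (- s) = a `^ (- s) * ((a - 1) / a) `^ (- s).
  rewrite -powRM ?ltW//; congr (_ `^ _); field; exact: lt0r_neq0.
have p0 : 0 < a `^ (- s) by rewrite powR_gt0.
rewrite -[X in _ - X]mulr1 -mulrBr mulrCA ler_pM2l//.
rewrite /powR gt_eqF// lerBrDr addrC.
apply: le_trans (expR_ge1Dx _); rewrite lerD2l mulNr -mulrN ler_pM2l//.
have := le_ln1Dx (x := - a^-1).
have -> : 1 + - a^-1 = (a - 1) / a by field; exact: lt0r_neq0.
rewrite lerNr; apply.
by rewrite ltrN2 invf_lt1.
Qed.

Lemma step_size_gt0 (gamma0 gamma c : R) n : 0 < gamma0 -> 0 < gamma ->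
  0 < step_size gamma0 gamma c n.
Proof. by case: n => [//|n] _ gamma_gt0 /=; rewrite mulr_gt0// powR_gt0. Qed.

Lemma step_size_divergent (gamma0 gamma c : R) : 0 < gamma0 -> 0 < gamma ->
  0 <= c <= 1 ->
  forall A : R, exists n, A <= \sum_(0 <= k < n) step_size gamma0 gamma c k.
Proof.
move=> h0 h1 c01 A; apply: contrapT => /forallNP H.
apply: (dvg_riemannR c01).
apply: nondecreasing_is_cvgn.
  apply/nondecreasing_seqP => n; rewrite /series/= big_nat_recr//= lerDl.
  by apply/ltW/riemannR_gt0; case/andP: c01.
exists (A / gamma) => _ [n _ <-].
have /negP := H n.+1; rewrite -ltNge => /ltW.
rewrite big_nat_recl//= => hA.
rewrite ler_pdivlMr// /series/= mulr_suml.
apply: le_trans hA; rewrite -[leLHS]add0r lerD ?(ltW h0)//.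
apply: ler_sum => k _; rewrite /riemannR powRN mulrC//.
Qed.

Lemma step_size_sqr_summable (gamma0 gamma c : R) : 0 < gamma0 -> 0 < gamma ->
  2^-1 < c ->
  exists S, forall n, \sum_(0 <= k < n) step_size gamma0 gamma c k ^+ 2 <= S.
Proof.
move=> h0 h1 hc.
(* The squared steps are [gamma ^+ 2] times the terms of exponent [- s - 1 = - 2 * c], whose sum
   telescopes up to [1 + s^-1]. *)
pose s := 2 * c - 1; have s0 : 0 < s by rewrite /s; lra.
exists (gamma0 ^+ 2 + gamma ^+ 2 * (1 + s^-1)).
have bnd n : \sum_(0 <= k < n.+1) (k.+1%:R : R) `^ (- s - 1) <=
    1 + s^-1 * (1 - n.+1%:R `^ (- s)).
  elim: n => [|n IH]; first by rewrite big_nat1 !powR1 subrr mulr0 addr0.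
  rewrite big_nat_recr//=.
  have := @powR_telescope n.+2%:R s; rewrite ltr1n => /(_ isT s0).
  have -> : n.+2%:R - 1 = n.+1%:R :> R by rewrite -[n.+2]addn1 natrD addrK.
  rewrite mulrC -ler_pdivlMr// mulrC => h.
  rewrite (le_trans (lerD IH h))//; lra.
case=> [|n]; first by rewrite big_geq// addr_ge0 ?sqr_ge0// mulr_ge0 ?sqr_ge0// addr_ge0// ltW// invr_gt0.
rewrite big_nat_recl//= lerD2l.
under eq_bigr do rewrite exprMn.
rewrite -mulr_sumr ler_pM2l ?exprn_gt0//.
have -> : \sum_(0 <= i < n) ((i.+1%:R : R) `^ (- c)) ^+ 2 = \sum_(0 <= k < n) (k.+1%:R : R) `^ (- s - 1).
  apply: eq_bigr => k _; rewrite expr2 -powRD; last by rewrite pnatr_eq0 implybT.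
  by congr (_ `^ _); rewrite /s; ring.
case: n => [|n]; first by rewrite big_geq// addr_ge0// ltW// invr_gt0.
apply: le_trans (bnd _) _; by rewrite lerD2l ger_pMr ?invr_gt0// gerBl powR_ge0.
Qed.

End deterministic_sequences.

(** * Independent samples and supermartingales *)

Section iid_sequences.
Context {R : realType} {dT : measure_display} {T : measurableType dT}.

Definition cons_tuple n (p : T * n.-tuple T) : n.+1.-tuple T :=
  [tuple of p.1 :: p.2].

Lemma measurable_cons_tuple n : measurable_fun setT (@cons_tuple n).
Proof. exact: measurable_cons. Qed.

HB.instance Definition _ n :=
  isMeasurableFun.Build _ _ _ _ (@cons_tuple n) (@measurable_cons_tuple n).

Context (nu : probability T R).

Fixpoint iid_law (n : nat) : probability (n.-tuple T) R :=
  match n with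
  | 0 => \d_([tuple] : 0.-tuple T)
  | n'.+1 => distribution (nu \x iid_law n')%E (@cons_tuple n')
  end.

Definition box n (A : 'I_n -> set T) : set (n.-tuple T) :=
  [set x | forall i, A i (tnth x i)].

Lemma measurable_tuple_box n (A : 'I_n -> set T) :
  (forall i, measurable (A i)) -> measurable (box A).
Proof.
move=> mA; rewrite (_ : box A =
    \bigcap_(i in [set: 'I_n]) ((fun x : n.-tuple T => tnth x i) @^-1` A i)).
  apply: fin_bigcap_measurable => // i _; rewrite -[X in measurable X]setTI.
  exact: measurable_tnth.
by apply/seteqP; split => x /= Ax i; [move=> _|]; exact: Ax.
Qed.

Lemma iid_law_box n (A : 'I_n -> set T) : (forall i, measurable (A i)) ->
  iid_law n (box A) = (\prod_(i < n) nu (A i))%E.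
Proof.
elim: n A => [|n IH] A mA.
  by rewrite big_ord0 /= diracE mem_set//=; case.
rewrite big_ord_recl -(IH (fun i => A (lift ord0 i)))//.
rewrite -product_measure1E; [|exact: mA|exact: measurable_tuple_box].
rewrite [LHS]/= /distribution /pushforward.
congr ((_ \x _)%E _); apply/seteqP; split => -[a x] /=.
  move=> Ax; split; first exact: (Ax ord0).
  by move=> i; have := Ax (lift ord0 i); rewrite tnthS.
move=> [Aa Ax] i; case: (unliftP ord0 i) => [j ->|->//].
by rewrite tnthS; exact: Ax.
Qed.

(** Boxes are stable under intersection, so with this generation property a law on tuples is
    determined by its values on boxes. *)
Lemma measurable_tupleE n : (@measurable _ (n.-tuple T)) =
  <<s [set box A | A in [set A : 'I_n -> set T | forall i, measurable (A i)]] >>.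
Proof.
apply/seteqP; split; last first.
  apply: smallest_sub; first exact: sigma_algebra_measurable.
  by move=> _ [A mA <-]; exact: measurable_tuple_box.
apply: smallest_sub; first exact: smallest_sigma_algebra.
move=> B; rewrite -bigcup_seq/= => -[i _ [C mC <-]]; apply: sub_sigma_algebra.
exists (fun j => if j == i then C else setT).
  by move=> j; case: ifP.
apply/seteqP; split => x /=.
  by move=> h; split=> //; have := h i; rewrite eqxx.
by move=> [_ h] j; case: ifP => // /eqP ->.
Qed.

Context {dO : measure_display} {Omega : measurableType dO}
  (P : probability Omega R) (Z : nat -> {RV P >-> T}).
Hypothesis Z_law : forall n, has_law (Z n) nu.
Hypothesis Z_indep : mutually_independent Z.

(* Most recent variable first. *)
Fixpoint hist (n : nat) (om : Omega) : n.-tuple T :=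
  match n with
  | 0 => [tuple]
  | m.+1 => [tuple of Z m om :: hist m om]
  end.

Lemma measurable_hist n : measurable_fun setT (hist n).
Proof.
elim: n => [|n IH]; first exact: measurable_cst.
exact: measurable_cons.
Qed.

HB.instance Definition _ n :=
  isMeasurableFun.Build _ _ _ _ (hist n) (@measurable_hist n).

Let PZ n A : measurable A -> P (Z n @^-1` A) = nu A.
Proof. by move=> mA; rewrite -(Z_law n mA). Qed.

(** The set [J] of later times makes the induction possible: shortening the history by one moves its
    newest variable into [J], and independence is invoked once the history is empty. Only the case
    of empty [J] is used afterwards. *)
Lemma hist_box n (A : 'I_n -> set T) (J : {fset nat}) (B : nat -> set T) :
  (forall i, measurable (A i)) -> (forall j, measurable (B j)) ->
  (forall j, j \in J -> (n <= j)%N) ->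
  P (hist n @^-1` box A `&` \bigcap_(j in [set` J]) (Z j @^-1` B j)) =
  ((\prod_(i < n) nu (A i)) * \prod_(j <- J) nu (B j))%E.
Proof.
elim: n A J B => [|n IH] A J B mA mB nJ.
  rewrite big_ord0 mul1e (_ : hist 0 @^-1` _ = setT); last first.
    by apply/seteqP; split => // om _ -[].
  rewrite setTI Z_indep//; apply: eq_bigr => j _; exact: PZ.
pose B' j := if j == n then A ord0 else B j.
have nJ' : n \notin J by apply/negP => /nJ; rewrite ltnn.
have Bj j : j \in J -> B' j = B j.
  by rewrite /B'; case: eqP => // -> h; rewrite h in nJ'.
have IHn := IH (fun i => A (lift ord0 i)) (n |` J)%fset B' (fun i => mA _).
rewrite big_ord_recl -muleA muleCA.
have -> : (nu (A ord0) * \prod_(j <- J) nu (B j) =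
    \prod_(j <- (n |` J)%fset) nu (B' j))%E.
  rewrite big_fsetU1//= /B' eqxx; congr (_ * _)%E.
  by rewrite big_seq [RHS]big_seq; apply: eq_bigr => j jJ; have := Bj j jJ; rewrite /B' => ->.
rewrite -IHn; last 2 first.
- by move=> j; rewrite /B'; case: ifP.
- by move=> j; rewrite !inE => /orP[/eqP->//|/nJ /ltnW].
congr (P _); apply/seteqP; split => om /=.
  move=> [hA hB]; split.
    by move=> i; have := hA (lift ord0 i); rewrite tnthS.
  move=> j /=; rewrite !inE => /orP[/eqP->|jJ].
    by rewrite /B' eqxx; exact: (hA ord0).
  by rewrite Bj//; exact: hB.
move=> [hA hB]; split.
  move=> i; case: (unliftP ord0 i) => [j ->|->].
    by rewrite tnthS; exact: hA.
  by have := hB n; rewrite /= !inE eqxx /B' eqxx; apply.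
by move=> j /= jJ; have := hB j; rewrite /= !inE jJ orbT Bj//; apply.
Qed.

Lemma hist_law n (A : set (n.-tuple T)) : measurable A ->
  P (hist n @^-1` A) = iid_law n A.
Proof.
move=> mA.
rewrite -[LHS]/(distribution P (hist n) A).
apply: (@measure_unique _ R _
  [set box A | A in [set A : 'I_n -> set T | forall i, measurable (A i)]]
  (fun _ => setT)) => //.
- exact: measurable_tupleE.
- move=> _ _ [B mB <-] [C mC <-]; exists (fun i => B i `&` C i).
    by move=> i; exact: measurableI.
  apply/seteqP; split => x /=.
    by move=> h; split=> i; have [] := h i.
  by move=> [h1 h2] i; split; [exact: h1|exact: h2].
- move=> _; exists (fun _ => setT) => //.
  by apply/seteqP; split.
- by rewrite bigcup_const//; exists 0%N.
- move=> _ [B mB <-].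
  have J0 j : j \in (fset0 : {fset nat}) -> (n <= j)%N by rewrite in_fset0.
  have := hist_box (J := fset0) (B := fun _ => setT) mB (fun _ => measurableT) J0.
  rewrite big_seq_fset0 mule1 => hb.
  transitivity (\prod_(i < n) nu (B i))%E; last exact/esym/iid_law_box.
  rewrite -hb /= /distribution /pushforward.
  rewrite (_ : \bigcap_(j in _) _ = setT) ?setIT//.
  by apply/seteqP; split.
- move=> _; apply: (@le_lt_trans _ _ 1%E); last exact: ltry.
  exact: (@probability_le1 _ _ _ (distribution P (hist n))).
Qed.

Lemma integral_hist n (f : n.-tuple T -> \bar R) :
  measurable_fun setT f -> (forall x, 0 <= f x)%E ->
  (\int[P]_om f (hist n om) = \int[iid_law n]_x f x)%E.
Proof.
move=> mf f0.
rewrite -(@ge0_integral_distribution _ _ _ _ _ P (hist n))//.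
by apply: eq_measure_integral => A mA _; exact: hist_law.
Qed.

(** The tower property: the inner integral over the head is the conditional expectation given the
    first [n] samples. *)
Lemma integral_histS n (f : n.+1.-tuple T -> \bar R) :
  measurable_fun setT f -> (forall x, 0 <= f x)%E ->
  (\int[P]_om f (hist n.+1 om) =
   \int[P]_om \int[nu]_y f [tuple of y :: hist n om])%E.
Proof.
move=> mf f0.
rewrite integral_hist//= ge0_integral_distribution//.
have mfc : measurable_fun setT (f \o @cons_tuple n).
  by apply: measurableT_comp => //; exact: measurable_cons_tuple.
rewrite (fubini_tonelli2 (f \o @cons_tuple n))//.
rewrite (integral_hist (f := fun x => \int[nu]_y f [tuple of y :: x])%E)//.
- by apply: (measurable_fun_fubini_tonelli_G (m1 := nu) (f \o @cons_tuple n)) => // p; exact: f0.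
- by move=> x; apply: integral_ge0.
- by move=> p; exact: f0.
Qed.

Section supermartingale.
Context (v b : forall n, n.-tuple T -> R).
Arguments v : clear implicits.
Arguments b : clear implicits.
Hypothesis mv : forall n, measurable_fun setT (v n).
Hypothesis mb : forall n, measurable_fun setT (b n).
Hypothesis v0 : forall n x, 0 <= v n x.
Hypothesis b0 : forall n x, 0 <= b n x.
Hypothesis vb : forall n (x : n.-tuple T),
  (\int[nu]_y (v n.+1 [tuple of y :: x])%:E + (b n x)%:E <= (v n x)%:E)%E.

Lemma expected_drift n :
  (\int[P]_om (v n (hist n om))%:E +
   \sum_(0 <= k < n) \int[P]_om (b k (hist k om))%:E <= (v 0 [tuple])%:E)%E.
Proof.
have mvh k : measurable_fun setT (fun om => (v k (hist k om))%:E).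
  by apply/measurable_EFinP; exact: (measurableT_comp (@mv k) (@measurable_hist k)).
have mbh k : measurable_fun setT (fun om => (b k (hist k om))%:E).
  by apply/measurable_EFinP; exact: (measurableT_comp (@mb k) (@measurable_hist k)).
elim: n => [|n IH].
  by rewrite big_geq// adde0 /= integral_cst//= probability_setT mule1.
rewrite big_nat_recr//= [X in (_ + X)%E]addeC addeA.
apply: le_trans IH; rewrite leeD2r//.
rewrite (integral_histS (f := fun x => (v n.+1 x)%:E)); last 2 first.
- by apply/measurable_EFinP; exact: mv.
- by move=> x; rewrite lee_fin.
have mI : measurable_fun setT (fun x : n.-tuple T => (\int[nu]_y (v n.+1 [tuple of y :: x])%:E)%E).
  apply: (measurable_fun_fubini_tonelli_G (fun p => (v n.+1 (cons_tuple p))%:E)).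
    apply/measurable_EFinP; apply: measurableT_comp; [exact: mv|exact: measurable_cons_tuple].
  by move=> p; rewrite lee_fin.
rewrite -ge0_integralD//; last 3 first.
- by move=> om _; apply: integral_ge0 => y _; rewrite lee_fin.
- by exact: (measurableT_comp mI (@measurable_hist n)).
- by move=> om _; rewrite lee_fin.
apply: ge0_le_integral => //.
- move=> om _; apply: adde_ge0; last by rewrite lee_fin.
  by apply: integral_ge0 => y _; rewrite lee_fin.
- by apply: emeasurable_funD => //; exact: (measurableT_comp mI (@measurable_hist n)).
Qed.

(** By monotone convergence the whole series of drifts has expectation at most [v 0], hence is
    almost surely finite. *)
Lemma drift_summable :
  {ae P, forall om, exists B, forall n, \sum_(0 <= k < n) b k (hist k om) <= B}.
Proof.
have mbh k : measurable_fun setT (fun om => (b k (hist k om))%:E).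
  by apply/measurable_EFinP; exact: (measurableT_comp (@mb k) (@measurable_hist k)).
pose F om := (\sum_(k <oo) (b k (hist k om))%:E)%E.
have mF : measurable_fun setT F.
  by apply: ge0_emeasurable_sum => // k x _ _; rewrite lee_fin.
have IF : (\int[P]_om F om <= (v 0 [tuple])%:E)%E.
  rewrite /F integral_nneseries//; last by move=> k om _; rewrite lee_fin.
  apply: lime_le.
    by apply: is_cvg_nneseries => k _ _; apply: integral_ge0 => om _; rewrite lee_fin.
  apply: nearW => n; apply: le_trans (expected_drift n).
  by rewrite leeDr//; apply: integral_ge0 => om _; rewrite lee_fin.
have iF : P.-integrable setT F.
  apply/integrableP; split => //.
  apply: le_lt_trans (ltry (v 0 [tuple])).
  apply: le_trans IF; apply: ge0_le_integral => //.
  - exact: measurableT_comp.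
  - move=> om _; rewrite gee0_abs//.
    by apply: nneseries_ge0 => k _ _; rewrite lee_fin.
have := integrable_ae measurableT iF; apply: filterS => om /(_ I) Ffin.
exists (fine (F om)) => n; rewrite -lee_fin fineK// -sumEFin.
by apply: nneseries_lim_ge => k _; rewrite lee_fin.
Qed.

End supermartingale.

Lemma small_negligible (E : set Omega) :
  (forall e : R, 0 < e -> exists2 A, measurable A /\ E `<=` A & (P A <= e%:E)%E) ->
  P.-negligible E.
Proof.
move=> h.
have /choice[A hA] : forall k : nat, exists A, [/\ measurable A, E `<=` A &
    (P A <= (k.+1%:R^-1)%:E)%E].
  by move=> k; have [|A [mA EA] PA] := h k.+1%:R^-1; [rewrite invr_gt0|exists A].
exists (\bigcap_k A k); split.
- by apply: bigcap_measurable => // k _; case: (hA k).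
- apply/eqP; rewrite eq_le measure_ge0 andbT; apply/lee_addgt0Pr => e e0.
  rewrite add0e.
  have [k _ hk] := near_infty_natSinv_lt (PosNum e0).
  have [mA EA PA] := hA k.
  apply: (le_trans (le_measure _ _ _ (bigcap_inf (i := k) _))) => //.
  + by rewrite inE; apply: bigcap_measurable => // j _; case: (hA j).
  + by rewrite inE.
  + by apply: (le_trans PA); rewrite lee_fin ltW//; exact: (hk k (leqnn k)).
- by move=> om Eom k _; have [_ + _] := hA k; apply.
Qed.

(* Stopping the supermartingale when it first reaches level [a] keeps its mean
   below the initial value. *)
Lemma maximal_inequality (v : forall n, n.-tuple T -> R) (a : R) :
  (forall n, measurable_fun setT (v n)) -> (forall n x, 0 <= v n x) ->
  (forall n (x : n.-tuple T),
    (\int[nu]_y (v n.+1 [tuple of y :: x])%:E <= (v n x)%:E)%E) -> 0 < a ->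
  measurable (\bigcup_n [set om | (a <= v n (hist n om))%R]) /\
  (P (\bigcup_n [set om | (a <= v n (hist n om))%R]) <= (v 0 [tuple] / a)%:E)%E.
Proof.
move=> mv v0 vS a0.
pose hit := fix hit n : n.-tuple T -> bool := match n with
  | 0 => fun x => a <= v 0 x
  | m.+1 => fun x => hit m [tuple of behead x] || (a <= v m.+1 x)
  end.
have mle n : measurable_fun setT (fun x : n.-tuple T => a <= v n x).
  by apply: measurable_fun_ler; [exact: measurable_cst|exact: mv].
have mhit n : measurable_fun setT (hit n).
  elim: n => [|n IH]; first exact: mle.
  apply: measurable_or; last exact: mle.
  by apply: (measurableT_comp IH); exact: measurable_behead.
(* After the first passage the process is frozen at [a], not at the value reached. That value is at
   least [a], so freezing only lowers the mean, and [w >= a] on the event of passage. *)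
pose w n (x : n.-tuple T) := if hit n x then a else v n x.
have w0 n x : 0 <= w n x by rewrite /w; case: ifP => // _; exact: ltW.
have mw n : measurable_fun setT (w n).
  by apply: measurable_fun_ifT; [exact: mhit|exact: measurable_cst|exact: mv].
have beheadK n y (x : n.-tuple T) : [tuple of behead [tuple of y :: x]] = x.
  by apply/val_inj.
have wS n (x : n.-tuple T) :
    (\int[nu]_y (w n.+1 [tuple of y :: x])%:E + (0 : R)%:E <= (w n x)%:E)%E.
  rewrite adde0 {2}/w; case: ifP => hx.
    under eq_integral do rewrite /w /= beheadK hx/=.
    by rewrite integral_cst//= probability_setT mule1.
  apply: le_trans (vS n x); apply: ge0_le_integral => //.
  - by move=> y _; rewrite lee_fin.
  - apply/measurable_EFinP; apply: (measurableT_comp (mw n.+1)).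
    by apply: measurable_cons => //; exact: measurable_cst.
  - apply/measurable_EFinP; apply: (measurableT_comp (mv n.+1)).
    by apply: measurable_cons => //; exact: measurable_cst.
  - by move=> y _; rewrite lee_fin /w; case: ifP => //= /orP[]//; rewrite beheadK hx.
pose H n := [set om | hit n (hist n om)].
have mH n : measurable (H n).
  rewrite -[H n]setTI; apply: (measurableT_comp (mhit n) (@measurable_hist n)) => //.
have PH n : (P (H n) <= (v 0 [tuple] / a)%:E)%E.
  have m0 k : measurable_fun setT (fun _ : k.-tuple T => 0 : R) by exact: measurable_cst.
  have := expected_drift (b := fun k _ => 0) mw m0 w0 (fun _ _ => lexx 0) wS n.
  under eq_bigr do rewrite integral0.
  rewrite big1// adde0 => hw.
  rewrite EFinM lee_pdivlMr//.
  apply: le_trans (_ : _ <= (w 0 [tuple])%:E)%E _; last first.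
    by rewrite lee_fin /w; case: ifP.
  apply: le_trans hw.
  rewrite muleC -[H n]setIT -integral_indic// -ge0_integralZl//; last by rewrite lee_fin ltW.
  apply: ge0_le_integral => //.
  - by move=> om _; apply: mule_ge0; rewrite lee_fin//; exact: ltW.
  - rewrite (_ : (fun x => _) = EFin \o (fun x => a * \1_(H n) x))//.
    by apply/measurable_EFinP; apply: measurable_funM; [exact: measurable_cst|exact: measurable_indic].
  - by apply/measurable_EFinP; exact: (measurableT_comp (mw n) (@measurable_hist n)).
  - move=> om _; rewrite -EFinM lee_fin indicE; have [|_] := boolP (om \in H n).
      by rewrite inE /H /= /w => ->; rewrite mulr1.
    by rewrite mulr0.
  - by apply/measurable_EFinP; exact: measurable_indic.
have HE : \bigcup_n [set om | (a <= v n (hist n om))%R] = \bigcup_n H n.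
  apply/seteqP; split => om [n _ /= hn].
    by exists n => //; rewrite /H /=; case: n hn => [//|n] /= ->; rewrite orbT.
  elim: n hn => [h|n IH]; first by exists 0%N.
  by rewrite /H /= beheadK => /orP[/IH//|h]; exists n.+1.
rewrite HE; split; first exact: bigcup_measurable.
have ndH : nondecreasing_seq H.
  by apply/nondecreasing_seqP => n; apply/subsetPset => om /= h; rewrite /H /= beheadK h.
have := nondecreasing_cvg_mu (mu := P) mH (bigcup_measurable (fun n _ => mH n)) ndH.
move=> /cvg_lim <-//; apply: lime_le.
  by apply: ereal_nondecreasing_is_cvgn => m n mn; apply: le_measure; rewrite ?inE//; exact/subsetPset/ndH.
by apply: nearW => n; exact: PH.
Qed.

Lemma supermartingale_bounded (v : forall n, n.-tuple T -> R) :
  (forall n, measurable_fun setT (v n)) -> (forall n x, 0 <= v n x) ->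
  (forall n (x : n.-tuple T),
    (\int[nu]_y (v n.+1 [tuple of y :: x])%:E <= (v n x)%:E)%E) ->
  {ae P, forall om, exists B, forall n, v n (hist n om) <= B}.
Proof.
move=> mv v0 vS; apply: small_negligible => e e0.
(* The 1 keeps the level positive when [v 0] vanishes. *)
pose a := (v 0 [tuple] + 1) / e.
have a0 : 0 < a by rewrite divr_gt0// ltr_wpDl.
have [mA PA] := maximal_inequality mv v0 vS a0.
exists (\bigcup_n [set om | (a <= v n (hist n om))%R]).
  split=> // om /= hB; apply: contrapT => hn; apply: hB; exists a => n.
  rewrite leNgt; apply/negP => /ltW h; apply: hn; by exists n.
apply: (le_trans PA); rewrite lee_fin /a invf_div mulrA ler_pdivrMr ?ltr_wpDl//.
by rewrite [leLHS]mulrC ler_wpM2l ?lerDl// ltW.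
Qed.

(** * Almost sure convergence of weighted sums of centred samples *)

Section weighted_sums.
Context (z : T -> R) (g : nat -> R).

(** Samples are listed newest first, so the head of a list carries the time index [size s]. Terms of
    index below [m] are discarded. *)
Fixpoint tail_sum (m : nat) (x : seq T) : R :=
  match x with
  | [::] => 0
  | y :: s => tail_sum m s + (if (m <= size s)%N then g (size s) else 0) * z y
  end.

Lemma tail_sum_hist m n p om : (m <= n)%N ->
  tail_sum m (hist (n + p) om) =
  tail_sum m (hist n om) + \sum_(n <= k < n + p) g k * z (Z k om).
Proof.
move=> mn; elim: p => [|p IH]; first by rewrite addn0 big_geq// addr0.
rewrite addnS big_nat_recr ?leq_addr//= IH -addrA; congr (_ + (_ + _)).
by rewrite size_tuple (leq_trans mn) ?leq_addr.
Qed.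

Lemma measurable_tail_sum m n : measurable_fun setT z ->
  measurable_fun setT (fun x : n.-tuple T => tail_sum m x).
Proof.
move=> mz; elim: n => [|n IH].
  rewrite (_ : (fun x => _) = fun _ => 0); first exact: measurable_cst.
  by apply/funext => x; rewrite (tuple0 x).
rewrite (_ : (fun x => _) = fun x : n.+1.-tuple T =>
    tail_sum m [tuple of behead x] + (if (m <= n)%N then g n else 0) * z (tnth x ord0)).
  apply: measurable_funD.
    exact: (measurableT_comp IH (@measurable_behead _ _ _)).
  apply: measurable_funM; first exact: measurable_cst.
  exact: (measurableT_comp mz (@measurable_tnth _ _ _ ord0)).
apply/funext => x; case/tupleP: x => y x /=.
have -> : tnth [tuple of y :: x] ord0 = y by [].
by rewrite size_tuple.
Qed.

(** Kolmogorov's inequality for the tails: the square of a martingale plus the variance still to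
    come is a nonnegative supermartingale, to which the maximal inequality applies. *)
Lemma weighted_sum_cauchy (S : R) : measurable_fun setT z ->
  (forall y, `|z y| <= 1) -> \int[nu]_y z y = 0 ->
  (forall n, \sum_(0 <= k < n) g k ^+ 2 <= S) ->
  {ae P, forall om, forall e : R, 0 < e -> exists m, forall n n', (m <= n <= n')%N ->
    `|\sum_(n <= k < n') g k * z (Z k om)| <= e}.
Proof.
move=> mz z1 zE gS.
pose s n := \sum_(0 <= k < n) g k ^+ 2.
have hs : has_sup (range s).
  by split; [exists (s 0%N), 0%N|exists S => _ [n _ <-]; exact: gS].
set L := sup (range s).
have sL n : s n <= L by apply: ub_le_sup; [case: hs|exists n].
have key (e : R) : 0 < e ->
  P.-negligible [set om | ~ exists m, forall n n', (m <= n <= n')%N ->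
    `|\sum_(n <= k < n') g k * z (Z k om)| <= e].
  move=> e0; pose a := (e / 2) ^+ 2; have a0 : 0 < a by rewrite exprn_gt0 ?divr_gt0.
  apply: small_negligible => eta eta0.
  have e2 : 0 <= e / 2 by rewrite divr_ge0// ltW.
  (* The supermartingale started at [m] has initial value [L - s m < eta * a], so it reaches the
     level [a = (e / 2) ^+ 2] with probability at most [eta]. Otherwise two partial sums from [m]
     differ by at most [e]. *)
  have [_ [m _ <-] hm] := sup_adherent (mulr_gt0 eta0 a0) hs.
  pose v n (x : n.-tuple T) := tail_sum m x ^+ 2 + (L - s (maxn m n)).
  have mv n : measurable_fun setT (v n).
    apply: measurable_funD; last exact: measurable_cst.
    by apply: measurable_funX; exact: measurable_tail_sum.
  have v0 n x : 0 <= v n x by rewrite addr_ge0 ?sqr_ge0// subr_ge0.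
  have vS n (x : n.-tuple T) : (\int[nu]_y (v n.+1 [tuple of y :: x])%:E <= (v n x)%:E)%E.
    rewrite /v /= size_tuple.
    set c := if _ then _ else _; set q := tail_sum m x.
    have bz : bmf z by apply: bmf_bound z1.
    have bl : bmf (fun y => q + c * z y) by apply: bmfD; [exact: bmf_cst|exact: bmfZ].
    have -> : s (maxn m n.+1) = s (maxn m n) + c ^+ 2.
      rewrite /c; case: leqP => mn.
        by rewrite (maxn_idPr (leqW mn)) /s big_nat_recr.
      by rewrite (maxn_idPl mn) expr0n addr0.
    rewrite (bmf_integralE nu (u := fun y => (q + c * z y) ^+ 2 + (L - (s (maxn m n) + c ^+ 2)))); last first.
      by apply: bmfD; [exact: bmf_sqr|exact: bmf_cst].
    rewrite lee_fin meanD; [|exact: bmf_sqr|exact: bmf_cst].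
    rewrite mean_cst.
    have -> : \int[nu]_y ((q + c * z y) ^+ 2) = q ^+ 2 + c ^+ 2 * \int[nu]_y (z y ^+ 2).
      under eq_Rintegral.
        move=> y _.
        have -> : (q + c * z y) ^+ 2 = q ^+ 2 + ((2 * q * c) * z y + c ^+ 2 * z y ^+ 2) by ring.
        over.
      have bz2 := bmf_sqr bz.
      rewrite meanD; [|exact: bmf_cst|by apply: bmfD; exact: bmfZ].
      rewrite meanD; [|exact: bmfZ..].
      by rewrite mean_cst !meanZ// zE mulr0 add0r.
    have : c ^+ 2 * \int[nu]_y (z y ^+ 2) <= c ^+ 2.
      rewrite ler_piMr ?sqr_ge0// -[leRHS](mean_cst nu); apply: le_mean => [||y].
      - exact: bmf_sqr.
      - exact: bmf_cst.
      - by rewrite -real_normK ?num_real// expr_le1.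
    by lra.
  have [mA PA] := maximal_inequality mv v0 vS a0.
  exists (\bigcup_n [set om | (a <= v n (hist n om))%R]).
    split=> // om /= hB; apply: contrapT => hn; apply: hB; exists m => n n' /andP[mn nn'].
    have sm k : `|tail_sum m (hist k om)| <= e / 2.
      rewrite leNgt; apply/negP => h; apply: hn; exists k => //=.
      rewrite /v /a -[leLHS]addr0 lerD ?subr_ge0//.
      by rewrite -[leRHS]real_normK ?num_real// lerXn2r ?nnegrE// ltW.
    have := tail_sum_hist (n' - n) om mn; rewrite subnKC// => E.
    have -> : \sum_(n <= k < n') g k * z (Z k om) =
      tail_sum m (hist n' om) - tail_sum m (hist n om) by rewrite E; ring.
    rewrite (le_trans (ler_normB _ _))// [leRHS](splitr e) lerD//.
  apply: (le_trans PA); rewrite lee_fin ler_pdivrMr// /v /= expr0n add0r maxn0.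
  by rewrite lerBlDl -lerBlDr ltW.
have hj : forall j : nat, {ae P, forall om, exists m, forall n n', (m <= n <= n')%N ->
    `|\sum_(n <= k < n') g k * z (Z k om)| <= j.+1%:R^-1}.
  by move=> j; apply: key; rewrite invr_gt0.
have := (ae_foralln hj); apply: filterS => om hom e e0.
have [j _ hj'] := near_infty_natSinv_lt (PosNum e0).
have [m hm] := hom j; exists m => n n' nn'.
by apply: (le_trans (hm _ _ nn')); apply/ltW; exact: (hj' j (leqnn j)).
Qed.

End weighted_sums.

End iid_sequences.

(** * Summable families *)

Section parametric_integrals.
Context {R : realType}.

Lemma measurable_Rintegral_param d1 d2 (T1 : measurableType d1)
    (T2 : measurableType d2) (m2 : {sigma_finite_measure set T2 -> \bar R})
    (f : T1 -> T2 -> R) :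
  measurable_fun setT (fun p : T1 * T2 => f p.1 p.2) ->
  measurable_fun setT (fun x => \int[m2]_y f x y).
Proof.
move=> mf; apply: (measurableT_comp (f := fine)) => //.
have mE : measurable_fun setT (fun p : T1 * T2 => (f p.1 p.2)%:E).
  exact/measurable_EFinP.
rewrite (_ : (fun x => _) = (fun x =>
    \int[m2]_y ((fun p : T1 * T2 => (f p.1 p.2)%:E)^\+ (x, y)) -
    \int[m2]_y ((fun p : T1 * T2 => (f p.1 p.2)%:E)^\- (x, y)))%E); last first.
  apply/funext => x; rewrite integralE.
  by congr (_ - _)%E; apply: eq_integral => y _; rewrite ?funeposE ?funenegE.
apply: emeasurable_funB.
  apply: (measurable_fun_fubini_tonelli_F (m2 := m2) (fun p : T1 * T2 => (f p.1 p.2)%:E)^\+%E) => //.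
  exact: measurable_funepos.
apply: (measurable_fun_fubini_tonelli_F (m2 := m2) (fun p : T1 * T2 => (f p.1 p.2)%:E)^\-%E) => //.
exact: measurable_funeneg.
Qed.

End parametric_integrals.

(* The discrete sigma-algebra on a countable type; the library's measurable types
   are pointed, hence the parameter [k0]. *)
Definition discr (K : countType) (k0 : K) : Type := K.
HB.instance Definition _ (K : countType) (k0 : K) := Countable.on (discr k0).
HB.instance Definition _ (K : countType) (k0 : K) :=
  isPointed.Build (discr k0) k0.
HB.instance Definition _ (K : countType) (k0 : K) := @isMeasurable.Build
  default_measure_display (discr k0) (fun _ => True) I (fun _ _ => I)
  (fun _ _ => I).

Section discrete_sums.
Context {R : realType} {K : countType} {k0 : K}.
Local Notation J := (discr k0).

Lemma discr_measurable (A : set J) : measurable A.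
Proof. by []. Qed.

Let code (k : J) : nat := choice.pickle (k : K).

Let code_inj : injective code.
Proof. exact: (pcan_inj (@choice.pickleK K)). Qed.

Lemma discr_sigma_finite : sigma_finite [set: J] (@counting J R).
Proof.
exists (fun n => [set k : J | code k = n]).
  by apply/seteqP; split => // k _; exists (code k).
move=> n; split => //; rewrite /counting asboolT ?ltry//.
have [[k kn]|hn] := pselect (exists k : J, code k = n).
  apply: (sub_finite_set (B := [set k])); last exact: finite_set1.
  move=> k' /=; rewrite -kn => /code_inj ->//.
rewrite (_ : [set k | _] = set0) ?finite_set0//.
by apply/seteqP; split => // k /= kn; case: hn; exists k.
Qed.

(** A named copy of the counting measure, to carry the sigma-finite structure that Fubini
    requires. *)
Definition dcount : set J -> \bar R := counting.
HB.instance Definition _ := Measure.copy dcount (@counting J R).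
HB.instance Definition _ :=
  Measure_isSigmaFinite.Build _ J R dcount discr_sigma_finite.

Lemma measurable_fun_prod_discr d (Z : measurableType d) d' (T : measurableType d')
    (f : Z * J -> T) :
  (forall k, measurable_fun setT (fun z => f (z, k))) -> measurable_fun setT f.
Proof.
move=> mf _ A mA; rewrite setTI.
rewrite (_ : f @^-1` A = \bigcup_n \bigcup_(k in [set k : J | code k = n])
   (((fun z => f (z, k)) @^-1` A) `*` [set k])); last first.
  apply/seteqP; split => -[z k] /=; first by move=> fA; exists (code k) => //; exists k.
  by move=> [n _ [k' /= _ [fA ->]]].
apply: bigcupT_measurable => n.
have [[k kn]|hn] := pselect (exists k : J, code k = n).
  rewrite (_ : \bigcup_(k in _) _ = ((fun z => f (z, k)) @^-1` A) `*` [set (k : J)]).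
    apply: measurableX; last exact: discr_measurable.
    by rewrite -[X in measurable X]setTI; exact: mf.
  apply/seteqP; split => -[z k'] /=.
    by move=> [k'' /=]; rewrite -kn => /code_inj -> [].
  by move=> [fA ->]; exists k.
rewrite (_ : \bigcup_(k in _) _ = set0) //.
by apply/seteqP; split => // -[z k'] [k'' /= kn]; case: hn; exists k''.
Qed.

Lemma integral_dcount (f : J -> \bar R) : (forall k, 0 <= f k)%E ->
  (\int[dcount]_k f k = \esum_(k in [set: K]) f k)%E.
Proof.
move=> f0; pose F n := [set k : J | code k = n].
have FT : [set: J] = \bigcup_n F n.
  by apply/seteqP; split => // k _; exists (code k).
have tF : trivIset setT F.
  by move=> i j _ _ [k [/= <- <-]].
rewrite FT ge0_integral_bigcup//.
rewrite nneseries_esumT; last by move=> n; apply: integral_ge0.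
rewrite (@esum_bigcupT _ _ [set: nat] F)//.
apply: eq_esum => n _.
have [[k kn]|hn] := pselect (exists k : J, code k = n).
  have -> : F n = [set k].
    apply/seteqP; split => k' /=; last by move=> ->.
    by rewrite /F /= -kn => /code_inj.
  rewrite esum_set1// (eq_integral (fun _ => f k)); last first.
    by move=> x; rewrite inE /= => ->.
  rewrite integral_cst//= /dcount /counting asboolT; last exact: finite_set1.
  by rewrite fset_set1 cardfs1 mule1.
have -> : F n = set0 by apply/seteqP; split => // k /= kn; case: hn; exists k.
by rewrite integral_set0 esum_set0.
Qed.

(** Absolute summability as integrability: linearity, monotonicity, Fubini and measurability in a
    parameter are then inherited from the integral. *)
Definition summable_fam (f : J -> R) := dcount.-integrable setT (EFin \o f).

Definition isum (f : J -> R) : R := \int[dcount]_k f k.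

Lemma summable_famP f :
  summable_fam f <-> (\esum_(k in [set: K]) `|f k|%:E < +oo)%E.
Proof.
rewrite -integral_dcount//.
by split=> [/integrableP[]|h] //; apply/integrableP.
Qed.

Lemma summable_le f g : summable_fam g -> (forall k, `|f k| <= `|g k|) ->
  summable_fam f.
Proof. by move=> sg fg; apply: le_integrable sg => // k _ /=; rewrite lee_fin. Qed.

Lemma summableD f g : summable_fam f -> summable_fam g ->
  summable_fam (fun k => f k + g k).
Proof. by move=> sf sg; exact: (integrableD measurableT sf sg). Qed.

Lemma summableB f g : summable_fam f -> summable_fam g ->
  summable_fam (fun k => f k - g k).
Proof. by move=> sf sg; exact: (integrableB measurableT sf sg). Qed.

Lemma summableZ (a : R) f : summable_fam f -> summable_fam (fun k => a * f k).
Proof. by move=> sf; exact: (integrableZl measurableT a sf). Qed.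

Lemma summable_norm f : summable_fam f -> summable_fam (fun k => `|f k|).
Proof. exact: integrable_norm. Qed.

Lemma summable_bound f g (M : R) : summable_fam f -> (forall k, `|g k| <= M) ->
  summable_fam (fun k => f k * g k).
Proof.
move=> sf gM; apply: (@summable_le _ (fun k => M * f k)); first exact: summableZ.
by move=> k; rewrite !normrM mulrC ler_wpM2r// (le_trans (gM k)) ?ler_norm.
Qed.

Lemma isumD f g : summable_fam f -> summable_fam g ->
  isum (fun k => f k + g k) = isum f + isum g.
Proof. by move=> sf sg; apply: RintegralD. Qed.

Lemma isumB f g : summable_fam f -> summable_fam g ->
  isum (fun k => f k - g k) = isum f - isum g.
Proof. by move=> sf sg; apply: RintegralB. Qed.

Lemma isumZ (a : R) f : summable_fam f -> isum (fun k => a * f k) = a * isum f.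
Proof. by move=> sf; apply: RintegralZl. Qed.

Lemma le_isum f g : summable_fam f -> summable_fam g ->
  (forall k, f k <= g k) -> isum f <= isum g.
Proof. by move=> sf sg fg; apply: le_Rintegral. Qed.

Lemma isum_ge0 f : (forall k, 0 <= f k) -> 0 <= isum f.
Proof. by move=> f0; apply: Rintegral_ge0. Qed.

Lemma norm_isum_le f : summable_fam f -> `|isum f| <= isum (fun k => `|f k|).
Proof. by move=> sf; apply: le_normr_Rintegral. Qed.

Lemma eq_isum f g : f =1 g -> isum f = isum g.
Proof. by move=> /funext ->. Qed.

End discrete_sums.

(** * Descent and coupling inequalities *)

Section dual_ascent.
Context {R : realType} {dX : measure_display} {X : measurableType dX}
  (mu : probability X R) {dT : measure_display} {T : measurableType dT}
  {K : countType} {k0 : K}.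
Local Notation J := (discr k0).
Context (eps : R) (c : X -> T -> R) (Kc : T -> R) (e : J -> X -> R) (w : J -> R).
Hypothesis eps_gt0 : 0 < eps.
Hypothesis mc : measurable_fun setT (fun p : X * T => c p.1 p.2).
Hypothesis cK : forall x y, `|c x y| <= Kc y.
Hypothesis me : forall k, measurable_fun setT (e k).
Hypothesis e1 : forall k x, `|e k x| <= 1.
Hypothesis w0 : forall k, 0 < w k.
Hypothesis sw : summable_fam w.
Implicit Types (s t r q : J -> R) (y : T).

Lemma bmf_cost y : bmf (c^~ y).
Proof.
split; last by exists (Kc y).
exact: (measurableT_comp mc (@measurable_pair2 _ _ _ _ y)).
Qed.

Lemma bmf_e k : bmf (e k).
Proof. by split; [exact: me|exists 1]. Qed.

Definition trig t x : R := isum (fun k => t k * e k x).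

Definition norm1 t : R := isum (fun k => `|t k|).

Lemma norm1_ge0 t : 0 <= norm1 t.
Proof. by apply: isum_ge0. Qed.

Lemma summable_trig t x : summable_fam t -> summable_fam (fun k => t k * e k x).
Proof. by move=> st; apply: (summable_bound (M := 1)). Qed.

Lemma trig_le t x : summable_fam t -> `|trig t x| <= norm1 t.
Proof.
move=> st; apply: (le_trans (norm_isum_le (summable_trig x st))).
apply: le_isum => [||k]; [exact/summable_norm/summable_trig|exact: summable_norm|].
by rewrite normrM ler_piMr.
Qed.

Lemma bmf_trig t : summable_fam t -> bmf (trig t).
Proof.
move=> st; split; last by exists (norm1 t) => x; exact: trig_le.
apply: (measurable_Rintegral_param (@dcount R K k0)
  (f := fun x (k : J) => t k * e k x)).
apply: measurable_fun_prod_discr => k /=; apply: measurable_funM.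
  exact: measurable_cst.
exact: me.
Qed.

Lemma trigD s t x : summable_fam s -> summable_fam t ->
  trig (fun k => s k + t k) x = trig s x + trig t x.
Proof.
move=> ss st; rewrite /trig -isumD; [|exact: summable_trig..].
by apply: eq_isum => k; rewrite mulrDl.
Qed.

Lemma trigZ (a : R) t x : summable_fam t ->
  trig (fun k => a * t k) x = a * trig t x.
Proof.
move=> st; rewrite /trig -isumZ; last exact: summable_trig.
by apply: eq_isum => k; rewrite mulrA.
Qed.

Lemma trigB s t x : summable_fam s -> summable_fam t ->
  trig (fun k => s k - t k) x = trig s x - trig t x.
Proof.
move=> ss st; rewrite /trig -isumB; [|exact: summable_trig..].
by apply: eq_isum => k; rewrite mulrBl.
Qed.

(** Fubini between [mu] and the counting measure. With a Gibbs density for [F] it rewrites pairings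
    with the gradient; with a mode for [F] it extracts Fourier coefficients. *)
Lemma pairing (F : X -> R) t : bmf F -> summable_fam t ->
  \int[mu]_x (F x * trig t x) = isum (fun k => t k * \int[mu]_x (F x * e k x)).
Proof.
move=> bF st; have [mF [M FM]] := bF.
pose g x (k : J) := t k * (F x * e k x).
have bFe k : bmf (fun x => F x * e k x) by apply: bmfM => //; exact: bmf_e.
have sg x : summable_fam (g x).
  apply: (summable_bound (M := M)) => // k.
  by rewrite normrM -[M]mulr1 ler_pM.
have mg : measurable_fun setT (fun p : X * J => (g p.1 p.2)%:E).
  apply/measurable_EFinP; apply: measurable_fun_prod_discr => k /=.
  by apply: measurable_funM; [exact: measurable_cst|case: (bFe k)].
have M0 : 0 <= M by apply: le_trans (FM point).
have ig : (mu \x dcount)%E.-integrable setT (fun p : X * J => (g p.1 p.2)%:E).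
  apply/integrable12ltyP => //=.
  have sM : summable_fam (fun k => M * t k) by exact: summableZ.
  apply: (@le_lt_trans _ _ (\int[mu]_x (norm1 (fun k => M * t k))%:E)%E); last first.
    by rewrite integral_cst//= -[mu _]/(mu setT) probability_setT mule1 ltry.
  apply: ge0_le_integral => //.
  - by move=> x _; apply: integral_ge0.
  - apply: (measurable_fun_fubini_tonelli_F (m2 := dcount) (abse \o (fun p : X * J => (g p.1 p.2)%:E))) => //.
      exact: measurableT_comp.
    by move=> p; exact: abse_ge0.
  - move=> x _; rewrite /norm1 /isum /Rintegral fineK; last first.
      by have := integrable_fin_num measurableT (summable_norm sM).
    apply: ge0_le_integral => // k _; rewrite lee_fin /g !normrM mulrC ler_pM//.
    by rewrite -[leRHS]mulr1 ler_pM// (le_trans (FM x)) ?ler_norm.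
transitivity (\int[mu]_x (isum (g x))).
  apply: eq_Rintegral => x _; rewrite /trig -isumZ; last exact: summable_trig.
  by apply: eq_isum => k; rewrite /g mulrCA.
rewrite /isum /Rintegral.
have /= FE := Fubini ig.
transitivity (fine (\int[mu]_x \int[dcount]_k (g x k)%:E)%E).
  congr fine; apply: eq_integral => x _; rewrite fineK//.
  by have := integrable_fin_num measurableT (sg x).
rewrite FE; congr fine; apply: eq_integral => k _.
rewrite -/(Rintegral mu setT (fun x => F x * e k x)) -meanZ//.
by rewrite -(bmf_integralE mu (u := fun x => t k * (F x * e k x)))//; exact: bmfZ.
Qed.

Definition fr t y : R := free mu eps (c^~ y) (trig t).

Definition grad t y k : R := \int[mu]_x (tilt mu eps (c^~ y) (trig t) x * e k x).

Lemma grad_le t y k : summable_fam t -> `|grad t y k| <= 1.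
Proof.
move=> st; have bc := bmf_cost y; have bt := bmf_trig st.
have bF := bmf_tilt mu eps bc bt.
have bFe : bmf (fun x => tilt mu eps (c^~ y) (trig t) x * e k x).
  by apply: bmfM => //; exact: bmf_e.
rewrite (le_trans (norm_mean_le mu bFe))// -[leRHS](int_tilt mu eps_gt0 bc bt).
apply: le_mean => // [|x]; first exact: bmf_norm.
have F0 := tilt_gt0 mu eps_gt0 bc x bt.
by rewrite normrM (gtr0_norm F0) ler_piMr// ltW.
Qed.

Lemma pairing_grad s t y : summable_fam s -> summable_fam t ->
  isum (fun k => s k * grad t y k) =
  \int[mu]_x (tilt mu eps (c^~ y) (trig t) x * trig s x).
Proof.
move=> ss st; rewrite -pairing//.
by apply: bmf_tilt => //; [exact: bmf_cost|exact: bmf_trig].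
Qed.

Lemma summable_grad s t y : summable_fam s -> summable_fam t ->
  summable_fam (fun k => s k * grad t y k).
Proof. by move=> ss st; apply: (summable_bound (M := 1)) => // k; exact: grad_le. Qed.

Lemma grad_convex s t y : summable_fam s -> summable_fam t ->
  isum (fun k => (s k - t k) * grad t y k) <= fr s y - fr t y.
Proof.
move=> ss st; rewrite pairing_grad//; last exact: summableB.
under eq_Rintegral do rewrite trigB//.
apply: free_convex => //; [exact: bmf_cost|exact: bmf_trig..].
Qed.

Lemma fr_lipschitz s t y : summable_fam s -> summable_fam t ->
  `|fr s y - fr t y| <= norm1 (fun k => s k - t k).
Proof.
have one a b : summable_fam a -> summable_fam b ->
    fr b y - fr a y <= norm1 (fun k => a k - b k).
  move=> sa sb; rewrite -lerN2 opprB; apply: le_trans (grad_convex y sa sb).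
  have sab := summableB sa sb.
  rewrite lerNl; apply: le_trans (ler_norm _) _; rewrite normrN.
  apply: (le_trans (norm_isum_le (summable_grad y sab sb))).
  apply: le_isum => [||k]; [exact/summable_norm/summable_grad|exact: summable_norm|].
  by rewrite normrM ler_piMr//; exact: grad_le.
move=> ss st; rewrite ler_norml; apply/andP; split.
  by rewrite lerNl opprB; exact: one.
rewrite (le_trans (one t s st ss))// le_eqVlt; apply/orP; left; apply/eqP.
by apply: eq_isum => k; rewrite distrC.
Qed.

(** The constant of [free_strong_midpoint] is split in two: [kap] holds the part due to the sample,
    through the size of its cost, and [modulus] the part due to the radius of the parameters. *)
Definition kap y : R := expR (- (2 * Kc y) / eps).
Definition modulus (M : R) : R := (8 * eps)^-1 * expR (- (4 * M) / eps).

Lemma modulus_gt0 M : 0 < modulus M.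
Proof. by rewrite mulr_gt0 ?expR_gt0// invr_gt0 mulr_gt0. Qed.

Lemma modulus_le M N : M <= N -> modulus N <= modulus M.
Proof.
move=> MN; rewrite ler_pM2l ?invr_gt0 ?mulr_gt0// ler_expR.
by rewrite ler_pM2r ?invr_gt0// lerN2 ler_pM2l.
Qed.

Definition trig_gap s t : R := var mu (fun x => trig s x - trig t x).

Lemma gap_ge0 s t : summable_fam s -> summable_fam t -> 0 <= trig_gap s t.
Proof. by move=> ss st; apply: var_ge0; apply: bmfB; exact: bmf_trig. Qed.

Lemma fr_midpoint s t y (M : R) : summable_fam s -> summable_fam t ->
  norm1 s <= M -> norm1 t <= M ->
  modulus M * kap y * trig_gap s t <=
  2^-1 * fr s y + 2^-1 * fr t y - fr (fun k => 2^-1 * (s k + t k)) y.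
Proof.
move=> ss st sM tM.
have := free_strong_midpoint mu eps_gt0 (bmf_cost y) (bmf_trig ss) (bmf_trig st)
  (fun x => le_trans (trig_le x ss) sM) (fun x => le_trans (trig_le x st) tM)
  (fun x => cK x y).
have -> : - (4 * M + 2 * Kc y) / eps = - (4 * M) / eps + - (2 * Kc y) / eps.
  by rewrite opprD mulrDl.
rewrite expRD /fr /trig_gap /modulus /kap mulrA.
suff -> : trig (fun k => 2^-1 * (s k + t k)) = fun x => 2^-1 * (trig s x + trig t x) by [].
by apply/funext => x; rewrite trigZ ?trigD//; exact: summableD.
Qed.

(** The subgradient inequalities at [s] and at [t], both tested at the midpoint, are added to
    [fr_midpoint]. Each displacement to the midpoint is half of [s - t] and each value has weight
    one half, whence the factor 4. *)
Lemma grad_strongly_monotone s t y (M : R) : summable_fam s -> summable_fam t ->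
  norm1 s <= M -> norm1 t <= M ->
  4 * (modulus M * kap y * trig_gap s t) <=
  isum (fun k => (s k - t k) * (grad s y k - grad t y k)).
Proof.
have fin (a b p q r G x1 x2 : R) : G <= 2^-1 * p + 2^-1 * q - r ->
    x1 <= r - p -> x2 <= r - q -> x1 = - 2^-1 * a -> x2 = 2^-1 * b ->
    4 * G <= a - b by lra.
move=> ss st sM tM; have h := fr_midpoint y ss st sM tM.
pose m k := 2^-1 * (s k + t k).
have sm : summable_fam m by apply: summableZ; exact: summableD.
have h1 := grad_convex y sm ss; have h2 := grad_convex y sm st.
have sst := summableB ss st.
have E1 : isum (fun k => (m k - s k) * grad s y k) =
    - 2^-1 * isum (fun k => (s k - t k) * grad s y k).
  rewrite -isumZ; last exact: summable_grad.
  by apply: eq_isum => k; rewrite /m; field.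
have E2 : isum (fun k => (m k - t k) * grad t y k) =
    2^-1 * isum (fun k => (s k - t k) * grad t y k).
  rewrite -isumZ; last exact: summable_grad.
  by apply: eq_isum => k; rewrite /m; field.
have -> : isum (fun k => (s k - t k) * (grad s y k - grad t y k)) =
    isum (fun k => (s k - t k) * grad s y k) - isum (fun k => (s k - t k) * grad t y k).
  rewrite -isumB; [|exact: summable_grad..].
  by apply: eq_isum => k; rewrite mulrBr.
exact: fin h h1 h2 E1 E2.
Qed.

Lemma grad_lipschitz s t y k : summable_fam s -> summable_fam t ->
  `|grad s y k - grad t y k| <= 8 / eps * norm1 (fun k => s k - t k).
Proof.
move=> ss st; have bc := bmf_cost y.
have bs := bmf_tilt mu eps bc (bmf_trig ss).
have bt := bmf_tilt mu eps bc (bmf_trig st).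
have be := bmf_e k.
rewrite /grad -meanB; [|exact: bmfM..].
have bd : bmf (fun x => tilt mu eps (c^~ y) (trig s) x * e k x -
   tilt mu eps (c^~ y) (trig t) x * e k x) by apply: bmfB; exact: bmfM.
apply: (le_trans (norm_mean_le mu bd)).
have hl := @tilt_lipschitz _ _ _ mu eps _ eps_gt0 bc _ _
  (norm1 (fun k => s k - t k)) (bmf_trig ss) (bmf_trig st).
apply: le_trans (hl _).
  apply: le_mean => [||x]; [exact: bmf_norm|by apply: bmf_norm; exact: bmfB|].
  by rewrite -mulrBl normrM ler_piMr.
by move=> x; rewrite -trigB//; apply: trig_le; exact: summableB.
Qed.

Definition wenergy s : R := isum (fun k => (w k)^-1 * s k ^+ 2).
Definition fin_wenergy s := summable_fam (fun k => (w k)^-1 * s k ^+ 2).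
Definition wmass : R := isum w.

Lemma mass_ge0 : 0 <= wmass.
Proof. by apply: isum_ge0 => k; exact: ltW. Qed.

Lemma energy_ge0 s : 0 <= wenergy s.
Proof. by apply: isum_ge0 => k; rewrite mulr_ge0 ?sqr_ge0// invr_ge0 ltW. Qed.

Lemma weight_amgm (a : R) s k : a * (2 * `|s k|) <= a ^+ 2 * w k + (w k)^-1 * s k ^+ 2.
Proof.
rewrite -subr_ge0 -[s k ^+ 2]real_normK ?num_real//.
have -> : a ^+ 2 * w k + (w k)^-1 * `|s k| ^+ 2 - a * (2 * `|s k|) =
  w k * (a - (w k)^-1 * `|s k|) ^+ 2 by field; exact: lt0r_neq0.
by rewrite mulr_ge0 ?sqr_ge0// ltW.
Qed.

Lemma fin_energy_summable s : fin_wenergy s -> summable_fam s.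
Proof.
move=> fs; apply: (summable_le (summableD sw fs)) => k.
have h := weight_amgm 1 s k.
have n0 : 0 <= `|s k| by [].
rewrite [leRHS]ger0_norm; last first.
  apply: addr_ge0; first exact: ltW.
  by apply: mulr_ge0; [rewrite invr_ge0 ltW|exact: sqr_ge0].
by move: h; rewrite expr1n !mul1r; lra.
Qed.

(** Cauchy-Schwarz, obtained by summing [weight_amgm] and choosing the optimal
    [a = norm1 s / wmass]. If [wmass] were 0, a large [a] would be contradictory unless
    [norm1 s = 0]. *)
Lemma norm1_energy s : fin_wenergy s -> norm1 s ^+ 2 <= wmass * wenergy s.
Proof.
move=> fs; have ss := fin_energy_summable fs.
have N0 := norm1_ge0 s; have V0 := energy_ge0 s; have S0 := mass_ge0.
have key (a : R) : a * (2 * norm1 s) <= a ^+ 2 * wmass + wenergy s.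
  have s1 : summable_fam (fun k => `|s k|) by exact: summable_norm.
  have s2 : summable_fam (fun k => 2 * `|s k|) by exact: summableZ.
  have s3 : summable_fam (fun k => a ^+ 2 * w k) by exact: summableZ.
  rewrite /norm1 /wmass /wenergy -!isumZ// -isumD//.
  apply: le_isum => [||k].
  - exact: summableZ.
  - exact: summableD.
  - exact: weight_amgm.
have [N00|Npos] := eqVneq (norm1 s) 0.
  by rewrite N00 expr0n/= mulr_ge0.
have {}N0 : 0 < norm1 s by rewrite lt_neqAle eq_sym Npos.
have [S00|Spos] := eqVneq wmass 0.
  have := key ((wenergy s + 1) / norm1 s); rewrite S00 mulr0 add0r mulrCA mulfVK//; lra.
have {}S0 : 0 < wmass by rewrite lt_neqAle eq_sym Spos.
have := key (norm1 s / wmass).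
have -> : norm1 s / wmass * (2 * norm1 s) = 2 * (norm1 s ^+ 2 / wmass) by ring.
have -> : (norm1 s / wmass) ^+ 2 * wmass = norm1 s ^+ 2 / wmass.
  by field; exact: lt0r_neq0.
move=> h; rewrite mulrC -ler_pdivrMr//; lra.
Qed.

Definition sgd_step t y (g : R) k : R := t k - g * (w k * grad t y k).

Lemma fin_energyD s q : fin_wenergy s -> fin_wenergy q ->
  fin_wenergy (fun k => s k + q k).
Proof.
move=> fs fq; apply: (summable_le (g := fun k => 2 * ((w k)^-1 * s k ^+ 2) + 2 * ((w k)^-1 * q k ^+ 2))).
  by apply: summableD; exact: summableZ.
move=> k; have wi : 0 < (w k)^-1 by rewrite invr_gt0.
have p (a : R) : 0 <= (w k)^-1 * a ^+ 2 by rewrite mulr_ge0 ?sqr_ge0// ltW.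
rewrite (ger0_norm (p _)) ger0_norm; last by rewrite addr_ge0// mulr_ge0// p.
rewrite -subr_ge0.
have -> : 2 * ((w k)^-1 * s k ^+ 2) + 2 * ((w k)^-1 * q k ^+ 2) -
  (w k)^-1 * (s k + q k) ^+ 2 = (w k)^-1 * (s k - q k) ^+ 2 by ring.
exact: p.
Qed.

Lemma summable_wq q (M : R) : (forall k, `|q k| <= M) ->
  summable_fam (fun k => w k * q k ^+ 2).
Proof.
move=> qM; apply: (summable_bound (M := M ^+ 2)) => // k.
rewrite normrX lerXn2r ?nnegrE//; exact: le_trans (qM k).
Qed.

Lemma fin_energy_wq q (M g : R) : (forall k, `|q k| <= M) ->
  fin_wenergy (fun k => - (g * (w k * q k))).
Proof.
move=> qM; rewrite /fin_wenergy.
rewrite (_ : (fun k => _) = fun k => g ^+ 2 * (w k * q k ^+ 2)).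
  by apply: summableZ; exact: (summable_wq qM).
by apply/funext => k; field; exact: lt0r_neq0.
Qed.

(** The inverse weights of the energy cancel the preconditioner: the cross term is the unweighted
    pairing to which convexity applies, and the quadratic term carries a summable weight. *)
Lemma energy_update s q (M g : R) : fin_wenergy s -> (forall k, `|q k| <= M) ->
  wenergy (fun k => s k - g * (w k * q k)) =
  wenergy s - 2 * g * isum (fun k => s k * q k) + g ^+ 2 * isum (fun k => w k * q k ^+ 2).
Proof.
move=> fs qM; have ss := fin_energy_summable fs.
have ssq : summable_fam (fun k => s k * q k) by exact: (summable_bound (M := M)).
have sq := summable_wq qM.
rewrite /wenergy -!isumZ// -isumB//; last exact: summableZ.
rewrite -isumD; last 2 first.
- by apply: summableB => //; exact: summableZ.
- exact: summableZ.
by apply: eq_isum => k; field; exact: lt0r_neq0.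
Qed.

Lemma fin_energy_sgd t r y (g : R) : summable_fam t ->
  fin_wenergy (fun k => t k - r k) -> fin_wenergy (fun k => sgd_step t y g k - r k).
Proof.
move=> st ftr.
rewrite (_ : (fun k => _) = fun k => (t k - r k) + (- (g * (w k * grad t y k)))).
  apply: fin_energyD => //; apply: (fin_energy_wq (M := 1)) => k.
  exact: grad_le.
by apply/funext => k; rewrite /sgd_step addrAC.
Qed.

Lemma isum_wgrad_le t y : summable_fam t ->
  isum (fun k => w k * grad t y k ^+ 2) <= wmass.
Proof.
move=> st; apply: le_isum => //.
  by apply: (summable_wq (M := 1)) => k; exact: grad_le.
move=> k; rewrite ler_piMr ?(ltW (w0 k))//.
by rewrite -real_normK ?num_real// expr_le1// grad_le.
Qed.

Lemma energy_descent t r y (g : R) : 0 <= g -> summable_fam t -> summable_fam r ->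
  fin_wenergy (fun k => t k - r k) ->
  wenergy (fun k => sgd_step t y g k - r k) <=
  wenergy (fun k => t k - r k) - 2 * g * (fr t y - fr r y) + g ^+ 2 * wmass.
Proof.
move=> g0 st sr ftr.
have -> : (fun k => sgd_step t y g k - r k) = fun k => (t k - r k) - g * (w k * grad t y k).
  by apply/funext => k; rewrite /sgd_step addrAC.
rewrite (energy_update (M := 1))//; last by move=> k; exact: grad_le.
apply: lerD; last by rewrite ler_wpM2l ?sqr_ge0// isum_wgrad_le.
rewrite lerD2l lerN2 ler_wpM2l ?mulr_ge0//.
have := grad_convex y sr st.
have -> : isum (fun k => (r k - t k) * grad t y k) = - isum (fun k => (t k - r k) * grad t y k).
  rewrite -mulN1r -isumZ; last by apply: summable_grad => //; exact: summableB.
  by apply: eq_isum => k; rewrite mulN1r -mulNr opprB.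
by rewrite lerNl opprB.
Qed.

(** With a common sample the cross term is governed by strong monotonicity, hence
    [8 * g = 2 * g * 4]. The quadratic term is proportional to the energy by the Lipschitz bound on
    gradients and [norm1_energy]. *)
Lemma energy_coupling s t y (g M : R) : 0 <= g -> summable_fam s -> summable_fam t ->
  fin_wenergy (fun k => s k - t k) -> norm1 s <= M -> norm1 t <= M ->
  wenergy (fun k => sgd_step s y g k - sgd_step t y g k) +
    8 * g * (modulus M * kap y * trig_gap s t) <=
  (1 + g ^+ 2 * (wmass * (8 / eps) ^+ 2 * wmass)) * wenergy (fun k => s k - t k).
Proof.
move=> g0 ss st fst sM tM.
pose q k := grad s y k - grad t y k.
have qM k : `|q k| <= 8 / eps * norm1 (fun k => s k - t k) by exact: grad_lipschitz.
have -> : (fun k => sgd_step s y g k - sgd_step t y g k) = fun k => (s k - t k) - g * (w k * q k).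
  apply/funext => k; rewrite /sgd_step /q.
  by move: (grad s y k) (grad t y k) => a b; ring.
rewrite (energy_update _ fst qM).
have := grad_strongly_monotone y ss st sM tM; rewrite -/q.
have h2 : isum (fun k => w k * q k ^+ 2) <=
    wmass * (8 / eps) ^+ 2 * wmass * wenergy (fun k => s k - t k).
  rewrite -[leRHS]mulrA -mulrA.
  apply: (@le_trans _ _ (wmass * ((8 / eps) ^+ 2 * norm1 (fun k => s k - t k) ^+ 2))); last first.
    rewrite ler_wpM2l ?mass_ge0// ler_wpM2l ?sqr_ge0//; exact: norm1_energy.
  rewrite mulrC -isumZ//; apply: le_isum => [||k]; first exact: (summable_wq qM).
    exact: summableZ.
  rewrite mulrC ler_pM2r// -exprMn -[leLHS]real_normK ?num_real// lerXn2r ?nnegrE//.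
  by rewrite mulr_ge0 ?norm1_ge0// divr_ge0// ltW.
have := ler_wpM2l (sqr_ge0 g) h2.
have fin (V b I G L : R) : g ^+ 2 * I <= g ^+ 2 * (L * V) -> 4 * G <= b ->
    V - 2 * g * b + g ^+ 2 * I + 8 * g * G <= (1 + g ^+ 2 * L) * V.
  by move=> h3 h4; have := ler_wpM2l (mulr_ge0 (ler0n R 2) g0) h4; lra.
exact: fin.
Qed.

End dual_ascent.

(** * Convergence along random paths *)

Lemma midpoint_arith {R : realType} (q fa f0 fm : R) :
  q <= 2^-1 * fa + 2^-1 * f0 - fm -> 4 * q <= 2 * fa + 2 * f0 - 4 * fm.
Proof. lra. Qed.

Lemma lyap_arith {R : realType} (W V g fa f0 fm C k G0 s m : R) :
  W <= V - 2 * g * (fa - f0) + g ^+ 2 * m ->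
  g * (4 * (C * k)) <= g * (2 * fa + 2 * f0 - 4 * fm) ->
  W + m * (G0 - (s + g ^+ 2)) <=
  V + m * (G0 - s) - (4 * g * C) * k - 4 * g * (fm - f0).
Proof. lra. Qed.

Section stochastic_approximation.
Context {R : realType} {dX : measure_display} {X : measurableType dX}
  (mu : probability X R) {dT : measure_display} {T : measurableType dT}
  (nu : probability T R) {K : countType} {k0 : K}.
Local Notation J := (discr k0).
Context (eps : R) (c : X -> T -> R) (Kc : T -> R) (e : J -> X -> R) (w : J -> R).
Hypothesis eps_gt0 : 0 < eps.
Hypothesis mc : measurable_fun setT (fun p : X * T => c p.1 p.2).
Hypothesis mKc : measurable_fun setT Kc.
Hypothesis cK : forall x y, `|c x y| <= Kc y.
Hypothesis me : forall k, measurable_fun setT (e k).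
Hypothesis e1 : forall k x, `|e k x| <= 1.
Hypothesis w0 : forall k, 0 < w k.
Hypothesis sw : summable_fam w.

Local Notation trig := (trig e).
Local Notation fr := (fr mu eps c e).
Local Notation grad := (grad mu eps c e).
Local Notation sgd := (sgd_step mu eps c e w).
Local Notation gap := (trig_gap mu e).
Local Notation energy := (wenergy w).
Local Notation fin_energy := (fin_wenergy w).
Local Notation mass := (wmass w).
Local Notation kap := (kap eps Kc).
Local Notation modulus := (modulus eps).

Section parametric_measurability.
Context {dW : measure_display} {W : measurableType dW}.
Context (t : W -> J -> R) (y : W -> T).
Hypothesis mt : forall k, measurable_fun setT (fun z => t z k).
Hypothesis st : forall z, summable_fam (t z).
Hypothesis my : measurable_fun setT y.

Lemma measurable_trig_param :
  measurable_fun setT (fun p : W * X => trig (t p.1) p.2).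
Proof.
apply: (measurable_Rintegral_param (@dcount R K k0)
  (f := fun (p : W * X) (k : J) => t p.1 k * e k p.2)).
apply: measurable_fun_prod_discr => k /=; apply: measurable_funM.
  exact: (measurableT_comp (@mt k) measurable_fst).
exact: (measurableT_comp (@me k) measurable_snd).
Qed.

Lemma measurable_boltz_param :
  measurable_fun setT (fun p : W * X => boltz eps (c^~ (y p.1)) (trig (t p.1)) p.2).
Proof.
apply: measurableT_comp => //; apply: measurable_funM; last exact: measurable_cst.
apply: measurable_funB; first exact: measurable_trig_param.
apply: (measurableT_comp (f := fun p : X * T => c p.1 p.2)
  (g := fun p : W * X => (p.2, y p.1))) => //.
apply/measurable_fun_pairP; split; first exact: measurable_snd.
exact: (measurableT_comp my measurable_fst).
Qed.

Lemma measurable_pfun_param :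
  measurable_fun setT (fun z => pfun mu eps (c^~ (y z)) (trig (t z))).
Proof.
apply: (measurable_Rintegral_param mu
  (f := fun (z : W) (x : X) => boltz eps (c^~ (y z)) (trig (t z)) x)).
exact: measurable_boltz_param.
Qed.

Lemma measurable_fr_param : measurable_fun setT (fun z => fr (t z) (y z)).
Proof.
apply: measurable_funD; last exact: measurable_cst.
apply: measurable_funM; first exact: measurable_cst.
by apply: measurableT_comp => //; exact: measurable_pfun_param.
Qed.

Lemma measurable_grad_param k : measurable_fun setT (fun z => grad (t z) (y z) k).
Proof.
apply: (measurable_Rintegral_param mu
  (f := fun (z : W) (x : X) => tilt mu eps (c^~ (y z)) (trig (t z)) x * e k x)).
apply: measurable_funM; last exact: (measurableT_comp (@me k) measurable_snd).
(* The reciprocal of the positive partition function is written as exp of minus its logarithm, a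
   composition of measurable maps. *)
rewrite (_ : (fun p : W * X => _) = fun p : W * X =>
    boltz eps (c^~ (y p.1)) (trig (t p.1)) p.2 *
    expR (- ln (pfun mu eps (c^~ (y p.1)) (trig (t p.1))))); last first.
  apply/funext => p; rewrite /tilt expRN lnK// posrE.
  by apply: pfun_gt0 => //; [exact: bmf_cost|exact: bmf_trig].
apply: measurable_funM; first exact: measurable_boltz_param.
apply: measurableT_comp => //; apply: measurable_funN; apply: measurableT_comp => //.
exact: (measurableT_comp measurable_pfun_param measurable_fst).
Qed.

Lemma measurable_energy_param (r : J -> R) :
  measurable_fun setT (fun z => energy (fun k => t z k - r k)).
Proof.
apply: (measurable_Rintegral_param (@dcount R K k0)
  (f := fun (z : W) (k : J) => (w k)^-1 * (t z k - r k) ^+ 2)).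
apply: measurable_fun_prod_discr => k /=; apply: measurable_funM; first exact: measurable_cst.
by apply: measurable_funX; apply: measurable_funB => //; exact: measurable_cst.
Qed.

Lemma measurable_gap_param (r : J -> R) : summable_fam r ->
  measurable_fun setT (fun z => gap (t z) r).
Proof.
move=> sr.
have mD : measurable_fun setT (fun p : W * X => trig (t p.1) p.2 - trig r p.2).
  apply: measurable_funB; first exact: measurable_trig_param.
  by apply: (measurableT_comp _ measurable_snd); case: (bmf_trig me e1 sr).
apply: measurable_funB; last apply: measurable_funX.
  apply: (measurable_Rintegral_param mu
    (f := fun (z : W) (x : X) => (trig (t z) x - trig r x) ^+ 2)).
  exact: measurable_funX.
exact: (measurable_Rintegral_param mu
  (f := fun (z : W) (x : X) => trig (t z) x - trig r x)).
Qed.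

End parametric_measurability.

Context (gm : nat -> R) (G0 : R).
Hypothesis gm0 : forall n, 0 <= gm n.
Hypothesis gmdiv : forall A : R, exists n, A <= \sum_(0 <= k < n) gm k.
Hypothesis gm2 : forall n, \sum_(0 <= k < n) gm k ^+ 2 <= G0.

Context (rt : J -> R).
Hypothesis srt : summable_fam rt.

Lemma fin_energy_shift (t r : J -> R) : summable_fam r ->
  fin_energy (fun k => t k - r k) -> summable_fam t.
Proof.
move=> sr ft; rewrite (_ : t = fun k => (t k - r k) + r k).
  by apply: summableD => //; exact: (fin_energy_summable w0 sw ft).
by apply/funext => k; rewrite subrK.
Qed.

(** An l1-bound for families at energy at most [V] from [rt]; [mass + V] stands for the larger side
    of [sqrt (mass * V) <= mass + V]. *)
Definition radius (V : R) : R := norm1 rt + (mass + V).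

Lemma norm1D (s t : J -> R) : summable_fam s -> summable_fam t ->
  norm1 (fun k => s k + t k) <= norm1 s + norm1 t.
Proof.
move=> ss st; rewrite /norm1 -isumD; [|exact: summable_norm..].
apply: le_isum => [||k]; last exact: ler_normD.
  by apply: summable_norm; exact: summableD.
by apply: summableD; exact: summable_norm.
Qed.

Lemma norm1_le_energy (s : J -> R) : fin_energy s -> norm1 s <= mass + energy s.
Proof.
move=> fs; have m0 := mass_ge0 w0; have V0 := energy_ge0 w0 s.
have h := norm1_energy w0 sw fs.
rewrite -ler_sqr ?nnegrE ?norm1_ge0 ?addr_ge0//; apply: le_trans h _.
rewrite -subr_ge0.
have -> : (mass + energy s) ^+ 2 - mass * energy s =
  mass ^+ 2 + energy s ^+ 2 + mass * energy s by ring.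
by rewrite !addr_ge0 ?sqr_ge0 ?mulr_ge0.
Qed.

Lemma norm1_le_radius (t : J -> R) (V : R) : fin_energy (fun k => t k - rt k) ->
  energy (fun k => t k - rt k) <= V -> norm1 t <= radius V.
Proof.
move=> ft tV; have sd := fin_energy_summable w0 sw ft.
rewrite {1}(_ : t = fun k => rt k + (t k - rt k)); last first.
  by apply/funext => k; rewrite addrC subrK.
apply: (le_trans (norm1D srt sd)); rewrite lerD2l.
by apply: (le_trans (norm1_le_energy ft)); rewrite lerD2l.
Qed.

Lemma norm1_rt_le_radius (V : R) : 0 <= V -> norm1 rt <= radius V.
Proof. by move=> V0; rewrite lerDl addr_ge0 ?mass_ge0. Qed.

(* The iterates started at [rt]; the head of [x] is the last sample used. *)
Fixpoint traj (x : seq T) : J -> R :=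
  match x with
  | [::] => rt
  | y :: s => sgd (traj s) y (gm (size s))
  end.

Lemma fin_energy0 : fin_energy (fun k => rt k - rt k).
Proof.
rewrite /fin_wenergy (_ : (fun k => _) = fun k => 0 * rt k); first exact: summableZ.
by apply/funext => k; rewrite subrr expr0n mulr0 mul0r.
Qed.

Lemma fin_energy_traj x : fin_energy (fun k => traj x k - rt k).
Proof.
elim: x => [|y x IH]; first exact: fin_energy0.
by apply: fin_energy_sgd => //; exact: (fin_energy_shift srt).
Qed.

Lemma summable_traj x : summable_fam (traj x).
Proof. exact: (fin_energy_shift srt (fin_energy_traj x)). Qed.

Lemma measurable_traj n k : measurable_fun setT (fun x : n.-tuple T => traj x k).
Proof.
elim: n k => [|n IH] k.
  rewrite (_ : (fun x => _) = fun _ => rt k); first exact: measurable_cst.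
  by apply/funext => x; rewrite (tuple0 x).
rewrite (_ : (fun x => _) = fun x : n.+1.-tuple T =>
    sgd (traj [tuple of behead x]) (tnth x ord0) (gm n) k); last first.
  apply/funext => x; case/tupleP: x => y x /=.
  have -> : tnth [tuple of y :: x] ord0 = y by [].
  by rewrite size_tuple.
have mb j : measurable_fun setT (fun x : n.+1.-tuple T => traj [tuple of behead x] j).
  exact: (measurableT_comp (IH j) (@measurable_behead _ _ _)).
apply: measurable_funB; first exact: mb.
apply: measurable_funM; first exact: measurable_cst.
apply: measurable_funM; first exact: measurable_cst.
apply: (measurable_grad_param (t := fun x : n.+1.-tuple T => traj [tuple of behead x])) => //.
- by move=> x; exact: summable_traj.
- exact: measurable_tnth.
Qed.

Lemma Kc_ge0 y : 0 <= Kc y.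
Proof. exact: le_trans (cK point y). Qed.

Lemma kap_gt0 y : 0 < kap y. Proof. exact: expR_gt0. Qed.

Lemma kap_le1 y : kap y <= 1.
Proof.
by rewrite -expR0 ler_expR mulNr oppr_le0 divr_ge0 ?mulr_ge0 ?Kc_ge0// ltW.
Qed.

Lemma bmf_kap : bmf kap.
Proof.
apply: (@bmf_bound _ _ _ _ 1) => [|y]; last by rewrite gtr0_norm ?kap_gt0// kap_le1.
apply: measurableT_comp => //; apply: measurable_funM; last exact: measurable_cst.
apply: measurable_funN; apply: measurable_funM => //; exact: measurable_cst.
Qed.

Definition kbar : R := \int[nu]_y kap y.

(** Pointwise positivity suffices: if the mean were 0, [kap] would vanish almost everywhere, and the
    whole space would be negligible. *)
Lemma kbar_gt0 : 0 < kbar.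
Proof.
rewrite lt_neqAle Rintegral_ge0 ?andbT; last by move=> y _; exact: ltW (kap_gt0 y).
apply/eqP => k00.
have I0 : (\int[nu]_y `|(kap y)%:E| = 0)%E.
  rewrite (eq_integral (fun y => (kap y)%:E)); last first.
    by move=> y _; rewrite gee0_abs// lee_fin ltW// kap_gt0.
  by rewrite (bmf_integralE nu bmf_kap) -/kbar -k00.
have mk : measurable_fun setT (EFin \o kap) by apply/measurable_EFinP; case: bmf_kap.
have [/(_ I0) [N [mN N0 subN]] _] := ae_eq_integral_abs nu measurableT mk.
have NT : N = setT.
  apply/seteqP; split => // y _; apply: subN => /= /(_ I) [] ky.
  by have := kap_gt0 y; rewrite ky ltxx.
have h : nu N = 1%E by rewrite NT; exact: probability_setT.
have [] : (1%E : \bar R) = 0%E := etrans (esym h) N0.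
by move=> /eqP; rewrite oner_eq0.
Qed.

Lemma gap_slow (s r s' r' : J -> R) (M d : R) : summable_fam s -> summable_fam r ->
  summable_fam s' -> summable_fam r' ->
  norm1 (fun k => s k - r k) <= M -> norm1 (fun k => s' k - r' k) <= M ->
  norm1 (fun k => (s' k - r' k) - (s k - r k)) <= d ->
  `|gap s' r' - gap s r| <= 4 * M * d.
Proof.
move=> ss sr ss' sr' sM sM' sd; have d1 := summableB ss sr; have d2 := summableB ss' sr'.
have bd a b : summable_fam a -> summable_fam b -> bmf (fun x => trig a x - trig b x).
  by move=> sa sb; apply: bmfB; apply: bmf_trig.
apply: var_lipschitz => [||x|x|x]; [exact: bd|exact: bd|..].
- by rewrite -trigB//; apply: le_trans sM'; exact: trig_le.
- by rewrite -trigB//; apply: le_trans sM; exact: trig_le.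
- rewrite -!trigB//; apply: le_trans sd; apply: trig_le => //.
  exact: summableB.
Qed.

Lemma norm1_wq (q : J -> R) (g M : R) : 0 <= g -> (forall k, `|q k| <= M) ->
  norm1 (fun k => g * (w k * q k)) <= g * (M * mass).
Proof.
move=> g0 qM; have s1 : summable_fam (fun k => w k * q k) by exact: (summable_bound (M := M)).
rewrite /norm1 /wmass -!isumZ//; last exact: summableZ.
apply: le_isum => [||k].
- by apply: summable_norm; exact: summableZ.
- by do 2 apply: summableZ.
- rewrite !normrM (ger0_norm g0) ler_wpM2l// (gtr0_norm (w0 k)) mulrC.
  by rewrite ler_wpM2r// ltW.
Qed.

(** * Deterministic analysis along one fixed sequence of samples *)

Section path.
Context (zs : nat -> T) (a t : nat -> J -> R).
Hypothesis a_rec : forall n, a n.+1 = sgd (a n) (zs n) (gm n).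
Hypothesis t_rec : forall n, t n.+1 = sgd (t n) (zs n) (gm n).
Hypothesis fa : forall n, fin_energy (fun k => a n k - rt k).
Hypothesis ft0 : fin_energy (fun k => t 0%N k - rt k).
Context (Va Ba : R).
Hypothesis a_bounded : forall n, energy (fun k => a n k - rt k) <= Va.
Hypothesis a_gap : forall n, \sum_(0 <= k < n) gm k * gap (a k) rt <= Ba.
Hypothesis kap_cauchy : forall d : R, 0 < d -> exists m, forall n n', (m <= n <= n')%N ->
  `|\sum_(n <= k < n') gm k * (kap (zs k) - kbar)| <= d.

Let sa n : summable_fam (a n).
Proof. exact: (fin_energy_shift srt (fa n)). Qed.

Lemma path_fin_energy n : fin_energy (fun k => t n k - rt k).
Proof.
elim: n => [//|n IH]; rewrite t_rec; apply: fin_energy_sgd => //.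
exact: (fin_energy_shift srt).
Qed.

Let ft n := path_fin_energy n.

Lemma path_summable n : summable_fam (t n).
Proof. exact: (fin_energy_shift srt (ft n)). Qed.

Let st n := path_summable n.

Let fta n : fin_energy (fun k => t n k - a n k).
Proof.
rewrite (_ : (fun k => _) = fun k => (t n k - rt k) + (-1) * (a n k - rt k)).
  apply: fin_energyD => //; rewrite /fin_wenergy.
  rewrite (_ : (fun k => _) = fun k => (w k)^-1 * (a n k - rt k) ^+ 2); first exact: fa.
  by apply/funext => k; rewrite mulN1r sqrrN.
by apply/funext => k; ring.
Qed.

Let L := mass * (8 / eps) ^+ 2 * mass.

Let L0 : 0 <= L.
Proof. by apply: mulr_ge0; first apply: mulr_ge0; rewrite ?sqr_ge0 ?mass_ge0. Qed.

Let D n := energy (fun k => t n k - a n k).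

Let D0 n : 0 <= D n. Proof. exact: energy_ge0. Qed.

Let sumL n : \sum_(0 <= k < n) gm k ^+ 2 * L <= G0 * L.
Proof. by rewrite -mulr_suml; apply: ler_wpM2r; [exact: L0|exact: gm2]. Qed.

Let step n (M : R) : norm1 (t n) <= M -> norm1 (a n) <= M ->
  D n.+1 + 8 * gm n * (modulus M * kap (zs n) * gap (t n) (a n)) <=
  (1 + gm n ^+ 2 * L) * D n.
Proof. by move=> tM aM; rewrite /D t_rec a_rec; exact: energy_coupling. Qed.

Let gap0 n : 0 <= gap (t n) (a n).
Proof. exact: gap_ge0. Qed.

Let GL n : 0 <= gm n ^+ 2 * L.
Proof. by apply: mulr_ge0; [exact: sqr_ge0|exact: L0]. Qed.

Let bn0 n (M : R) : 0 <= 8 * gm n * (modulus M * kap (zs n) * gap (t n) (a n)).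
Proof.
apply: mulr_ge0; first by rewrite mulr_ge0.
by rewrite mulr_ge0// mulr_ge0// ltW// ?modulus_gt0 ?kap_gt0.
Qed.

(** First pass, with the drift dropped: no uniform radius is known yet, so [M] depends on [n]. The
    bound on [D] then yields the uniform radius of [radii]. *)
Let D_bounded : exists B, forall n, D n <= B.
Proof.
have [|h _] := almost_nonincreasing (b := fun _ => 0) D0 (fun _ => lexx 0) GL sumL.
  move=> n; rewrite addr0.
  pose M := norm1 (t n) + norm1 (a n).
  apply: le_trans (step (M := M) _ _); rewrite ?lerDl ?lerDr ?norm1_ge0//.
by exists (expR (G0 * L) * D 0%N).
Qed.

Let radii : exists M, forall n, norm1 (t n) <= M /\ norm1 (a n) <= M.
Proof.
have [B hB] := D_bounded.
exists (norm1 rt + (mass + Va) + (mass + B)) => n.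
have h1 : norm1 (a n) <= norm1 rt + (mass + Va) by exact: norm1_le_radius.
have h2 : norm1 (fun k => t n k - a n k) <= mass + B.
  by apply: (le_trans (norm1_le_energy (fta n))); rewrite lerD2l; exact: hB.
split; last by apply: (le_trans h1); rewrite lerDl (le_trans _ h2)// norm1_ge0.
rewrite {1}(_ : t n = fun k => a n k + (t n k - a n k)); last first.
  by apply/funext => k; rewrite addrC subrK.
apply: (le_trans (norm1D (sa n) (summableB (st n) (sa n)))).
exact: lerD.
Qed.

Let norm1B (s r : J -> R) : summable_fam s -> summable_fam r ->
  norm1 (fun k => s k - r k) <= norm1 s + norm1 r.
Proof.
move=> ss sr; have -> : norm1 r = norm1 (fun k => (-1) * r k).
  by apply: eq_isum => k; rewrite mulN1r normrN.
rewrite (_ : (fun k => _) = fun k => s k + (-1) * r k); last first.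
  by apply/funext => k; rewrite mulN1r.
by apply: norm1D => //; exact: summableZ.
Qed.

Let slowC (M : R) : 0 <= M -> 0 < 16 * M * mass + 1.
Proof. by move=> M0; rewrite ltr_wpDl// !mulr_ge0 ?mass_ge0. Qed.

(** Second pass of the Gronwall argument, now with a uniform modulus: it sums the gap against
    [gm n * kap (zs n)], and [kap_cauchy] says that on late windows this mass is close to [kbar]
    times the g-length. *)
Lemma gap_path_cvg0 : (fun n => gap (t n) (a n)) @ \oo --> 0.
Proof.
have [M hM] := radii.
have M0 : 0 <= M by apply: le_trans (hM 0%N).1; exact: norm1_ge0.
have m0 := modulus_gt0 eps_gt0 M.
have [|_ hb] := almost_nonincreasing (b := fun n => 8 * gm n * (modulus M * kap (zs n) * gap (t n) (a n))) D0 (fun n => bn0 n M) GL sumL.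
  by move=> n; apply: step; [exact: (hM n).1|exact: (hM n).2].
set B := (X in forall n, _ <= X) in hb.
(* The constant 16 is 4 from [gap_slow], 2 from the radius of the difference and 2 from the
   difference of two gradients; the added 1 ensures positivity. *)
apply: (@slow_variation_cvg0 _ gm _ (fun n => gm n * kap (zs n)) kbar (16 * M * mass + 1)
   (B / (8 * modulus M))).
- exact: kbar_gt0.
- exact: slowC.
- exact: gm0.
- exact: gmdiv.
- exact: gap0.
- move=> n.
  have nM : norm1 (fun k => t n k - a n k) <= 2 * M.
    by apply: (le_trans (norm1B (st n) (sa n))); rewrite mulr2n mulrDl mul1r lerD ?(hM n).1 ?(hM n).2.
  have nM' : norm1 (fun k => t n.+1 k - a n.+1 k) <= 2 * M.
    by apply: (le_trans (norm1B (st n.+1) (sa n.+1))); rewrite mulr2n mulrDl mul1r lerD ?(hM n.+1).1 ?(hM n.+1).2.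
  apply: (@le_trans _ _ (4 * (2 * M) * (gm n * (2 * mass)))).
    apply: gap_slow => //.
    rewrite (_ : norm1 _ = norm1 (fun k => gm n * (w k * (grad (t n) (zs n) k - grad (a n) (zs n) k)))).
      apply: norm1_wq => // k; rewrite (le_trans (ler_normB _ _))//.
      rewrite mulr2n lerD//; exact: grad_le.
    apply: eq_isum => k; rewrite t_rec a_rec /sgd_step -normrN; congr (`|_|).
    by move: (grad _ _ _) (grad _ _ _) => p q; ring.
  have -> : 4 * (2 * M) * (gm n * (2 * mass)) = 16 * M * mass * gm n by ring.
  by rewrite ler_wpM2r// lerDl.
- by move=> n; rewrite mulr_ge0// ltW// kap_gt0.
- move=> n; rewrite ler_pdivlMr; last by rewrite mulr_gt0.
  apply: le_trans _ (hb n).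
  rewrite mulr_suml; apply: ler_sum => k _; rewrite le_eqVlt; apply/orP; left; apply/eqP; ring.
- move=> d d0; have [m hm] := kap_cauchy d0; exists m => n n' nn'.
  apply: le_trans _ (hm n n' nn'); rewrite le_eqVlt; apply/orP; left; apply/eqP.
  by congr (`|_|); apply: eq_bigr => k _; ring.
Qed.

(** Here the summation weight is [gm] itself, the mean over the next sample having been taken in
    [a_gap]; the Cauchy condition is therefore trivial, with constant 1. *)
Lemma gap_ref_cvg0 : (fun n => gap (a n) rt) @ \oo --> 0.
Proof.
have [M hM] := radii.
have M0 : 0 <= M by apply: le_trans (hM 0%N).1; exact: norm1_ge0.
have Mr : 0 <= M + norm1 rt by rewrite addr_ge0// norm1_ge0.
apply: (@slow_variation_cvg0 _ gm _ gm 1 (16 * (M + norm1 rt) * mass + 1) Ba).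
- exact: ltr01.
- exact: slowC.
- exact: gm0.
- exact: gmdiv.
- by move=> n; apply: gap_ge0.
- move=> n.
  have nM j : norm1 (fun k => a j k - rt k) <= M + norm1 rt.
    by apply: (le_trans (norm1B (sa j) srt)); rewrite lerD2r (hM j).2.
  apply: (@le_trans _ _ (4 * (M + norm1 rt) * (gm n * (1 * mass)))).
    apply: gap_slow => //.
    rewrite (_ : norm1 _ = norm1 (fun k => gm n * (w k * grad (a n) (zs n) k))).
      by apply: norm1_wq => // k; exact: grad_le.
    apply: eq_isum => k; rewrite a_rec /sgd_step -normrN; congr (`|_|).
    by move: (grad _ _ _) => p; ring.
  rewrite mul1r mulrA -[leLHS]mulrA [gm n * mass]mulrC mulrA ler_wpM2r//.
  by rewrite ler_wpDr// ler_wpM2r ?mass_ge0// ler_wpM2r// ler_nat.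
- exact: gm0.
- exact: a_gap.
- move=> d d0; exists 0%N => n n' _; rewrite big1 ?normr0 ?ltW// => k _.
  by rewrite mul1r subrr.
Qed.

Lemma gap_cvg0 : (fun n => gap (t n) rt) @ \oo --> 0.
Proof.
apply: (@squeeze_cvgr _ _ _ _ (fun _ => 0) (fun n => 2 * gap (t n) (a n) + 2 * gap (a n) rt)).
- apply: nearW => n; have -> /= : 0 <= gap (t n) rt by apply: gap_ge0.
  rewrite /trig_gap.
  have -> : (fun x => trig (t n) x - trig rt x) = fun x =>
     (trig (t n) x - trig (a n) x) + (trig (a n) x - trig rt x).
    by apply/funext => x; rewrite addrA subrK.
  have bd a' b' : summable_fam a' -> summable_fam b' -> bmf (fun x => trig a' x - trig b' x).
    by move=> sa' sb; apply: bmfB; apply: bmf_trig.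
  by apply: varD_le; apply: bd.
- exact: cvg_cst.
- rewrite -[X in _ --> X](addr0 0) -{1}(mulr0 2) -{2}(mulr0 2).
  by apply: cvgD; apply: cvgM; rewrite ?mulr0; [exact: cvg_cst|exact: gap_path_cvg0|exact: cvg_cst|exact: gap_ref_cvg0].
Qed.

End path.

(** * The reference trajectory as a random process *)

Section random_path.
Context {dO : measure_display} {Omega : measurableType dO}
  (P : probability Omega R) (Z : nat -> {RV P >-> T}).
Hypothesis Z_law : forall n, has_law (Z n) nu.
Hypothesis Z_indep : mutually_independent Z.
Context (Hm : (J -> R) -> Prop).
Hypothesis Hm_rt : Hm rt.
Hypothesis Hm_comb : forall (a b : R) (s t : J -> R), Hm s -> Hm t ->
  Hm (fun k => a * s k + b * t k).
Hypothesis Hm_grad : forall t y, Hm (fun k => w k * grad t y k).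
Hypothesis rt_optimal : forall t : J -> R, Hm t -> summable_fam t ->
  0 <= \int[nu]_y (fr t y - fr rt y).

(** [rt] is optimal only within [Hm], later the hermitian families, so the reference iterates and
    their midpoints with [rt] have to stay there. *)
Lemma Hm_traj x : Hm (traj x).
Proof.
elim: x => [//|y x IH] /=.
have := Hm_comb 1 (- gm (size x)) IH (Hm_grad (traj x) y).
rewrite (_ : (fun k => _) = sgd (traj x) y (gm (size x)))//.
by apply/funext => k; rewrite /sgd_step mul1r mulNr.
Qed.

(** The second term is a reserve that pays for the error [gm n ^+ 2 * mass] of each descent step. *)
Definition lyap n (x : n.-tuple T) : R :=
  energy (fun k => traj x k - rt k) + mass * (G0 - \sum_(0 <= k < n) gm k ^+ 2).

(** The modulus is taken at the radius of the current iterate, since no uniform bound is available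
    in advance; on a bounded path it is bounded below afterwards. *)
Definition drift n (x : n.-tuple T) : R :=
  4 * gm n * (modulus (radius (energy (fun k => traj x k - rt k))) *
  gap (traj x) rt * kbar).

Lemma lyap_ge0 n x : 0 <= @lyap n x.
Proof.
apply: addr_ge0; first exact: energy_ge0.
by rewrite mulr_ge0 ?mass_ge0// subr_ge0.
Qed.

Lemma drift_ge0 n x : 0 <= @drift n x.
Proof.
apply: mulr_ge0; first by rewrite mulr_ge0.
apply: mulr_ge0; last exact: ltW kbar_gt0.
apply: mulr_ge0; first exact/ltW/modulus_gt0.
by apply: gap_ge0 => //; exact: summable_traj.
Qed.

Lemma measurable_energy_traj n :
  measurable_fun setT (fun x : n.-tuple T => energy (fun k => traj x k - rt k)).
Proof.
by apply: (measurable_energy_param (t := fun x : n.-tuple T => traj x)) => k; exact: measurable_traj.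
Qed.

Lemma measurable_lyap n : measurable_fun setT (@lyap n).
Proof.
by apply: measurable_funD; [exact: measurable_energy_traj|exact: measurable_cst].
Qed.

Lemma measurable_drift n : measurable_fun setT (@drift n).
Proof.
apply: measurable_funM; first exact: measurable_cst.
apply: measurable_funM; last exact: measurable_cst.
apply: measurable_funM.
  apply: measurable_funM; first exact: measurable_cst.
  apply: measurableT_comp => //; apply: measurable_funM; last exact: measurable_cst.
  apply: measurable_funN; apply: measurable_funM; first exact: measurable_cst.
  apply: measurable_funD; first exact: measurable_cst.
  by apply: measurable_funD; [exact: measurable_cst|exact: measurable_energy_traj].
apply: (measurable_gap_param (t := fun x : n.-tuple T => traj x)) => //.
by move=> k; exact: measurable_traj.
Qed.

(* The gain [drift] comes from the strong midpoint convexity of [fr] between the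
   iterate and [rt], the optimality of [rt] being used at the midpoint. *)
Lemma lyap_supermartingale n (x : n.-tuple T) :
  (\int[nu]_y (@lyap n.+1 [tuple of y :: x])%:E + (drift x)%:E <= (lyap x)%:E)%E.
Proof.
set a := traj x; set V := energy (fun k => a k - rt k).
have sa : summable_fam a by exact: summable_traj.
have V0 : 0 <= V by exact: energy_ge0.
pose m k := 2^-1 * (a k + rt k).
have sm : summable_fam m by apply: summableZ; exact: summableD.
have Hmm : Hm m.
  rewrite (_ : m = fun k => 2^-1 * a k + 2^-1 * rt k).
    by apply: Hm_comb => //; exact: Hm_traj.
  by apply/funext => k; rewrite /m mulrDr.
set C := modulus (radius V) * gap a rt.
(* Strong midpoint convexity gives [2 * (fr a y - fr rt y) >= 4 * C * kap y + 4 * (fr m y - fr rt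
   y)]. Unlike [fr] itself, the last difference is bounded in [y], and its mean is nonnegative by
   optimality. *)
pose U y := (lyap x - (4 * gm n * C) * kap y) - 4 * gm n * (fr m y - fr rt y).
have bfr : bmf (fun y => fr m y - fr rt y).
  apply: (@bmf_bound _ _ _ _ (norm1 (fun k => m k - rt k))) => [|y].
    by apply: measurable_funB; apply: measurable_fr_param.
  exact: fr_lipschitz.
have bU : bmf U.
  apply: bmfB; last exact: bmfZ.
  apply: bmfB; first exact: bmf_cst.
  by apply: bmfZ; exact: bmf_kap.
have lyapU y : @lyap n.+1 [tuple of y :: x] <= U y.
  have h1 : energy (fun k => sgd a y (gm n) k - rt k) <=
      V - 2 * gm n * (fr a y - fr rt y) + gm n ^+ 2 * mass.
    by apply: energy_descent => //; exact: fin_energy_traj.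
  have h2 : modulus (radius V) * kap y * gap a rt <=
      2^-1 * fr a y + 2^-1 * fr rt y - fr m y.
    apply: fr_midpoint => //.
      by apply: norm1_le_radius => //; exact: fin_energy_traj.
    exact: norm1_rt_le_radius.
  rewrite /lyap /U /= size_tuple -/a big_nat_recr//= /lyap -/a -/V.
  move: h1 h2; rewrite -/m -/V.
  set W := energy _; set fa := fr a y; set fm := fr m y; set f0 := fr rt y.
  move=> h1; rewrite (_ : modulus _ * kap y * gap a rt = C * kap y) => [h2|]; last first.
    by rewrite /C mulrAC.
  have h3 : gm n * (4 * (C * kap y)) <= gm n * (2 * fa + 2 * f0 - 4 * fm).
    by rewrite ler_wpM2l//; exact: midpoint_arith.
  move: h1 h3; set s := \sum_(0 <= k < n) _ => h1 h3.
  by apply: lyap_arith h1 h3.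
have IU : \int[nu]_y U y = lyap x - 4 * gm n * C * kbar -
    4 * gm n * \int[nu]_y (fr m y - fr rt y).
  have bk := bmf_kap.
  transitivity (\int[nu]_y (lyap x - 4 * gm n * C * kap y) -
      \int[nu]_y (4 * gm n * (fr m y - fr rt y))).
    apply: meanB; last exact: bmfZ.
    by apply: bmfB; [exact: bmf_cst|exact: bmfZ].
  congr (_ - _); last exact: meanZ.
  by rewrite meanB; [rewrite mean_cst meanZ|exact: bmf_cst|exact: bmfZ].
apply: (@le_trans _ _ (\int[nu]_y (U y)%:E + (drift x)%:E)%E).
  rewrite leeD2r//; apply: ge0_le_integral => //.
  - by move=> y _; rewrite lee_fin lyap_ge0.
  - apply/measurable_EFinP; apply: (measurableT_comp (@measurable_lyap n.+1)).
    by apply: measurable_cons => //; exact: measurable_cst.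
  - by apply/measurable_EFinP; case: bU.
  - by move=> y _; rewrite lee_fin.
rewrite (bmf_integralE nu bU) -EFinD lee_fin IU.
have opt : 0 <= 4 * gm n * \int[nu]_y (fr m y - fr rt y).
  by rewrite mulr_ge0 ?mulr_ge0// rt_optimal.
rewrite (_ : drift x = 4 * gm n * C * kbar); last by rewrite /drift /C mulrA.
by rewrite addrAC subrK lerBlDr lerDl.
Qed.

(** The quantifier on [t] stands inside the almost sure event: the exceptional set is the same for
    all starting points, so the start may depend on [om] in any way. *)
Theorem sgd_gap_cvg0 : {ae P, forall om, forall t : nat -> J -> R,
  fin_energy (fun k => t 0%N k - rt k) ->
  (forall n, t n.+1 = sgd (t n) (Z n om) (gm n)) ->
  (fun n => gap (t n) rt) @ \oo --> 0}.
Proof.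
have ae1 := supermartingale_bounded Z_law Z_indep measurable_lyap lyap_ge0.
have {}ae1 := ae1 (fun n x => le_trans (leeDl _ (_ : (0 <= (drift x)%:E)%E)) (lyap_supermartingale x)).
have ae2 := drift_summable Z_law Z_indep measurable_lyap measurable_drift lyap_ge0
  drift_ge0 lyap_supermartingale.
have bz : bmf (fun y => kap y - kbar) by apply: bmfB; [exact: bmf_kap|exact: bmf_cst].
have ae3 := @weighted_sum_cauchy _ _ _ nu _ _ P Z Z_law Z_indep (fun y => kap y - kbar) gm G0 bz.1.
have kbar1 : kbar <= 1.
  rewrite -[leRHS](mean_cst nu); apply: le_mean; [exact: bmf_kap|exact: bmf_cst|exact: kap_le1].
have z1 y : `|kap y - kbar| <= 1.
  have := kap_le1 y; have := kap_gt0 y; have := kbar_gt0; move: kbar1.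
  by rewrite ler_norml; move: (kap y) kbar => p q ? ? ? ?; apply/andP; split; lra.
have z0 : \int[nu]_y (kap y - kbar) = 0.
  by rewrite meanB ?mean_cst ?subrr//; [exact: bmf_kap|exact: bmf_cst].
have {}ae3 := ae3 z1 z0 gm2.
have drift0 n (x : n.-tuple T) : (0 <= (drift x)%:E)%E by rewrite lee_fin drift_ge0.
near=> om.
move=> t ft0 t_rec.
have [B1 hB1] : exists B, forall n, lyap (hist Z n om) <= B by near: om; exact: ae1.
have [B2 hB2] : exists B, forall n, \sum_(0 <= k < n) drift (hist Z k om) <= B by near: om; exact: ae2.
have hc : forall d : R, 0 < d -> exists m, forall n n', (m <= n <= n')%N ->
  `|\sum_(n <= k < n') gm k * (kap (Z k om) - kbar)| <= d by near: om; exact: ae3.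
pose a n := traj (hist Z n om).
have EB1 n : energy (fun k => a n k - rt k) <= B1.
  by apply: le_trans (hB1 n); rewrite /lyap lerDl mulr_ge0 ?mass_ge0// subr_ge0.
have m0 : 0 < 4 * modulus (radius B1) * kbar.
  by rewrite mulr_gt0 ?kbar_gt0// mulr_gt0// modulus_gt0.
apply: (@gap_cvg0 (fun n => Z n om) a t _ t_rec _ ft0 B1 (B2 / (4 * modulus (radius B1) * kbar))).
- by move=> n; rewrite /a /= size_tuple.
- by move=> n; exact: fin_energy_traj.
- exact: EB1.
- move=> n; rewrite ler_pdivlMr//; apply: le_trans _ (hB2 n).
  rewrite mulr_suml; apply: ler_sum => k _; rewrite /drift -/(a k).
  have g0 : 0 <= gap (a k) rt by apply: gap_ge0 => //; exact: summable_traj.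
  have ml : modulus (radius B1) <= modulus (radius (energy (fun j => a k j - rt j))).
    by apply: modulus_le => //; rewrite !lerD2l.
  have kb := ltW kbar_gt0.
  rewrite (_ : gm k * gap (a k) rt * (4 * modulus (radius B1) * kbar) =
    4 * gm k * (modulus (radius B1) * gap (a k) rt * kbar)); last by ring.
  by rewrite ler_wpM2l ?mulr_ge0// ler_wpM2r// ler_wpM2r.
- exact: hc.
Unshelve. all: by end_near.
Qed.

End random_path.

End stochastic_approximation.

(** * Fourier modes on the cube *)

Section product_expectations.
Context {R : realType} {d1 d2 : measure_display} {T1 : measurableType d1}
  {T2 : measurableType d2} (m1 : probability T1 R) (m2 : probability T2 R).
Context (f : T1 * T2 -> R).
Hypothesis bf : bmf f.

Let intf : (m1 \x m2)%E.-integrable setT (EFin \o f).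
Proof. exact: (bmf_integrable (m1 \x m2)%E bf). Qed.

Let bf1 x : bmf (fun y => f (x, y)).
Proof.
have [mf [M fM]] := bf; split; last by exists M.
exact: (measurableT_comp mf (@measurable_pair1 _ _ _ _ x)).
Qed.

Let bf2 y : bmf (fun x => f (x, y)).
Proof.
have [mf [M fM]] := bf; split; last by exists M.
exact: (measurableT_comp mf (@measurable_pair2 _ _ _ _ y)).
Qed.

Lemma mean_prod1 : \int[(m1 \x m2)%E]_z f z = \int[m1]_x \int[m2]_y f (x, y).
Proof.
rewrite /Rintegral; congr fine; rewrite -(integral12_prod_meas1 intf).
apply: eq_integral => x _; rewrite -(bmf_integralE m2 (bf1 x)).
by [].
Qed.

Lemma mean_prod2 : \int[(m1 \x m2)%E]_z f z = \int[m2]_y \int[m1]_x f (x, y).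
Proof.
rewrite /Rintegral; congr fine; rewrite -(integral21_prod_meas1 intf).
apply: eq_integral => y _; rewrite -(bmf_integralE m1 (bf2 y)).
by [].
Qed.

End product_expectations.

Section fourier_modes.
Context {R : realType}.
Local Notation U := (uniform_prob (@ltr01 R)).

Lemma sin_shift_int (m : int) (x : R) : sin (2 * pi * m%:~R + x) = sin x.
Proof.
have shiftn (n : nat) (y : R) : sin (2 * pi * n%:R + y) = sin y.
  elim: n y => [|n IH] y; first by rewrite mulr0 add0r.
  have -> : 2 * pi * n.+1%:R + y = (2 * pi * n%:R + y) + pi *+ 2.
    by rewrite -natr1 -mulr_natl; ring.
  by rewrite sinD2pi IH.
case: m => n; first exact: shiftn.
have := shiftn n.+1 (2 * pi * (Negz n)%:~R + x) => <-; congr sin.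
by rewrite NegzE mulrNz; ring.
Qed.

Lemma int_cos_uniform (m : int) (psi : R) : m != 0 ->
  \int[U]_a cos (2 * pi * (m%:~R * a) + psi) = 0.
Proof.
move=> m0; pose b : R := 2 * pi * m%:~R.
have b0 : b != 0 by rewrite !mulf_neq0 ?intr_eq0// gt_eqF// pi_gt0.
(* Adding 1 makes the integrand nonnegative for the passage to the Lebesgue integral. By periodicity
   the primitive [G] grows by exactly 1 on the unit interval. *)
pose g a := 1 + cos (b * a + psi).
pose G a := a + b^-1 * sin (b * a + psi).
have daff (a : R) : is_derive a (1 : R) (fun a : R => b * a + psi) b.
  have -> : (fun a : R => b * a + psi) = b *: id + cst psi by [].
  by apply: is_derive_eq; rewrite addr0 [LHS]mulr1.
have dG (a : R) : is_derive a (1 : R) (G : R -> R) (g a).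
  have dsin : is_derive a (1 : R) (sin \o (fun a : R => b * a + psi))
      (cos (b * a + psi) * b).
    by apply: (is_derive1_comp (f := sin) (g := fun a : R => b * a + psi)).
  have -> : G = id + b^-1 *: (sin \o (fun a : R => b * a + psi)) by [].
  have -> : g a = 1 + b^-1 *: (cos (b * a + psi) * b).
    by rewrite /g; congr (_ + _); rewrite [RHS]mulrCA mulVf// mulr1.
  exact: (is_deriveD (is_derive_id a 1) (is_deriveZ b^-1 dsin)).
have cG : continuous (G : R -> R).
  by move=> a; apply: differentiable_continuous; apply/derivable1_diffP; case: (dG a).
have cg : continuous (g : R -> R).
  move=> a; rewrite /g; apply: cvgD; first exact: cvg_cst.
  apply: (continuous_comp (f := fun a : R => b * a + psi)); last exact: continuous_cos.
  by apply: differentiable_continuous; apply/derivable1_diffP; case: (daff a).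
have FTC : (\int[lebesgue_measure]_(x in `[0%R, 1%R]) (g x)%:E = (G 1)%:E - (G 0)%:E)%E.
  apply: continuous_FTC2 => //.
  - exact: continuous_subspaceT.
  - split.
    + by move=> x _; case: (dG x).
    + by apply: cvg_at_right_filter; exact: cG.
    + by apply: cvg_at_left_filter; exact: cG.
  - by move=> x _; rewrite derive1E; case: (dG x).
have G10 : G 1 - G 0 = 1.
  rewrite /G mulr1 mulr0 !add0r [sin (b + psi)]sin_shift_int addrK.
  by [].
have mg : measurable_fun [set: measurableTypeR R] g.
  by apply: continuous_measurable_fun.
have g0 x : 0 <= g x by rewrite /g -lerBlDl sub0r cos_geN1.
have Eg : \int[U]_a g a = 1.
  rewrite /Rintegral integral_uniform//.
    by rewrite FTC -EFinB G10 subr0 invr1 mule1.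
  exact/measurable_EFinP.
have bc : bmf (X := measurableTypeR R) (fun a => cos (b * a + psi)).
  apply: (@bmf_bound _ _ _ _ 1) => [|x].
    rewrite (_ : (fun a => _) = fun a => g a - 1); last first.
      by apply/funext => a; rewrite /g addrAC subrr add0r.
    by apply: measurable_funB => //; exact: measurable_cst.
  by rewrite ler_norml cos_geN1 cos_le1.
have : \int[U]_a g a = 1 + \int[U]_a cos (b * a + psi).
  by rewrite meanD ?mean_cst//; exact: bmf_cst.
rewrite Eg => /esym/eqP; rewrite -subr_eq0 addrAC subrr add0r => /eqP h.
rewrite -[RHS]h; apply: eq_Rintegral => a _; congr (cos (_ + _)).
by rewrite /b mulrA.
Qed.

Definition lin_phase d (m : 'I_d -> int) (x : d.-tuple R) : R :=
  2 * pi * \sum_(i < d) (m i)%:~R * tnth x i.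

Lemma measurable_lin_phase d (m : 'I_d -> int) :
  measurable_fun setT (lin_phase m).
Proof.
apply: measurable_funM; first exact: measurable_cst.
apply: measurable_sum => i; apply: measurable_funM; first exact: measurable_cst.
exact: measurable_tnth.
Qed.

Lemma bmf_cos_lin_phase d (m : 'I_d -> int) (psi : R) :
  bmf (fun x => cos (lin_phase m x + psi)).
Proof.
apply: (@bmf_bound _ _ _ _ 1) => [|x]; last by rewrite ler_norml cos_geN1 cos_le1.
apply: measurableT_comp; first by apply: continuous_measurable_fun; exact: continuous_cos.
by apply: measurable_funD; [exact: measurable_lin_phase|exact: measurable_cst].
Qed.

(** The free phase [psi] lets the induction go through: if the first frequency is nonzero, the other
    coordinates are absorbed in the phase; otherwise the first coordinate disappears. *)
Lemma int_cos_cube d (m : 'I_d -> int) (psi : R) : (exists i, m i != 0) ->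
  \int[unif_cube d]_x cos (lin_phase m x + psi) = 0.
Proof.
elim: d m psi => [|d IH] m psi; first by move=> [[]].
move=> m0; have bm := bmf_cos_lin_phase m psi.
pose f (p : measurableTypeR R * d.-tuple R) := cos (lin_phase m (tuple_cons p) + psi).
have bf : bmf f.
  have [mf [M fM]] := bm; split; last by exists M => p; exact: fM.
  exact: (measurableT_comp mf (@measurable_tuple_cons R d)).
have -> : \int[unif_cube d.+1]_x cos (lin_phase m x + psi) =
    \int[(U \x unif_cube d)%E]_p f p.
  rewrite /Rintegral; congr fine.
  rewrite (integral_distribution (P := (U \x unif_cube d)%E) (X := @tuple_cons R d))//.
    by apply/measurable_EFinP; case: bm.
  exact: (bmf_integrable (U \x unif_cube d)%E bf).
pose m' i := m (lift ord0 i).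
have fE a x : f (a, x) = cos (2 * pi * ((m ord0)%:~R * a) + (lin_phase m' x + psi)).
  rewrite /f /lin_phase big_ord_recl mulrDr addrA; congr (cos (_ + _ + _)).
  by congr (_ * _); apply: eq_bigr => i _; rewrite tnthS.
have [m00|m00] := eqVneq (m ord0) 0; last first.
  rewrite (mean_prod2 U (unif_cube d) bf) (_ : (fun y => _) = fun _ => 0) ?mean_cst//.
  apply/funext => x; under eq_Rintegral do rewrite fE.
  exact: int_cos_uniform.
rewrite (mean_prod1 U (unif_cube d) bf) (_ : (fun y => _) = fun _ => 0) ?mean_cst//.
apply/funext => a; under eq_Rintegral do rewrite fE m00 mul0r mulr0 add0r.
apply: IH; case: m0 => i; case: (unliftP ord0 i) => [j ->|->] mi; first by exists j.
by rewrite m00 eqxx in mi.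
Qed.

End fourier_modes.

(** * Correlations of the real modes and Parseval's identity *)

Section parseval.
Context {R : realType} {d : nat}.
Local Notation mu := (@unif_cube R d).
Implicit Types (k : freq d * bool) (x : d.-tuple R).

Lemma int_cos_cube_shift (m : 'I_d -> int) (psi : R) :
  \int[mu]_x cos (lin_phase m x + psi) = [forall i, m i == 0]%:R * cos psi.
Proof.
have [/forallP m0|] := boolP [forall i, m i == 0].
  rewrite mul1r -[RHS](mean_cst mu); apply: eq_Rintegral => x _; congr (cos _).
  rewrite /lin_phase big1 ?mulr0 ?add0r// => i _.
  by rewrite (eqP (m0 i)) mulr0z mul0r.
rewrite negb_forall => /existsP m0; rewrite mul0r; exact: int_cos_cube.
Qed.

(** The sign makes [coord t] the coefficients of the real part of the Fourier sum, as [Re (t * phi)]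
    is [Re t * cos - Im t * sin]; these are also the real and imaginary parts of the conjugate of
    [phi]. *)
Definition mode k x : R := if k.2 then cos (phase k.1 x) else - sin (phase k.1 x).

Definition mode_shift (b : bool) : R := if b then 0 else pi / 2.

Lemma modeE k x : mode k x = cos (lin_phase (fun i => val k.1 0 i) x + mode_shift k.2).
Proof.
by rewrite /mode /mode_shift; case: k.2; rewrite ?addr0 ?cosDpihalf.
Qed.

Lemma bmf_mode k : bmf (mode k).
Proof. by rewrite (funext (modeE k)); exact: bmf_cos_lin_phase. Qed.

Lemma mode_le1 k x : `|mode k x| <= 1.
Proof. by rewrite modeE ler_norml cos_geN1 cos_le1. Qed.

Lemma mean_mode k : \int[mu]_x mode k x = 0.
Proof.
rewrite (funext (modeE k)); apply: int_cos_cube.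
have [/eqfunP k0|] := boolP [forall i, val k.1 0 i == 0]; last first.
  by rewrite negb_forall => /existsP.
case: k k0 => -[l l0] b /= k0; exfalso; move/negP: l0; apply; apply/eqP/rowP => i.
by rewrite mxE; exact: k0.
Qed.

Definition mode_opp k : freq d * bool := (freq_opp k.1, k.2).
Definition mode_sign k : R := (-1) ^+ ~~ k.2.

(** The modes are not independent: opposite frequencies give the same function up to [mode_sign]. In
    the product-to-sum formula the frequency difference detects [k], the frequency sum detects
    [mode_opp k]. *)
Lemma mean_mode_mul k k' : \int[mu]_x (mode k x * mode k' x) =
  2^-1 * ((k' == k)%:R + mode_sign k * (k' == mode_opp k)%:R).
Proof.
pose p := mode_shift k.2; pose q := mode_shift k'.2.
pose m i := val k.1 0 i - val k'.1 0 i; pose n i := val k.1 0 i + val k'.1 0 i.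
have prodE x : mode k x * mode k' x =
    2^-1 * (cos (lin_phase m x + (p - q)) + cos (lin_phase n x + (p + q))).
  have -> : lin_phase m x = lin_phase (fun i => val k.1 0 i) x -
      lin_phase (fun i => val k'.1 0 i) x.
    rewrite /lin_phase -mulrBr -sumrB; congr (_ * _); apply: eq_bigr => i _.
    by rewrite /m rmorphB mulrBl.
  have -> : lin_phase n x = lin_phase (fun i => val k.1 0 i) x +
      lin_phase (fun i => val k'.1 0 i) x.
    rewrite /lin_phase -mulrDr -big_split; congr (_ * _); apply: eq_bigr => i _.
    by rewrite /n rmorphD mulrDl.
  rewrite !modeE -/p -/q; set a := lin_phase _ x; set b := lin_phase _ x.
  have -> : a - b + (p - q) = (a + p) - (b + q) by ring.
  have -> : a + b + (p + q) = (a + p) + (b + q) by ring.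
  by move: (a + p) (b + q) => u v; rewrite cosB cosD; field.
under eq_Rintegral do rewrite prodE.
rewrite meanZ ?meanD ?int_cos_cube_shift; first 1 last.
- exact: bmf_cos_lin_phase.
- exact: bmf_cos_lin_phase.
- by apply: bmfD; exact: bmf_cos_lin_phase.
congr (_ * (_ + _)).
- have -> : [forall i, m i == 0] = (k'.1 == k.1).
    apply/forallP/idP => [m0|/eqP kk' i]; last by rewrite /m kk' subrr.
    by apply/eqP/val_inj/rowP => i; apply/esym/eqP; rewrite -subr_eq0; exact: m0.
  rewrite /p /q; case: k {p q prodE m n} => l b; case: k' => l' b' /=.
  rewrite xpair_eqE /mode_shift; case: b; case: b' => /=;
    rewrite ?andbT ?andbF ?subrr ?cos0 ?mulr1// ?subr0 ?sub0r ?cosN cos_pihalf mulr0//.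
- have -> : [forall i, n i == 0] = (k'.1 == freq_opp k.1).
    apply/forallP/idP => [n0|/eqP kk' i]; last by rewrite /n kk' /= mxE subrr.
    apply/eqP/val_inj/rowP => i; rewrite /= mxE; apply/eqP; rewrite -addr_eq0 addrC.
    exact: n0.
  rewrite /p /q; case: k {p q prodE m n} => l b; case: k' => l' b' /=.
  rewrite /mode_opp /mode_sign xpair_eqE /mode_shift; case: b; case: b' => /=;
    rewrite ?andbT ?andbF ?addr0 ?add0r ?cos0 ?cos_pihalf ?mulr0 ?mulr1 ?expr0 ?mul1r//.
  by rewrite expr1 -splitr cospi mulrC.
Qed.

Context {k0 : freq d * bool}.
Local Notation J := (discr k0).
Local Notation md := (mode : J -> _ -> R).

Lemma isum_unit k : summable_fam (fun j : J => (j == k :> freq d * bool)%:R : R) /\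
  isum (fun j : J => (j == k :> freq d * bool)%:R : R) = 1.
Proof.
have E : \esum_(j in [set: J]) (((j == k :> freq d * bool)%:R : R)%:E) = 1%E.
  rewrite -[RHS](@esum_set1 R _ (k : J) (fun=> 1%E))// [RHS]esum_mkcond.
  apply: eq_esum => j _; have [->|jk] := eqVneq (j : freq d * bool) k; first by rewrite mem_set.
  by rewrite memNset// => /= jk'; rewrite jk' eqxx in jk.
split; last by rewrite /isum /Rintegral integral_dcount ?E// => j; rewrite lee_fin.
apply/summable_famP; rewrite (eq_esum (b := fun j => ((j == k :> freq d * bool)%:R : R)%:E)) ?E ?ltry//.
by move=> j _; rewrite ger0_norm.
Qed.

Lemma isum_pick (a : R) k :
  summable_fam (fun j : J => a * (j == k :> freq d * bool)%:R) /\
  isum (fun j : J => a * (j == k :> freq d * bool)%:R) = a.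
Proof.
have [s1 i1] := isum_unit k; split; first exact: summableZ.
by rewrite isumZ// i1 mulr1.
Qed.

(* Coordinates of a family [t] such that [t (-l)] is the conjugate of [t l]. *)
Definition herm_coord (t : J -> R) := forall k : J, t (mode_opp k) = mode_sign k * t k.

Lemma mode_signK k : mode_sign k * mode_sign k = 1.
Proof. by rewrite -signr_addb addbb. Qed.

Let mm (k : J) : measurable_fun setT (md k).
Proof. by case: (bmf_mode k). Qed.

Let mode1 (k : J) x : `|md k x| <= 1.
Proof. exact: mode_le1. Qed.

(** The indices [k] and [mode_opp k] contribute one half of [t k] each, by hermitian symmetry. *)
Lemma fourier_coef (t : J -> R) (k : J) : summable_fam t -> herm_coord t ->
  \int[mu]_x (trig md t x * mode k x) = t k.
Proof.
have arith (u x y a : R) :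
  u * (2^-1 * (x + a * y)) = 2^-1 * (u * x) + 2^-1 * a * (u * y) by ring.
have arith2 (u a : R) : a * a = 1 -> 2^-1 * u + 2^-1 * a * (a * u) = u.
  by move=> a1; rewrite -[2^-1 * a * _]mulrA [a * (a * u)]mulrA a1 mul1r; field.
move=> st ht; have := pairing mu mm mode1 (bmf_mode k) st.
under eq_Rintegral do rewrite mulrC.
move=> ->; have [s1 i1] := isum_pick (2^-1 * t k) k.
have [s2 i2] := isum_pick (2^-1 * mode_sign k * t (mode_opp k)) (mode_opp k).
transitivity (isum (fun j : J => 2^-1 * t k * (j == k :> freq d * bool)%:R +
    2^-1 * mode_sign k * t (mode_opp k) * (j == mode_opp k :> freq d * bool)%:R)).
  apply: eq_isum => j; rewrite mean_mode_mul.
  have pickE a : t j * (j == a :> freq d * bool)%:R = t a * (j == a :> freq d * bool)%:R.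
    by have [->|ja] := eqVneq (j : freq d * bool) a; rewrite ?mulr0.
  apply: etrans (arith _ _ _ _) _.
  by congr (_ + _); rewrite -[RHS]mulrA; congr (_ * _); exact: pickE.
apply: etrans (isumD s1 s2) _; apply: etrans (f_equal2 +%R i1 i2) _.
by rewrite (ht k); apply: arith2; exact: mode_signK.
Qed.

Lemma parseval (t : J -> R) : summable_fam t -> herm_coord t ->
  \int[mu]_x (trig md t x) ^+ 2 = isum (fun k : J => t k ^+ 2).
Proof.
move=> st ht; have bt := bmf_trig mm mode1 st.
under eq_Rintegral do rewrite expr2.
rewrite (pairing mu mm mode1 bt st); apply: eq_isum => k.
by rewrite fourier_coef// expr2.
Qed.

Lemma mean_trig (t : J -> R) : summable_fam t -> \int[mu]_x trig md t x = 0.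
Proof.
move=> st; have := pairing mu mm mode1 (bmf_cst (1 : R)) st.
under eq_Rintegral do rewrite mul1r.
move=> ->; rewrite -[RHS](mul0r (isum t)) -isumZ//.
apply: eq_isum => k; rewrite mul0r.
by under eq_Rintegral do rewrite mul1r; rewrite mean_mode mulr0.
Qed.

(** Without frequency 0 every potential has mean zero, so the variance is the full second moment. *)
Lemma trig_gap_parseval (s t : J -> R) : summable_fam s -> summable_fam t ->
  herm_coord s -> herm_coord t ->
  trig_gap mu md s t = isum (fun k : J => (s k - t k) ^+ 2).
Proof.
move=> ss st hs ht; have sst := summableB ss st.
rewrite -parseval//; last by move=> k; rewrite hs ht mulrBr.
have stE : (fun x => trig md s x - trig md t x) = trig md (fun k => s k - t k).
  by apply/funext => x; rewrite (trigB mode1).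
by rewrite /trig_gap stE /var mean_trig// expr0n subr0.
Qed.

End parseval.

(** * The complex Fourier parametrization *)

Section cube_integrals.
Context {R : realType} {d : nat}.
Local Notation mu := (@unif_cube R d).
Local Notation X := (d.-tuple R).

Let unit_itv : [set a : R | 0 <= a <= 1] = `[0, 1]%classic.
Proof. by rewrite set_itvcc. Qed.

Lemma measurable_cube : measurable (@cube R d).
Proof.
apply: (measurable_box (A := fun=> [set a : R | 0 <= a <= 1])) => i.
rewrite unit_itv; exact: measurable_itv.
Qed.

Lemma uniform_prob_unit : uniform_prob (@ltr01 R) `[0, 1]%classic = 1%E.
Proof.
apply: etrans (probability_setT (uniform_prob (@ltr01 R))).
rewrite -[RHS]/(\int[lebesgue_measure]_(x in setT) (uniform_pdf 0 1 x)%:E)%E.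
by rewrite [RHS]integral_uniform_pdf setTI.
Qed.

Lemma unif_cube_cube : mu (cube d) = 1%E.
Proof.
rewrite (@unif_cube_box R d (fun=> [set a : R | 0 <= a <= 1])) => [|i].
  by apply: big1 => i _; rewrite unit_itv uniform_prob_unit.
rewrite unit_itv; exact: measurable_itv.
Qed.

Lemma int_cube (f : X -> R) : bmf f ->
  (\int[mu]_(x in cube d) (f x)%:E = (\int[mu]_x f x)%R%:E)%E.
Proof.
move=> bf; rewrite -(bmf_integralE mu bf).
rewrite [RHS](negligible_integral (N := ~` cube d)).
- by rewrite setTD setCK.
- by apply: measurableC; exact: measurable_cube.
- exact: measurableT.
- exact: bmf_integrable.
- apply: etrans (probability_setC mu measurable_cube) _.
  by apply: etrans (f_equal (fun z => 1 - z)%E unif_cube_cube) _; rewrite subee.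
Qed.

Lemma mean_cube (f g : X -> R) : bmf g -> (forall x, cube d x -> f x = g x) ->
  \int[mu]_(x in cube d) f x = \int[mu]_x g x.
Proof.
move=> bg fg; transitivity (\int[mu]_(x in cube d) g x).
  by apply: eq_Rintegral => x; rewrite inE; exact: fg.
by rewrite {1}/Rintegral int_cube.
Qed.

(** The cost cut off outside the cube, where [unif_cube] has no mass, so that it is bounded in [x]
    over the whole space of tuples. *)
Definition cube_cost (x y : X) : R := \1_(cube d) x * cost x y.

Definition cost_bound (y : X) : R := d%:R + \sum_(i < d) tnth y i ^+ 2.

Lemma cube_cost_le x y : `|cube_cost x y| <= cost_bound y.
Proof.
have y0 : 0 <= \sum_(i < d) tnth y i ^+ 2 by apply: sumr_ge0 => i _; exact: sqr_ge0.
have [xc|xc] := pselect (cube d x); last first.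
  by rewrite /cube_cost indicE memNset// mul0r normr0 addr_ge0.
rewrite /cube_cost indicE mem_set// mul1r /cost normrM gtr0_norm ?invr_gt0//.
rewrite ger0_norm; last by apply: sumr_ge0 => i _; exact: sqr_ge0.
have dE : d%:R = \sum_(i < d) 1 :> R by rewrite sumr_const card_ord.
rewrite /cost_bound dE -big_split/= mulr_sumr; apply: ler_sum => i _; have := xc i.
move: (tnth x i) (tnth y i) => a b /andP[a0 a1].
have a2 : a ^+ 2 <= 1 by rewrite expr_le1.
have := sqr_ge0 (a + b); rewrite sqrrD sqrrB; lra.
Qed.

Lemma measurable_cube_cost :
  measurable_fun setT (fun p : X * X => cube_cost p.1 p.2).
Proof.
apply: measurable_funM.
  apply: (measurableT_comp (f := \1_(cube d) : X -> R)); last exact: measurable_fst.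
  apply: measurable_indic; exact: measurable_cube.
apply: measurable_funM; first exact: measurable_cst.
apply: measurable_sum => i; apply: measurable_funX; apply: measurable_funB.
  apply: (measurableT_comp (f := fun x : X => tnth x i)); last exact: measurable_fst.
  exact: measurable_tnth.
apply: (measurableT_comp (f := fun x : X => tnth x i)); last exact: measurable_snd.
exact: measurable_tnth.
Qed.

Lemma measurable_cost_bound : measurable_fun setT cost_bound.
Proof.
apply: measurable_funD; first exact: measurable_cst.
by apply: measurable_sum => i; apply: measurable_funX; exact: measurable_tnth.
Qed.

End cube_integrals.

(** No integrability is assumed, because [fine] sends infinite values to 0; [herm_grad] needs this,
    being stated for arbitrary families. *)
Lemma RintegralN d (T : measurableType d) (R : realType)
    (m : {measure set T -> \bar R}) (f : T -> R) :
  \int[m]_x (- f x) = - \int[m]_x f x.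
Proof.
rewrite /Rintegral integralE [in RHS]integralE.
under eq_integral do rewrite -[X in funepos X]/(\- (EFin \o f))%E funeposN.
under [X in (_ - X)%E]eq_integral do rewrite -[X in funeneg X]/(\- (EFin \o f))%E funenegN.
have := @integral_ge0 _ _ _ m setT _ (fun x _ => funepos_ge0 (EFin \o f) x).
have := @integral_ge0 _ _ _ m setT _ (fun x _ => funeneg_ge0 (EFin \o f) x).
move: (integral _ _ _) (integral _ _ _) => [a| |] [b| |] //= _ _.
- by rewrite opprB.
- by rewrite oppr0.
- by rewrite oppr0.
- by rewrite oppr0.
Qed.

(** * Sums over pairs of a frequency and a real or imaginary part *)

Section sums_over_pairs.
Context {R : realType} {I : countType} {i0 : I} {k0 : I * bool}.
Local Notation L := (discr i0).
Local Notation J := (discr k0).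

Lemma esum_pair (f : I * bool -> \bar R) : (forall k, 0 <= f k)%E ->
  (\esum_(k in [set: I * bool]) f k =
   \esum_(i in [set: I]) (f (i, true) + f (i, false)))%E.
Proof.
move=> f0.
rewrite (_ : [set: I * bool] = [set: I] `*`` fun=> [set: bool]); last first.
  by apply/seteqP; split=> -[].
rewrite (eq_esum (b := fun k => f (k.1, k.2))); last by case.
rewrite -(@esum_esum R _ _ setT (fun=> setT) (fun i b => f (i, b)))//.
apply: eq_esum => i _; rewrite esum_fset//.
  rewrite (fsbigTE [fset true; false]%fset) => [|[]]; rewrite ?inE//.
  by rewrite big_fsetU1 ?inE//= big_seq_fset1.
exact: finite_finset.
Qed.

Lemma summable_pair (f : J -> R) : summable_fam f <->
  summable_fam (fun i : L => f (i, true)) /\ summable_fam (fun i : L => f (i, false)).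
Proof.
rewrite !summable_famP esum_pair//; split=> [h|[ht hf]].
  by split; apply: le_lt_trans h; apply: le_esum => i _; rewrite (leeDl, leeDr).
by rewrite esumD//; exact: lte_add_pinfty.
Qed.

Lemma isum_ge0E (K : countType) (j0 : K) (f : discr j0 -> R) :
  (forall k, 0 <= f k) -> isum f = fine (\esum_(k in [set: K]) (f k)%:E)%E.
Proof. by move=> f0; rewrite /isum /Rintegral integral_dcount// => k; rewrite lee_fin. Qed.

Lemma esum_isum (K : countType) (j0 : K) (f : discr j0 -> R) : summable_fam f ->
  (forall k, 0 <= f k) -> (\esum_(k in [set: K]) (f k)%:E = (isum f)%:E)%E.
Proof.
move=> sf f0; rewrite isum_ge0E// fineK// ge0_fin_numE; last first.
  by apply: esum_ge0 => k _; rewrite lee_fin.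
have /summable_famP := sf; congr (_ < _)%E.
by apply: eq_esum => k _; rewrite ger0_norm.
Qed.

Lemma isum_pair (f : J -> R) : summable_fam f ->
  isum f = isum (fun i : L => f (i, true)) + isum (fun i : L => f (i, false)).
Proof.
have ge0_pair (g : J -> R) : summable_fam g -> (forall k, 0 <= g k) ->
    isum g = isum (fun i : L => g (i, true)) + isum (fun i : L => g (i, false)).
  move=> sg g0; have [gt gf] := (summable_pair g).1 sg.
  apply: EFin_inj; rewrite EFinD -!esum_isum// esum_pair => [|k]; last first.
    by rewrite lee_fin.
  by rewrite esumD// => i _; rewrite lee_fin.
move=> sf; have sn := summable_norm sf.
(* A signed family is the difference of the two nonnegative summable families [g] and its absolute
   value. *)
pose g k := f k + `|f k|.
have fg k : f k = g k - `|f k| by rewrite /g addrK.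
have g0 k : 0 <= g k by rewrite /g -lerBlDl sub0r -normrN ler_norm.
have sg : summable_fam g by exact: summableD.
have [gt gf] := (summable_pair g).1 sg; have [nt nf] := (summable_pair _).1 sn.
rewrite (eq_isum fg) isumB// ge0_pair// (ge0_pair _ sn)//.
rewrite (eq_isum (f := fun i : L => f (i, true)) (fun i => fg (i, true))) isumB//.
rewrite (eq_isum (f := fun i : L => f (i, false)) (fun i => fg (i, false))) isumB//.
ring.
Qed.

Lemma rsum_isum (f : L -> R) : summable_fam f -> rsum f = isum f.
Proof.
move=> sf; rewrite /rsum /isum /Rintegral integralE fineB.
- by rewrite !integral_dcount.
- exact: integrable_pos_fin_num.
- exact: integrable_neg_fin_num.
Qed.

End sums_over_pairs.

(** * Real coordinates of complex families *)

Section coordinates.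
Context {R : realType} {d : nat} {l0 : freq d} {k0 : freq d * bool}.
Local Notation L := (discr l0).
Local Notation J := (discr k0).
Implicit Types (t : freq d -> R[i]) (x y : d.-tuple R).

Lemma normc_sqr (z : R[i]) : normc z ^+ 2 = complex.Re z ^+ 2 + complex.Im z ^+ 2.
Proof. by case: z => a b; rewrite /= sqr_sqrtr ?addr_ge0 ?sqr_ge0. Qed.

Lemma norm_Re_le (z : R[i]) : `|complex.Re z| <= normc z.
Proof.
case: z => a b /=; rewrite -sqrtr_sqr; apply: ler_wsqrtr.
by rewrite lerDl sqr_ge0.
Qed.

Lemma norm_Im_le (z : R[i]) : `|complex.Im z| <= normc z.
Proof.
case: z => a b /=; rewrite -sqrtr_sqr; apply: ler_wsqrtr.
by rewrite lerDr sqr_ge0.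
Qed.

Lemma normc_le (z : R[i]) : normc z <= `|complex.Re z| + `|complex.Im z|.
Proof.
rewrite -(@ler_sqr _ (normc z)) ?nnegrE ?normc_ge0 ?addr_ge0// normc_sqr.
by rewrite sqrrD !real_normK ?num_real// lerD2r lerDl mulrn_wge0// mulr_ge0.
Qed.

Definition coord t (k : J) : R := if k.2 then complex.Re (t k.1) else complex.Im (t k.1).

Lemma coord_step (w : freq d -> R) (g : R) s t :
  coord (fun l => s l - (g%:C)%C * weightop w t l) =
  (fun k => coord s k - g * (w k.1 * coord t k)).
Proof.
apply/funext => -[l b]; rewrite /coord /weightop /=.
by case: (s l) (t l) b => [? ?] [? ?] [] /=; rewrite !mul0r ?subr0 ?addr0.
Qed.

Lemma coordB s t : coord (fun l => s l - t l) = (fun k => coord s k - coord t k).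
Proof.
by apply/funext => -[l b]; rewrite /coord /=; case: (s l) (t l) b => [? ?] [? ?] [].
Qed.

Lemma summable_coordP t : summable_fam (coord t) <-> (l1norm t < +oo)%E.
Proof.
have -> : (l1norm t < +oo)%E = summable_fam (fun l : L => normc (t l)).
  rewrite /l1norm; apply/idP/idP => [h|/summable_famP].
    apply/summable_famP; rewrite (eq_esum (b := fun l => (normc (t l))%:E))//.
    by move=> l _; rewrite ger0_norm// normc_ge0.
  rewrite (eq_esum (b := fun l => (normc (t l))%:E))//.
  by move=> l _; rewrite ger0_norm// normc_ge0.
split=> [/(summable_pair (i0 := l0)) [sr si]|sn].
  apply: (summable_le (summableD (summable_norm sr) (summable_norm si))) => l.
  by rewrite ger0_norm ?normc_ge0// ger0_norm ?addr_ge0//; exact: normc_le.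
apply/(summable_pair (i0 := l0)); split; apply: (summable_le sn) => l.
  by rewrite [leRHS]ger0_norm ?normc_ge0//; exact: norm_Re_le.
by rewrite [leRHS]ger0_norm ?normc_ge0//; exact: norm_Im_le.
Qed.

Lemma fin_wenergy_coord (w : freq d -> R) t : (forall l, 0 < w l) ->
  (sqwnorm w t < +oo)%E -> fin_wenergy (fun k : J => w k.1) (coord t).
Proof.
move=> w0 h.
have wn0 l : 0 <= (w l)^-1 * normc (t l) ^+ 2.
  by rewrite mulr_ge0 ?sqr_ge0// ltW ?invr_gt0.
have sn : summable_fam (fun l : L => (w l)^-1 * normc (t l) ^+ 2).
  apply/summable_famP; rewrite (eq_esum (b := fun l => ((w l)^-1 * normc (t l) ^+ 2)%:E))//.
  by move=> l _; rewrite ger0_norm.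
have bnd (i a b : R) : 0 < i -> a ^+ 2 <= b ^+ 2 ->
    `|i^-1 * a ^+ 2| <= `|i^-1 * b ^+ 2|.
  move=> i0 ab; have iV : 0 <= i^-1 by rewrite invr_ge0 ltW.
  have p (z : R) : 0 <= i^-1 * z ^+ 2 by rewrite mulr_ge0 ?sqr_ge0.
  by rewrite (ger0_norm (p a)) (ger0_norm (p b)); exact: ler_wpM2l.
apply/(summable_pair (i0 := l0)); split; apply: (summable_le sn) => l;
  apply: (bnd _ _ (normc (t l)) (w0 l)); rewrite normc_sqr /coord /=.
  by rewrite lerDl sqr_ge0.
by rewrite lerDr sqr_ge0.
Qed.

Lemma l2norm_coord t : summable_fam (fun k : J => coord t k ^+ 2) ->
  l2norm t = (Num.sqrt (isum (fun k : J => coord t k ^+ 2)))%:E.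
Proof.
move=> s2; rewrite /l2norm.
have -> : (\esum_(l in [set: freq d]) (normc (t l) ^+ 2)%:E =
    (isum (fun k : J => coord t k ^+ 2))%:E)%E; last by [].
rewrite -(esum_isum s2) ?esum_pair => [|k|k]; rewrite ?lee_fin ?sqr_ge0//.
by apply: eq_esum => l _; rewrite normc_sqr EFinD.
Qed.

Lemma herm_coordP t : Defs.hermitian t <-> herm_coord (coord t).
Proof.
split=> [ht [l []]|ht l].
- by rewrite /coord /mode_opp /mode_sign /= ht; case: (t l) => a b /=; rewrite expr0 mul1r.
- by rewrite /coord /mode_opp /mode_sign /= ht; case: (t l) => a b /=; rewrite expr1 mulN1r.
have := ht (l, true); have := ht (l, false).
rewrite /coord /mode_opp /mode_sign /= expr0 expr1 mul1r mulN1r.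
by case: (t l) (t (freq_opp l)) => [a b] [a' b'] /= -> ->.
Qed.

Lemma measurable_mode (k : J) : measurable_fun setT (mode k : d.-tuple R -> R).
Proof. by case: (@bmf_mode R d k). Qed.

Lemma fourier_coord t x : summable_fam (coord t) ->
  complex.Re (fourier t x) = trig (mode : J -> _ -> R) (coord t) x.
Proof.
move=> st; have s1 : summable_fam (fun k : J => coord t k * mode k x).
  by apply: (summable_bound (M := 1)) => // k; exact: mode_le1.
have [sr si] := (summable_pair (i0 := l0) _).1 s1.
rewrite /trig (isum_pair (i0 := l0) s1) -isumD//.
rewrite -(rsum_isum (summableD sr si)) /fourier /csum /=; congr rsum.
apply/funext => l; rewrite /coord /mode /phi /=.
by case: (t l) => a b /=; rewrite mulrN.
Qed.

Lemma herm_grad (w : freq d -> R) (c : d.-tuple R -> d.-tuple R -> R) eps (t : J -> R) y :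
  (forall l, w (freq_opp l) = w l) ->
  herm_coord (fun k : J => w k.1 * grad (unif_cube d) eps c mode t y k).
Proof.
move=> ws -[l b]; rewrite /= ws mulrCA; congr (_ * _).
have modeN x : mode (mode_opp (l, b)) x = mode_sign (l, b) * mode (l, b) x.
  rewrite /mode /mode_opp /mode_sign /=.
  have -> : phase (freq_opp l) x = - phase l x.
    rewrite /phase -mulrN -sumrN; congr (_ * _); apply: eq_bigr => i _.
    by rewrite /= mxE rmorphN mulNr.
  by case: b; rewrite ?cosN ?sinN ?expr0 ?expr1 ?mul1r ?mulN1r.
rewrite /grad; under eq_Rintegral do rewrite modeN.
rewrite /mode_sign /=; case: b {modeN}.
  by rewrite expr0 mul1r; under eq_Rintegral do rewrite mul1r.
rewrite expr1 mulN1r -RintegralN.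
by apply: eq_Rintegral => x _; rewrite mulN1r mulrN.
Qed.

End coordinates.

Section entropic_gradient.
Context {R : realType} {d : nat} {l0 : freq d} {k0 : freq d * bool}.
Local Notation J := (discr k0).
Local Notation mu := (@unif_cube R d).
Local Notation md := (mode : J -> d.-tuple R -> R).
Local Notation co := (@coord R d k0).
Context (eps : R) (t : freq d -> R[i]) (y : d.-tuple R).
Hypothesis eps_gt0 : 0 < eps.
Hypothesis st : summable_fam (co t).

Let mm (k : J) : measurable_fun setT (md k).
Proof. exact: measurable_mode. Qed.

Let m1 (k : J) x : `|md k x| <= 1.
Proof. exact: mode_le1. Qed.

Let bt : bmf (trig md (co t)).
Proof. exact: bmf_trig. Qed.

Let bc : bmf ((@cube_cost R d)^~ y).
Proof. exact: (bmf_cost measurable_cube_cost (@cube_cost_le R d)). Qed.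

Lemma gibbs_coord x : cube d x ->
  gibbs eps t y x = boltz eps ((@cube_cost R d)^~ y) (trig md (co t)) x.
Proof.
move=> xc; rewrite /gibbs /boltz (fourier_coord (l0 := l0) _ st).
by rewrite /cube_cost indicE mem_set// mul1r.
Qed.

Lemma partition_fun_coord :
  partition_fun eps t y = pfun mu eps ((@cube_cost R d)^~ y) (trig md (co t)).
Proof.
rewrite /partition_fun /pfun; apply: mean_cube => [|x]; last exact: gibbs_coord.
exact: bmf_boltz.
Qed.

Lemma h_eps_coord : h_eps eps t y = fr mu eps (@cube_cost R d) md (co t) y.
Proof. by rewrite /h_eps partition_fun_coord. Qed.

(** Through the conjugate of [phi] in [Dh_eps], the imaginary part carries [- sin], which is the
    mode of index [(l, false)]; hence the complex recursion is the real one in coordinates. *)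
Lemma Dh_eps_coord (k : J) :
  co (Dh_eps eps t y) k = grad mu eps (@cube_cost R d) md (co t) y k.
Proof.
have bF : bmf (fun x => tilt mu eps ((@cube_cost R d)^~ y) (trig md (co t)) x * md k x).
  by apply: bmfM; [exact: bmf_tilt|exact: bmf_mode].
have FE x : cube d x ->
    F_eps eps t y x = tilt mu eps ((@cube_cost R d)^~ y) (trig md (co t)) x.
  by move=> xc; rewrite /F_eps /tilt gibbs_coord// partition_fun_coord.
rewrite /grad -(mean_cube bF (fun x _ => erefl)) /coord /Dh_eps /cintegral.
case: k {bF} => l b /=; case: b => /=; apply: eq_Rintegral => x; rewrite inE => xc;
  rewrite /mode FE//=; ring.
Qed.

End entropic_gradient.

(** * Integrability in the sample and optimality in real coordinates *)

Section optimality.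
Context {R : realType} {d : nat} {l0 : freq d} {k0 : freq d * bool}.
Local Notation J := (discr k0).
Local Notation mu := (@unif_cube R d).
Local Notation md := (mode : J -> d.-tuple R -> R).
Local Notation co := (@coord R d k0).
Local Notation fr eps := (fr mu eps (@cube_cost R d) md).
Context (eps : R) (Ycal : set (d.-tuple R)) (mYcal : measurable Ycal).
Context (nu : probability (d.-tuple R) R).
Hypothesis eps_gt0 : 0 < eps.
Hypothesis nuY : nu Ycal = 1%E.
Hypothesis nu_moment2 :
  (\int[nu]_(y in Ycal) (\sum_(i < d) tnth y i ^+ 2)%:E < +oo)%E.

Let mm (k : J) : measurable_fun setT (md k).
Proof. exact: measurable_mode. Qed.

Let m1 (k : J) x : `|md k x| <= 1.
Proof. exact: mode_le1. Qed.

Lemma fr_le (t : J -> R) y : summable_fam t ->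
  `|fr eps t y| <= norm1 t + cost_bound y + eps.
Proof.
move=> st; have bc := bmf_cost measurable_cube_cost (@cube_cost_le R d) y.
have bt : bmf (trig md t) by exact: bmf_trig.
have tl x : `|trig md t x| <= norm1 t by exact: trig_le.
have cl x := @cube_cost_le R d x y.
set M := norm1 t + cost_bound y.
have uc x : - M <= trig md t x - cube_cost x y <= M.
  by rewrite -ler_norml; apply: le_trans (ler_normB _ _) _; exact: lerD.
have pg := pfun_ge mu eps_gt0 bc bt (fun x => proj1 (andP (uc x))).
have pl := pfun_le mu eps_gt0 bc bt (fun x => proj2 (andP (uc x))).
have p0 := pfun_gt0 mu eps_gt0 bc bt.
have lg : - M <= eps * ln (pfun mu eps ((@cube_cost R d)^~ y) (trig md t)).
  rewrite mulrC -ler_pdivrMr// -[X in X <= _]expRK ler_ln ?posrE ?expR_gt0//.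
have ll : eps * ln (pfun mu eps ((@cube_cost R d)^~ y) (trig md t)) <= M.
  rewrite mulrC -ler_pdivlMr// -[X in _ <= X]expRK ler_ln ?posrE ?expR_gt0//.
apply: le_trans (ler_normD _ _) _; rewrite (gtr0_norm eps_gt0) lerD2r.
by rewrite ler_norml lg.
Qed.

Let nuYC : nu (~` Ycal) = 0%E.
Proof.
apply: etrans (probability_setC nu mYcal) _.
by apply: etrans (f_equal (fun z => 1 - z)%E nuY) _; rewrite subee.
Qed.

Let cost_bound_integrable : nu.-integrable setT (EFin \o (@cost_bound R d)).
Proof.
have -> : EFin \o (@cost_bound R d) = (fun y : d.-tuple R =>
    (cst (d%:R)%:E y + (\sum_(i < d) tnth y i ^+ 2)%:E))%E.
  by apply/funext => y.
have ms : measurable_fun setT (fun y : d.-tuple R => (\sum_(i < d) tnth y i ^+ 2)%:E).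
  apply/measurable_EFinP; apply: measurable_sum => i; apply: measurable_funX.
  exact: measurable_tnth.
have s0 (y : d.-tuple R) : (0 <= (\sum_(i < d) tnth y i ^+ 2)%:E)%E.
  by rewrite lee_fin; apply: sumr_ge0 => i _; exact: sqr_ge0.
apply: integrableD => //; first exact: finite_measure_integrable_cst.
apply/integrableP; split=> //.
under eq_integral do rewrite gee0_abs//.
rewrite (ge0_negligible_integral (N := ~` Ycal))//; last exact: measurableC.
by rewrite setTD setCK.
Qed.

Lemma fr_integrable (t : J -> R) : summable_fam t ->
  nu.-integrable setT (EFin \o fr eps t).
Proof.
move=> st; have ic := cost_bound_integrable.
have ib : nu.-integrable setT (fun y => (cst (norm1 t + eps)%:E y + (cost_bound y)%:E)%E).
  by apply: integrableD => //; exact: finite_measure_integrable_cst.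
apply: le_integrable ib => //.
  apply/measurable_EFinP.
  apply: (measurable_fr_param mu eps measurable_cube_cost mm (t := fun=> t) (y := id)) => //.
move=> y _; rewrite -[leRHS]/(`|norm1 t + eps + cost_bound y|%R%:E) lee_fin.
apply: le_trans (fr_le y st) _; rewrite addrAC; exact: ler_norm.
Qed.

Lemma H_eps_coord t : summable_fam (co t) ->
  H_eps eps nu Ycal t = \int[nu]_y fr eps (co t) y.
Proof.
move=> st; rewrite /H_eps.
transitivity (\int[nu]_(y in Ycal) fr eps (co t) y).
  by apply: eq_Rintegral => y _; exact: (h_eps_coord (l0 := l0)).
rewrite /Rintegral [in RHS](negligible_integral (N := ~` Ycal)).
- by rewrite setTD setCK.
- exact: measurableC.
- exact: measurableT.
- exact: fr_integrable.
- exact: nuYC.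
Qed.

Context (theta_eps : ell1 R d).
Hypothesis theta_min : forall t : ell1 R d,
  H_eps eps nu Ycal theta_eps <= H_eps eps nu Ycal t.

Lemma summable_ell1 (t : ell1 R d) : summable_fam (co t).
Proof. by apply/(summable_coordP (l0 := l0)); case: (ell1P t). Qed.

(** A hermitian real family is the coordinate family of an element of [ell1], to which minimality
    applies. The second moment of [nu] makes both integrals finite, so that their difference is the
    integral of the difference. *)
Lemma fr_optimal (t : J -> R) : herm_coord t -> summable_fam t ->
  0 <= \int[nu]_y (fr eps t y - fr eps (co theta_eps) y).
Proof.
move=> ht st; pose z l : R[i] := (t (l, true) +i* t (l, false))%C.
have coz : co z = t by apply/funext => -[l []].
have z1 : in_l1 z.
  split; last by apply/(summable_coordP (l0 := l0) (k0 := k0)); rewrite coz.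
  move=> l; rewrite /z; have := ht (l, true); have := ht (l, false).
  rewrite /mode_opp /mode_sign /= => -> ->.
  by rewrite expr0 expr1 mul1r mulN1r.
have := theta_min (Ell1 z1); rewrite !H_eps_coord ?coz//; last exact: summable_ell1.
rewrite -subr_ge0 -RintegralB//; apply: fr_integrable => //; exact: summable_ell1.
Qed.

End optimality.

Section gap_norms.
Context {R : realType} {d : nat} {l0 : freq d} {k0 : freq d * bool}.
Local Notation J := (discr k0).
Local Notation mu := (@unif_cube R d).
Local Notation md := (mode : J -> d.-tuple R -> R).
Local Notation co := (@coord R d k0).

Lemma summable_sqr (f : J -> R) : summable_fam f -> summable_fam (fun k => f k ^+ 2).
Proof.
move=> sf; have sn := summable_norm sf.
apply: (@summable_bound _ _ _ f f (isum (fun k : J => `|f k|)) sf) => k.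
(* A single term is the sum of a family concentrated at [k], hence at most the l1-norm; a summable
   family is thus bounded and its square summable. *)
have [s1 i1] := isum_pick (k0 := k0) `|f k| k; rewrite -[leLHS]i1.
apply: le_isum => // j; have [->|_] := eqVneq (j : freq d * bool) k.
  by rewrite mulr1.
by rewrite mulr0.
Qed.

Context (s t : freq d -> R[i]).
Hypothesis hs : Defs.hermitian s.
Hypothesis ht : Defs.hermitian t.
Hypothesis ss : summable_fam (co s).
Hypothesis st : summable_fam (co t).

Let gapE : trig_gap mu md (co s) (co t) = isum (fun k : J => (co s k - co t k) ^+ 2).
Proof. by apply: trig_gap_parseval => //; exact/herm_coordP. Qed.

Lemma l2norm_gap :
  l2norm (fun l => s l - t l) = (Num.sqrt (trig_gap mu md (co s) (co t)))%:E.
Proof.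
rewrite gapE (l2norm_coord (k0 := k0)) coordB//.
by apply: summable_sqr; exact: summableB.
Qed.

Lemma int_fourier_gap :
  (\int[mu]_(x in cube d) (normc (fourier s x - fourier t x) ^+ 2)%:E)%E =
  (trig_gap mu md (co s) (co t))%:E.
Proof.
have mm (k : J) : measurable_fun setT (md k) by exact: measurable_mode.
have m1 (k : J) x : `|md k x| <= 1 by exact: mode_le1.
have sst : summable_fam (fun k => co s k - co t k) by exact: summableB.
have hst : herm_coord (fun k => co s k - co t k).
  by rewrite -coordB; apply/herm_coordP => l; rewrite hs ht rmorphB.
rewrite gapE -(parseval sst hst) -int_cube; last first.
  by apply: bmf_sqr; exact: bmf_trig.
have ReB (z u : R[i]) : complex.Re (z - u) = complex.Re z - complex.Re u.
  by rewrite raddfB.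
have ImB (z u : R[i]) : complex.Im (z - u) = complex.Im z - complex.Im u.
  by rewrite raddfB.
apply: eq_integral => x _; congr (_%:E); rewrite normc_sqr (trigB m1)//.
by rewrite -!(fourier_coord (l0 := l0))// ReB ImB !fourier_real// subrr expr0n addr0.
Qed.

End gap_norms.

Local Open Scope complex_scope.

Theorem theorem3p1 (R : realType) (d : nat) (d_gt0 : (0 < d)%N)
    (eps : R) (eps_gt0 : 0 < eps)
    (Ycal : set (d.-tuple R)) (mYcal : measurable Ycal)
    (nu : probability (d.-tuple R) R) (nuY : nu Ycal = 1%E)
    (nu_moment2 :
      (\int[nu]_(y in Ycal) (\sum_(i < d) tnth y i ^+ 2)%:E < +oo)%E)
    (theta_eps : ell1 R d)
    (theta_min : forall t : ell1 R d,
      H_eps eps nu Ycal theta_eps <= H_eps eps nu Ycal t)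
    (w : freq d -> R) (w_gt0 : forall l, 0 < w l)
    (w_sym : forall l, w (freq_opp l) = w l)
    (w_sum : (\esum_(l in [set: freq d]) (w l)%:E < +oo)%E)
    (dO : measure_display) (Omega : measurableType dO)
    (P : probability Omega R)
    (Y : nat -> {RV P >-> d.-tuple R})
    (Y_law : forall n, (1 <= n)%N -> has_law (Y n) nu)
    (Y_indep : mutually_independent (fun n => Y n.+1))
    (gamma0 gamma c : R) (gamma0_gt0 : 0 < gamma0) (gamma_gt0 : 0 < gamma)
    (c_gt : 2^-1 < c) (c_le1 : c <= 1)
    (theta : nat -> Omega -> freq d -> R[i])
    (theta0_rand : l2_random_element (theta 0%N))
    (theta0_W : {ae P, forall om, (sqwnorm w (theta 0%N om) < +oo)%E})
    (theta_rec : forall n om l, theta n.+1 om l = theta n om l -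
      (step_size gamma0 gamma c n)%:C *
      weightop w (Dh_eps eps (theta n om) (Y n.+1 om)) l)
    (theta_eps_W : (sqwnorm w theta_eps < +oo)%E)
    (c_eps : R) (c_eps_gt0 : 0 < c_eps)
    (D2H_ge : forall tau : ell1 R d,
      (c_eps%:E * l2norm tau ^+ 2 <=
       (diff2 (fun t : ell1 R d => H_eps eps nu Ycal t) theta_eps tau tau)%:E)%E) :
  {ae P, forall om,
     l2norm (fun l => theta n om l - theta_eps l) @[n --> \oo] --> 0%E} /\
  {ae P, forall om,
     (\int[unif_cube d]_(x in cube d)
       (normc (fourier (theta n om) x - fourier theta_eps x) ^+ 2)%:E)%E
       @[n --> \oo] --> 0%E}.
Proof.
(* Positive dimension supplies a nonzero frequency, the base point of the discrete measurable
   spaces. *)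
have l0 : freq d.
  exists (const_mx 1); apply/eqP => /rowP /(_ (Ordinal d_gt0)).
  by rewrite !mxE.
pose k0 : freq d * bool := (l0, true).
pose W (k : discr k0) := w k.1.
pose co := @coord R d k0.
have W0 k : 0 < W k by exact: w_gt0.
have sW : summable_fam W.
  have sw : summable_fam (w : discr l0 -> R).
    apply/summable_famP; rewrite (eq_esum (b := fun l => (w l)%:E))//.
    by move=> l _; rewrite gtr0_norm.
  by apply/(summable_pair (i0 := l0)).
have srt : summable_fam (co theta_eps) by exact: (summable_ell1 (l0 := l0)).
have frt : fin_wenergy W (co theta_eps) by exact: (fin_wenergy_coord (l0 := l0)).
have hrt : Defs.hermitian theta_eps by case: (ell1P theta_eps).
have [G0 gm2] := step_size_sqr_summable gamma0_gt0 gamma_gt0 c_gt.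
have c01 : 0 <= c <= 1 by rewrite c_le1 andbT (le_trans _ (ltW c_gt)).
have gmdiv := step_size_divergent gamma0_gt0 gamma_gt0 c01.
have gm0 n : 0 <= step_size gamma0 gamma c n by rewrite ltW ?step_size_gt0.
pose mm (k : discr k0) := @measurable_mode R d k0 k.
have m1 (k : discr k0) x : `|mode k x| <= 1 :> R by exact: mode_le1.
have Hm_comb (a b : R) (s t : discr k0 -> R) : herm_coord s -> herm_coord t ->
    herm_coord (fun k => a * s k + b * t k).
  by move=> hs ht k; rewrite hs ht mulrDr; congr (_ + _); rewrite mulrCA.
have Hm_grad (t : discr k0 -> R) y :
    herm_coord (fun k => W k * grad (unif_cube d) eps (@cube_cost R d) mode t y k).
  exact: herm_grad.
have main := sgd_gap_cvg0 eps_gt0 measurable_cube_cost (@measurable_cost_bound R d)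
  (@cube_cost_le R d) mm m1 W0 sW gm0 gmdiv gm2 srt
  (fun n => Y_law n.+1 isT) Y_indep ((herm_coordP theta_eps).1 hrt) Hm_comb Hm_grad
  (fr_optimal (l0 := l0) (k0 := k0) mYcal eps_gt0 nuY nu_moment2 theta_min).
pose gap n om := trig_gap (unif_cube d) (mode : discr k0 -> _ -> R) (co (theta n om)) (co theta_eps).
have key : {ae P, forall om, (gap^~ om @ \oo --> 0) /\
    forall n, Defs.hermitian (theta n om) /\ summable_fam (co (theta n om))}.
  apply: filterS2 main theta0_W => om cvg0 fin0.
  have f0 : fin_wenergy W (fun k => co (theta 0%N om) k - co theta_eps k).
    have fN : fin_wenergy W (fun k => - co theta_eps k).
      by rewrite /fin_wenergy; under eq_fun do rewrite sqrrN.
    by apply: fin_energyD => //; exact: (fin_wenergy_coord (l0 := l0)).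
  have step n : summable_fam (co (theta n om)) ->
      co (theta n.+1 om) = sgd_step (unif_cube d) eps (@cube_cost R d) mode W
        (co (theta n om)) (Y n.+1 om) (step_size gamma0 gamma c n).
    move=> sn; rewrite /co (funext (theta_rec n om)) coord_step; apply/funext => k.
    rewrite /sgd_step; congr (_ - _ * (_ * _)).
    exact: (Dh_eps_coord (l0 := l0)).
  (* The coordinate form [step] of the recursion is available only for a summable iterate, so finite
     energy is propagated together with the hermitian symmetry in one induction. *)
  have fS n : fin_wenergy W (fun k => co (theta n om) k - co theta_eps k) /\
      herm_coord (co (theta n om)).
    elim: n => [|n [fn hn]].
      by split=> //; apply/herm_coordP; have [/(_ om) []] := theta0_rand.
    have sn := fin_energy_shift W0 sW srt fn.
    rewrite step//; split; first exact: (fin_energy_sgd _ _ measurable_cube_cost (@cube_cost_le R d)).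
    have := Hm_comb 1 (- step_size gamma0 gamma c n) _ _ hn
      (Hm_grad (co (theta n om)) (Y n.+1 om)).
    by rewrite /sgd_step; under eq_fun do rewrite mul1r mulNr.
  have sS n : summable_fam (co (theta n om)).
    have [fn _] := fS n; exact: (fin_energy_shift W0 sW srt fn).
  split=> [|n]; last by split=> //; apply/(herm_coordP (k0 := k0)); case: (fS n).
  by apply: (cvg0 (fun n => co (theta n om))) => // n; exact: step.
split; apply: filterS key => om [gap0 hS].
- rewrite (_ : (fun n => _) = (fun n => (Num.sqrt (gap n om))%:E)); last first.
    apply/funext => n; have [hn sn] := hS n.
    exact: l2norm_gap.
  apply: cvg_EFin; first by near=> n.
  rewrite -[X in _ --> X]sqrtr0.
  by apply: continuous_cvg => //; exact: sqrt_continuous.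
- rewrite (_ : (fun n => _) = (fun n => (gap n om)%:E)); last first.
    apply/funext => n; have [hn sn] := hS n.
    exact: (int_fourier_gap (l0 := l0)).
  by apply: cvg_EFin; [near=> n|exact: gap0].
Unshelve. all: by end_near.
Qed.
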